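(* Let $(\Omega,\mathcal F,P)$ be a probability space with a filtration $(\mathcal F_t)_{t=0}^T$ such that every set in $\mathcal F_0$ has probability zero or one. For $t=1,\dots,T$, let $K_t:\mathbb R^N\times\mathbb R^M\times\mathbb R^N\times\Omega\to\overline{\mathbb R}$ be an $\mathcal F_t$-measurable lower bounded convex normal integrand and let $J:\mathbb R^N\times\Omega\to\overline{\mathbb R}$ be an $\mathcal F_T$-measurable lower bounded convex normal integrand. Consider the problem $$(\mathrm P)\quad\text{minimize } E\Big[\sum_{t=1}^TK_t(X_{t-1},U_{t-1},X_t)+J(X_T)\Big]\ \text{ over } (X,U)\in\mathcal N$$ and the reduced Bellman equations $$(\mathrm{BE})\quad J_T=J,\qquad \tilde Q_t(X_t,U_t)=\inf_{X_{t+1}\in\mathbb R^N}\{K_{t+1}(X_t,U_t,X_{t+1})+J_{t+1}(X_{t+1})\},$$ $$J_t(X_t)=\inf_{U_t\in\mathbb R^M}(E_t\tilde Q_t)(X_t,U_t),\qquad t=0,\dots,T-1.$$ Assume that the set $$\Big\{(X,U)\in\mathcal N\ \Big|\ \sum_{t=1}^TK_t^\infty(X_{t-1},U_{t-1},X_t)+J^\infty(X_T)\le 0\ \text{a.s.}\Big\}$$ is a linear space. Then (P) has a solution $(\bar X,\bar U)\in\mathcal N$ and the Bellman equations (BE) have a unique lower bounded convex normal solution $((J_t)_{t=0}^T,(\tilde Q_t)_{t=0}^{T-1})$.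
   Context: $\overline{\mathbb R}=[-\infty,+\infty]$. A function $h:\mathbb R^n\times\Omega\to\overline{\mathbb R}$ is a ($\mathcal G$-measurable) normal integrand if $\omega\mapsto\operatorname{epi}h(\cdot,\omega)$ is a closed-valued ($\mathcal G$-)measurable set-valued mapping, i.e. $\{\omega\mid \operatorname{epi}h(\cdot,\omega)\cap O\ne\emptyset\}$ is measurable for every open $O\subset\mathbb R^{n}\times\mathbb R$; it is convex if $h(\cdot,\omega)$ is convex for each $\omega$. It is lower bounded if there is $m\in L^1$ with $h(x,\omega)\ge m(\omega)$ for all $x\in\mathbb R^n$ and almost every $\omega$. For a random variable $x$, $h(x)$ denotes $\omega\mapsto h(x(\omega),\omega)$; the argument $\omega$ is often suppressed. For a sub-$\sigma$-algebra $\mathcal G\subset\mathcal F$, the $\mathcal G$-conditional expectation $E^{\mathcal G}h$ of a lower bounded normal integrand $h$ is the ($\mathcal G$-measurable, a.s. unique) normal integrand such that $(E^{\mathcal G}h)(x)=E[h(x)\mid\mathcal G]$ a.s. for every $\mathcal G$-measurable $\mathbb R^n$-valued random variable $x$. $E_t:=E^{\mathcal F_t}$. $\mathcal N$ is the space of adapted processes $(X_t,U_t)_{t=0}^T$, i.e. $(X_t,U_t)$ is $\mathcal F_t$-measurable and $\mathbb R^N\times\mathbb R^M$-valued for each $t$ (no integrability is required). For a lower semicontinuous convex $g:\mathbb R^n\to\overline{\mathbb R}$, the recession function is $g^\infty(x)=\lim_{\alpha\to\infty}\frac{g(\bar x+\alpha x)-g(\bar x)}{\alpha}$ for any $\bar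 x\in\operatorname{dom}g$ (whenever $g^\infty$ is written, $\operatorname{dom} g\neq\emptyset$ is understood). For a convex normal integrand, $h^\infty(\cdot,\omega)$ is the recession function of $h(\cdot,\omega)$. A lower bounded convex normal solution of (BE) consists of lower bounded convex normal integrands $J_t$ on $\mathbb R^N\times\Omega$ and $\tilde Q_t$ on $\mathbb R^N\times\mathbb R^M\times\Omega$ such that, for almost every $\omega$, the equations hold for all $t$ and all $(X_t,U_t)\in\mathbb R^N\times\mathbb R^M$. Uniqueness is up to equality of the functions $J_t(\cdot,\omega)$, $\tilde Q_t(\cdot,\omega)$ for almost every $\omega$. A solution of (P) is an element of $\mathcal N$ attaining the infimum. *)

(* Defs.v *)
From HB Require Import structures.
From mathcomp Require Import all_boot all_order all_algebra.
From mathcomp Require Import all_classical all_reals all_analysis.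
From mathcomp Require Import measurable_realfun.

Set Implicit Arguments.
Unset Strict Implicit.
Unset Printing Implicit Defensive.

Import Order.TTheory GRing.Theory Num.Theory.
Import numFieldNormedType.Exports.

Local Open Scope classical_set_scope.
Local Open Scope ring_scope.
Local Open Scope ereal_scope.

Section extended_real_functions.
Context (R : realType) (V : normedModType R).
Implicit Type g : V -> \bar R.

Definition dom g : set V := [set x | g x < +oo].

Definition epi g : set (V * R^o) := [set p | g p.1 <= (p.2 : R)%:E].

(* Extended-real-valued functions, possibly taking both infinite values, are
   convex when their epigraph is. *)
Definition convex_ereal g := convex_set (epi g).

(* The base point is an arbitrary element of [dom g]; when [g] is proper, lower
   semicontinuous and convex the limit exists and does not depend on it.
   Only meaningful when [dom g] is nonempty. *)
Definition recession g (x : V) : \bar R :=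
  let xbar := xget 0%R (dom g) in
  lim ((g (xbar + a *: x)%R - g xbar) * (a^-1)%:E @[a --> +oo%R]).

End extended_real_functions.

Section sub_sigma_algebras.
Context d (Omega : measurableType d) (R : realType) (P : probability Omega R).
Implicit Types (G : set (set Omega)).

Definition sub_sigma_algebra G :=
  sigma_algebra [set: Omega] G /\ G `<=` (measurable : set (set Omega)).

Definition filtration (T : nat) (F : nat -> set (set Omega)) :=
  (forall t, (t <= T)%N -> sub_sigma_algebra (F t)) /\
  (forall s t, (s <= t <= T)%N -> F s `<=` F t).

(* Random vectors: the target carries its Borel sigma-algebra. *)
Definition random_vector (V : normedModType R) G (x : Omega -> V) :=
  measurable_fun [set: g_sigma_algebraType G]
    (x : g_sigma_algebraType G -> g_sigma_algebraType (@open V)).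

(* [g] is a version of E[f | G], for extended real-valued [f] with integrable
   negative part; no integrability of the positive part is required. *)
Definition is_cond_expectation G (f g : Omega -> \bar R) :=
  measurable_fun [set: g_sigma_algebraType G]
    (g : g_sigma_algebraType G -> \bar R) /\
  forall A, G A -> \int[P]_(w in A) g w = \int[P]_(w in A) f w.

Section normal_integrands.
Context (V : normedModType R).
Implicit Type h : V -> Omega -> \bar R.

Definition normal_integrand G h :=
  (forall w, closed (epi (h ^~ w))) /\
  (forall O : set (V * R^o), open O -> G [set w | epi (h ^~ w) `&` O !=set0]).

Definition convex_integrand h := forall w, convex_ereal (h ^~ w).

Definition lower_bounded h :=
  exists2 m : Omega -> R, P.-integrable [set: Omega] (EFin \o m) &
    {ae P, forall w, forall x, (m w)%:E <= h x w}.

Definition lb_convex_normal_integrand G h :=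
  [/\ normal_integrand G h, convex_integrand h & lower_bounded h].

(* [g] is a version of the G-conditional expectation of the integrand [h]. *)
Definition is_cond_expectation_integrand G h g :=
  normal_integrand G g /\
  forall x : Omega -> V, random_vector G x ->
    is_cond_expectation G (fun w => h (x w) w) (fun w => g (x w) w).

End normal_integrands.

(* Time-indexed families are indexed by [nat]; only the indices in the range
   relevant to the family (t <= T for X, U, J_t; 1 <= t <= T for K_t; t < T for
   Q_t) are ever constrained or used. *)
Section control.
Context (N M T : nat) (F : nat -> set (set Omega)).
Context (K : nat -> 'rV[R]_N * 'rV[R]_M * 'rV[R]_N -> Omega -> \bar R).
Context (J : 'rV[R]_N -> Omega -> \bar R).

Definition process :=
  ((nat -> Omega -> 'rV[R]_N) * (nat -> Omega -> 'rV[R]_M))%type.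

Definition adapted : set process :=
  [set Z | forall t, (t <= T)%N ->
     random_vector (F t) (fun w => (Z.1 t w, Z.2 t w))].

Definition cost (Z : process) : \bar R :=
  \int[P]_w (\sum_(1 <= t < T.+1) K t (Z.1 t.-1 w, Z.2 t.-1 w, Z.1 t w) w
             + J (Z.1 T w) w).

Definition solution (Z : process) :=
  adapted Z /\ forall Z', adapted Z' -> cost Z <= cost Z'.

Definition recession_directions : set process :=
  [set Z | adapted Z /\
     {ae P, forall w,
       \sum_(1 <= t < T.+1)
          recession (K t ^~ w) (Z.1 t.-1 w, Z.2 t.-1 w, Z.1 t w)
       + recession (J ^~ w) (Z.1 T w) <= 0}].

(* [EQ t] is the version of the F_t-conditional expectation of [Q t] entering
   the equations. Neither [Jt t] nor [Q t] is asked to be measurable for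
   anything smaller than the ambient sigma-algebra. *)
Definition bellman_solution (Jt : nat -> 'rV[R]_N -> Omega -> \bar R)
    (Q : nat -> 'rV[R]_N * 'rV[R]_M -> Omega -> \bar R) :=
  [/\ forall t, (t <= T)%N -> lb_convex_normal_integrand measurable (Jt t),
      forall t, (t < T)%N -> lb_convex_normal_integrand measurable (Q t) &
      exists2 EQ : nat -> 'rV[R]_N * 'rV[R]_M -> Omega -> \bar R,
        forall t, (t < T)%N ->
          is_cond_expectation_integrand (F t) (Q t) (EQ t) &
        {ae P, forall w,
          (forall x, Jt T x w = J x w) /\
          forall t, (t < T)%N -> forall (x : 'rV[R]_N) (u : 'rV[R]_M),
            Q t (x, u) w =
              ereal_inf [set K t.+1 (x, u, y) w + Jt t.+1 y w
                        | y in [set: 'rV[R]_N]] /\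
            Jt t x w =
              ereal_inf [set EQ t (x, v) w | v in [set: 'rV[R]_M]]}].

End control.
End sub_sigma_algebras.

(* Main.v *)
(* Dynamic programming. Suppose E_t Qtilde_t is a lower bounded convex normal
   integrand. Minimizing K_t(z, y) + (E_t Qtilde_t)(y, u) over (y, u) at a fixed
   stage gives Qtilde_(t-1), whose epigraph is the projection of a closed convex
   set. It is closed, and the minimum is attained, if the recession directions of
   that set lying in the kernel of the projection form a symmetric cone: points of
   minimal norm in the fibers then stay bounded. The symmetry holds almost surely
   because every measurable selection of such directions starts at time t from
   zero, extends to an adapted process of recession directions of the whole
   problem, and can be negated there. Recession directions pass through the
   conditional expectation of an integrand by Fatou's lemma, so this property
   propagates backward in time. Measurable selections of the minimizers then give
   an optimal process. Uniqueness follows, backward in time, from the a.s.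
   uniqueness of conditional expectations of integrands. *)

Require Import Defs.
From HB Require Import structures.
From mathcomp Require Import all_boot all_order all_algebra.
From mathcomp Require Import all_classical all_reals all_analysis.
From mathcomp Require Import measurable_realfun ring lra.
Set Implicit Arguments.
Unset Strict Implicit.
Unset Printing Implicit Defensive.
Import Order.TTheory GRing.Theory Num.Theory.
Import numFieldNormedType.Exports.
Local Open Scope classical_set_scope.
Local Open Scope ring_scope.

(** Nonempty domains are assumed for [K] and [J] only; E_t Qtilde_t may be identically +oo on an
    event of positive probability. Recession is therefore expressed through epigraphs: nonpositivity
    of the recession function at z becomes invariance of the epigraph under translation by (z, 0),
    and the cone of an empty epigraph is taken to be trivial. Since the recession functions of the
    data are nonnegative, the assumed inequality on their sum splits into one such condition per
    term. An almost sure statement about all directions or points of a random closed set is tested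
    on countably many measurable selections that are dense in it; closedness extends it to the whole
    set off a single null set. A normal integrand must nevertheless have a closed epigraph at every
    [w], so the functions of the Bellman equations are set to 0 outside a measurable set of full
    measure. Integrals may be +oo throughout; an integrable lower bound lets each be written as the
    integral of a nonnegative function plus a finite constant. *)

Section metric_characterizations.
Context {R : realType} {V : normedModType R}.

Lemma closed_normP (A : set V) :
  closed A <-> forall x, (forall e, 0 < e -> exists2 y, A y & `|x - y| < e) -> A x.
Proof.
split=> [cA x H|H x clAx].
  apply: cA => B /nbhs_ballP[e /= e0 eB].
  by have [y Ay xy] := H e e0; exists y; split => //; apply: eB; rewrite -ball_normE.
apply: H => e e0; have [y [Ay]] := clAx _ (nbhsx_ballx x e e0).
by rewrite -ball_normE => xy; exists y.
Qed.

Lemma open_normP (A : set V) :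
  open A <-> forall x, A x -> exists2 e, 0 < e & forall y, `|x - y| < e -> A y.
Proof.
rewrite openE; split=> H x /H.
  rewrite /interior => /nbhs_ballP[e /= e0 eA]; exists e => // y xy.
  by apply: eA; rewrite -ball_normE.
move=> [e e0 eA]; apply/nbhs_ballP; exists e => //= y; rewrite -ball_normE; exact: eA.
Qed.

End metric_characterizations.

Lemma dist_lt {R : realType} {V : normedModType R} (y x z : V) (a b : R) :
  `|x - y| < a -> `|y - z| < b -> `|x - z| < a + b.
Proof.
move=> xy yz; rewrite -[x - z](subrKA y) (le_lt_trans (ler_normD _ _))//.
exact: ltrD.
Qed.

Lemma dist_eq {R : realType} {V : normedModType R} (x y : V) :
  (forall e, 0 < e -> `|x - y| < e) -> x = y.
Proof.
move=> H; apply/eqP; rewrite -subr_eq0 -normr_le0; apply/ler_addgt0Pr => e e0.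
by rewrite add0r ltW // H.
Qed.

(* [cvg_pair] with a target filter that unifies with the neighborhoods of a pair. *)
Lemma cvg_pair_nbhs {T : Type} {F : set_system T} {FF : Filter F} {U V : topologicalType}
  (f : T -> U) (g : T -> V) (l : U) (m : V) : f x @[x --> F] --> l -> g x @[x --> F] --> m ->
  (f x, g x) @[x --> F] --> (l, m).
Proof. exact: cvg_pair. Qed.

Lemma cvg_pr1 {T : Type} {F : set_system T} {FF : Filter F} {U V : topologicalType}
  (f : T -> U * V) (l : U * V) : f x @[x --> F] --> l -> (f x).1 @[x --> F] --> l.1.
Proof. by move=> fl; apply: (cvg_comp _ _ fl); exact: cvg_fst. Qed.

Lemma cvg_pr2 {T : Type} {F : set_system T} {FF : Filter F} {U V : topologicalType}
  (f : T -> U * V) (l : U * V) : f x @[x --> F] --> l -> (f x).2 @[x --> F] --> l.2.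
Proof. by move=> fl; apply: (cvg_comp _ _ fl); exact: cvg_snd. Qed.

Definition cball {R : realType} {V : normedModType R} (x : V) (r : R) : set V :=
  [set v | `|x - v| <= r].

Lemma cball_closed {R : realType} {V : normedModType R} (x : V) (r : R) :
  closed (cball x r).
Proof.
apply/closed_normP => v H; rewrite /cball /=.
apply/ler_addgt0Pr => e e0; have [y xy vy] := H e e0.
rewrite -[x - v](subrKA y); apply: (le_trans (ler_normD _ _)).
by rewrite lerD // distrC ltW.
Qed.

(** * Finite-dimensional normed spaces *)

Section findim.
Context (R : realType).

(* The two consequences of finite dimension that are needed: bounded sets are
   relatively compact and there is a dense sequence. *)
Definition findim (V : normedModType R) :=
  (forall r : R, exists2 C : set V, compact C & forall v, `|v| <= r -> C v) /\
  exists q : nat -> V, forall v (e : R), 0 < e -> exists i, `|v - q i| < e.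

Lemma findim_cball (V : normedModType R) (x : V) (r : R) :
  findim V -> compact (cball x r).
Proof.
move=> [/(_ (`|x| + r))[C cC rC] _]; apply: (subclosed_compact _ cC).
  exact: cball_closed.
move=> v xv; apply: rC; rewrite addrC -lerBlDr.
by apply: le_trans xv; rewrite distrC (le_trans _ (lerB_dist _ _)).
Qed.

Lemma dense_of_count (V : normedModType R) (I : countType) (f : I -> V) :
  (forall v (e : R), 0 < e -> exists i, `|v - f i| < e) ->
  exists q : nat -> V, forall v (e : R), 0 < e -> exists i, `|v - q i| < e.
Proof.
move=> H; exists (fun n => oapp f 0 (unpickle n)) => v e /(H v)[i vi].
by exists (pickle i); rewrite pickleK.
Qed.

Lemma findim_R : findim (R^o : normedModType R).
Proof.
split.
  move=> r; exists (`[- r, r]%classic : set R); first exact: segment_compact.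
  by move=> v; rewrite ler_norml /= in_itv.
apply: (@dense_of_count _ rat (@ratr R)) => v e e0.
have [q] := @rat_in_itvoo R (v - e) (v + e) ltac:(lra).
rewrite in_itv /= => /andP[h1 h2]; exists q.
by rewrite ltr_norml; apply/andP; split; lra.
Qed.

Lemma findim_rV (n : nat) : findim ('rV[R]_n : normedModType R).
Proof.
split.
  move=> r; exists [set v : 'rV[R]_n | forall i, `[- r, r]%classic (v ord0 i)].
    by apply: (@rV_compact _ _ (fun=> `[- r, r]%classic)) => i; exact: segment_compact.
  move=> v vr i; rewrite /= in_itv /= -ler_norml (le_trans _ vr) //.
  rewrite [leRHS]/Num.Def.normr /= mx_normrE; apply/bigmax_geP; right => /=.
  by exists (ord0, i).
apply: (@dense_of_count _ 'rV[rat]_n (fun M => map_mx (@ratr R) M)) => v e e0.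
have H i : exists q : rat, `|v ord0 i - ratr q| < e.
  have [q] := @rat_in_itvoo R (v ord0 i - e) (v ord0 i + e) ltac:(lra).
  rewrite in_itv /= => /andP[h1 h2]; exists q.
  by rewrite ltr_norml; apply/andP; split; lra.
have [f fP] := choice H.
exists (\row_i f i); rewrite [ltLHS]/Num.Def.normr /= mx_normrE; apply/bigmax_ltP; split => //.
by move=> [i j] _ /=; rewrite !mxE ord1; exact: fP.
Qed.

Lemma findim_prod (V W : normedModType R) :
  findim V -> findim W -> findim ((V * W)%type : normedModType R).
Proof.
move=> [cV [q qP]] [cW [q' qP']]; split.
  move=> r; have [C cC rC] := cV r; have [D cD rD] := cW r.
  exists (C `*` D); first exact: compact_setX.
  by move=> [v w]; rewrite prod_normE /= ge_max => /andP[/rC ? /rD ?].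
apply: (@dense_of_count _ (nat * nat)%type (fun ij => (q ij.1, q' ij.2))) => -[v w] e e0.
have [i vi] := qP v e e0; have [j wj] := qP' w e e0.
by exists (i, j); rewrite prod_normE /= gt_max vi.
Qed.

End findim.
#[export] Hint Resolve findim_R findim_rV findim_prod : core.

(** * Sigma-algebras as bare families of sets, for each F_t and the ambient one alike *)

Section sigma_algebra_facts.
Context {T : Type} (G : set (set T)).
Hypothesis sG : sigma_algebra setT G.

Lemma sG0 : G set0. Proof. by case: sG. Qed.

Lemma sGC A : G A -> G (~` A).
Proof. by have [_ + _] := sG => /[apply]; rewrite setTD. Qed.

Lemma sGT : G setT. Proof. by rewrite -setC0; apply/sGC/sG0. Qed.

Lemma sGbigcup (A : nat -> set T) : (forall n, G (A n)) -> G (\bigcup_n A n).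
Proof. by have [_ _] := sG; apply. Qed.

Lemma sGU A B : G A -> G B -> G (A `|` B).
Proof. by move=> GA GB; rewrite -bigcup2E; apply: sGbigcup => -[|[|n]] //=; exact: sG0. Qed.

Lemma sGI A B : G A -> G B -> G (A `&` B).
Proof. by move=> /sGC GA /sGC GB; rewrite -[X in G X]setCK setCI; exact/sGC/sGU. Qed.

Lemma sG_ex (I : countType) (A : I -> T -> Prop) :
  (forall i, G [set w | A i w]) -> G [set w | exists i, A i w].
Proof.
move=> GA; rewrite (_ : [set _ | _] =
    \bigcup_n (if unpickle n is Some i then [set w | A i w] else set0)).
  by apply: sGbigcup => n; case: unpickle => [i|]; [exact: GA|exact: sG0].
rewrite predeqE => w; split => [[i Ai]|[n _]].
  by exists (pickle i) => //; rewrite pickleK.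
by case: unpickle => // i ?; exists i.
Qed.

Lemma sG_all (I : countType) (A : I -> T -> Prop) :
  (forall i, G [set w | A i w]) -> G [set w | forall i, A i w].
Proof.
move=> GA; have H i : G [set w | ~ A i w] by apply: sGC (GA i).
have /sGC := sG_ex H; congr (G _).
rewrite predeqE => w /=; split => [h i|h [i]]; last by apply; exact: h.
by apply: contrapT => nA; apply: h; exists i.
Qed.

Lemma sG_prop (Q : Prop) : G [set _ | Q].
Proof.
have [q|nq] := pselect Q.
  by rewrite (_ : [set _ | _] = setT); [exact: sGT|rewrite predeqE].
by rewrite (_ : [set _ | _] = set0); [exact: sG0|rewrite predeqE].
Qed.

Lemma sG_and (A B : T -> Prop) : G [set w | A w] -> G [set w | B w] ->
  G [set w | A w /\ B w].
Proof. exact: sGI. Qed.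

Lemma sG_eq (A B : T -> Prop) : (forall w, A w <-> B w) -> G [set w | A w] ->
  G [set w | B w].
Proof. by move=> AB; congr (G _); rewrite predeqE. Qed.

End sigma_algebra_facts.

(** * Measurable closed-valued maps *)

Section measurable_closed_maps.
Context {R : realType} {T : Type} (G : set (set T)).
Hypothesis sG : sigma_algebra setT G.

(** Effros measurability. For the epigraph map of an integrand this is exactly
    [normal_integrand]. *)
Definition measurable_cmap (V : normedModType R) (S : T -> set V) :=
  (forall w, closed (S w)) /\
  forall O : set V, open O -> G [set w | S w `&` O !=set0].

(** A closed set meets the compact [C] iff it meets every open neighborhood of [C] of radius
    1/(k+1): nearby points of [C] have a cluster point, and it lies in the closed set. *)
Lemma measurable_cmap_hit_compact (V : normedModType R) (S : T -> set V) (C : set V) :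
  measurable_cmap S -> compact C -> G [set w | S w `&` C !=set0].
Proof.
move=> [cS mS] cC.
pose O (k : nat) := [set v : V | exists2 c, C c & `|v - c| < k.+1%:R^-1].
have oO k : open (O k).
  apply/open_normP => x [c Cc xc]; exists (k.+1%:R^-1 - `|x - c|); first by rewrite subr_gt0.
  move=> y; rewrite distrC => xy; exists c => //.
  by rewrite -[ltRHS](subrK `|x - c|) -[y - c](subrKA x) (le_lt_trans (ler_normD _ _))// ltrD2r.
apply: (sG_eq _ (sG_all sG (fun k => mS _ (oO k)))) => w; split; last first.
  move=> [v [Sv Cv]] k; exists v; split => //; exists v => //; rewrite subrr normr0.
  by rewrite invr_gt0.
move=> H.
have H' k : exists sc : V * V, [/\ S w sc.1, C sc.2 & `|sc.1 - sc.2| < k.+1%:R^-1].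
  by have [s [Ss [c Cc sc]]] := H k; exists (s, c).
have [f fP] := choice H'.
have FC : ((fun k => (f k).2) @ \oo) C by exists 0%N => // k _ /=; case: (fP k).
have [c [Cc clc]] := cC _ _ FC.
exists c; split => //; move/closed_normP: (cS w); apply => e e0.
have e20 : 0 < e / 2 by rewrite divr_gt0.
have near2 : \forall k \near \oo, k.+1%:R^-1 < e / 2 := near_infty_natSinv_lt (PosNum e20).
pose E := [set c' | exists2 s, S w s & `|s - c'| < e / 2].
have FE : ((fun k => (f k).2) @ \oo) E.
  have [m _ mP] := near2; exists m => // k mk; exists (f k).1; case: (fP k) => // _ _.
  by move=> /lt_trans; apply; exact: mP.
have [z [[s Ss sz]]] := clc _ _ FE (nbhsx_ballx c _ e20).
rewrite -ball_normE /= => cz; exists s => //.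
by rewrite [e]splitr; apply: (dist_lt cz); rewrite distrC.
Qed.

(** The intersection of [D] and [O] is a countable union of compact sets: [D] intersected with small
    closed balls, centered in the dense sequence, that lie inside [O]. *)
Lemma measurable_cmap_hit (V : normedModType R) (S : T -> set V) (D O : set V) : findim V ->
  measurable_cmap S -> closed D -> open O -> G [set w | exists v, [/\ S w v, D v & O v]].
Proof.
move=> fV mS cD oO; have [_ [q qP]] := fV.
have K ik : G [set w | S w `&` (D `&` cball (q ik.1) ik.2.+1%:R^-1) !=set0 /\
                 cball (q ik.1) ik.2.+1%:R^-1 `<=` O].
  apply: sG_and => //; last exact: sG_prop.
  apply: measurable_cmap_hit_compact => //.
  have cB := findim_cball (V := V) (x := q ik.1) (r := ik.2.+1%:R^-1) fV.
  apply: (subclosed_compact _ cB).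
    by apply: closedI => //; exact: cball_closed.
  by move=> ? [].
apply: (sG_eq _ (sG_ex sG K)) => w; split.
  by move=> [ik [[v [Sv [Dv Bv]]] BO]]; exists v; split => //; exact: BO.
move=> [v [Sv Dv Ov]]; move/open_normP: oO => /(_ _ Ov)[e e0 eO].
have e20 : 0 < e / 2 by rewrite divr_gt0.
have [k _ /(_ _ (leqnn _)) /= kP] := near_infty_natSinv_lt (PosNum e20).
have [i vi] := qP v k.+1%:R^-1 ltac:(by rewrite invr_gt0).
exists (i, k); split.
  by exists v; split => //; split => //; rewrite /cball /= distrC ltW.
move=> y; rewrite /cball /= => iy; apply: eO.
by rewrite [e]splitr; apply: (@dist_lt _ _ (q i)); [exact: lt_trans kP|exact: le_lt_trans kP].
Qed.

Lemma measurable_cmap_nonempty (V : normedModType R) (S : T -> set V) :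
  measurable_cmap S -> G [set w | S w !=set0].
Proof.
move=> [_ /(_ _ openT)]; apply: sG_eq => w.
by rewrite setIT.
Qed.

Lemma measurable_cmap_map (V W : normedModType R) (S : T -> set V) (D : set V)
  (phi : V -> W) (S' : T -> set W) : findim V ->
  measurable_cmap S -> closed D -> continuous phi -> (forall w, closed (S' w)) ->
  (forall w u, S' w u <-> exists v, [/\ S w v, D v & phi v = u]) -> measurable_cmap S'.
Proof.
move=> fV mS cD cphi cS' S'E; split=> // O oO.
have oO' : open (phi @^-1` O) by apply: open_comp => // ? _; exact: cphi.
apply: (sG_eq _ (measurable_cmap_hit fV mS cD oO')) => w; split.
  by move=> [v [Sv Dv Ov]]; exists (phi v); split => //; apply/S'E; exists v.
by move=> [u [/S'E[v [Sv Dv <-]] Ou]]; exists v.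
Qed.

Lemma measurable_cmap_prod (V W : normedModType R) (S : T -> set V) (S' : T -> set W) :
  findim V -> findim W ->
  measurable_cmap S -> measurable_cmap S' -> measurable_cmap (fun w => S w `*` S' w : set (V * W)%type).
Proof.
move=> [_ [q qP]] [_ [q' qP']] [cS mS] [cS' mS']; split.
  move=> w; apply/closed_normP => -[x y] H; split => /=.
    move/closed_normP: (cS w); apply => e /H[[x' y'] [/= Sx _]].
    by rewrite prod_normE /= gt_max => /andP[? _]; exists x'.
  move/closed_normP: (cS' w); apply => e /H[[x' y'] [/= _ Sx]].
  by rewrite prod_normE /= gt_max => /andP[_ ?]; exists y'.
move=> O oO.
have H (ijk : nat * nat * nat) : G [set w |
     [/\ S w `&` ball (q ijk.1.1) ijk.2.+1%:R^-1 !=set0,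
         S' w `&` ball (q' ijk.1.2) ijk.2.+1%:R^-1 !=set0 &
     (ball (q ijk.1.1) ijk.2.+1%:R^-1 `*` ball (q' ijk.1.2) ijk.2.+1%:R^-1 `<=` O)]].
  rewrite (_ : [set _ | _] = [set w | S w `&` ball (q ijk.1.1) ijk.2.+1%:R^-1 !=set0]
    `&` ([set w | S' w `&` ball (q' ijk.1.2) ijk.2.+1%:R^-1 !=set0] `&`
      [set w | (ball (q ijk.1.1) ijk.2.+1%:R^-1 `*` ball (q' ijk.1.2) ijk.2.+1%:R^-1 `<=` O)])).
    apply: sGI => //; first exact: mS (ball_open _ _).
    by apply: sGI => //; [exact: mS' (ball_open _ _)|exact: sG_prop].
  by rewrite predeqE => w; split => [[]|[? []]].
apply: (sG_eq _ (sG_ex sG H)) => w; split.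
  move=> [[[i j] k] [[v [Sv Bv]] [u [Su Bu]] BO]].
  by exists (v, u); split => //; exact: BO.
move=> [[v u] [[/= Sv Su] Ou]]; move/open_normP: oO => /(_ _ Ou)[e e0 eO].
have e20 : 0 < e / 2 by rewrite divr_gt0.
have [k _ /(_ _ (leqnn _)) /= kP] := near_infty_natSinv_lt (PosNum e20).
have k0 : 0 < k.+1%:R^-1 :> R by rewrite invr_gt0.
have [i vi] := qP v k.+1%:R^-1 k0.
have [j uj] := qP' u k.+1%:R^-1 k0.
exists (i, j, k); split => /=.
- by exists v; split => //; rewrite -ball_normE /= distrC.
- by exists u; split => //; rewrite -ball_normE /= distrC.
move=> [x y] [] /=; rewrite -!ball_normE /= => ix jy; apply: eO.
rewrite prod_normE /= gt_max; apply/andP; split.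
  by rewrite [e]splitr; apply: (@dist_lt _ _ (q i)); exact: lt_trans kP.
by rewrite [e]splitr; apply: (@dist_lt _ _ (q' j)); exact: lt_trans kP.
Qed.

Lemma measurable_cmap_cst (V : normedModType R) (A : set V) : closed A -> measurable_cmap (fun=> A).
Proof. by move=> cA; split => // O oO; exact: sG_prop. Qed.

Lemma measurable_cmap_setU (V : normedModType R) (S S' : T -> set V) :
  measurable_cmap S -> measurable_cmap S' -> measurable_cmap (fun w => S w `|` S' w).
Proof.
move=> [cS mS] [cS' mS']; split => [w|O oO]; first exact: closedU.
apply: (sG_eq _ (sGU sG (mS O oO) (mS' O oO))) => w; split.
  by move=> [] [v [Sv Ov]]; exists v; split => //; [left|right].
by move=> [v [[Sv|Sv] Ov]]; [left|right]; exists v.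
Qed.

(** The intersection is the first projection of the part of the product on the diagonal. *)
Lemma measurable_cmap_setI (V : normedModType R) (S S' : T -> set V) : findim V ->
  measurable_cmap S -> measurable_cmap S' -> measurable_cmap (fun w => S w `&` S' w).
Proof.
move=> fV mS mS'.
apply: (@measurable_cmap_map (V * V)%type V _ [set p | p.1 = p.2] fst _ _ (measurable_cmap_prod fV fV mS mS')) => //.
- by apply: findim_prod.
- apply/closed_normP => -[x y] H /=; apply: dist_eq => e e0.
  have [[x' _] /= <-] := H (e / 2) ltac:(by rewrite divr_gt0).
  rewrite prod_normE /= gt_max => /andP[xx yx].
  by rewrite [e]splitr; apply: (dist_lt xx); rewrite distrC.
- by move=> x; exact: cvg_fst.
- by move=> w; apply: closedI; [case: mS|case: mS'].
- move=> w u; split; first by move=> [? ?]; exists (u, u).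
  by move=> [[x y] [[/= ? ?] /= xy <-]]; split => //=; rewrite xy.
Qed.

(** By compactness a closed ball meets the whole intersection iff it meets each finite intersection
    [I n], and [O] is a countable union of such balls. *)
Lemma measurable_cmap_bigcap (V : normedModType R) (S : nat -> T -> set V) : findim V ->
  (forall n, measurable_cmap (S n)) -> measurable_cmap (fun w => \bigcap_n S n w).
Proof.
move=> fV mS.
pose I := fix I n := if n is m.+1 then fun w => S m.+1 w `&` I m w else S 0%N.
have mI n : measurable_cmap (I n) by elim: n => [|n IH] /=; [exact: mS|exact: measurable_cmap_setI].
have IE n w v : I n w v <-> forall k, (k <= n)%N -> S k w v.
  elim: n => [|n IH] /=; split.
  - by move=> ? k; rewrite leqn0 => /eqP ->.
  - exact.
  - move=> [Sv /IH h] k; rewrite leq_eqVlt => /orP[/eqP -> //|]; rewrite ltnS; exact: h.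
  - by move=> h; split; [exact: h|apply/IH => k kn; apply: h; rewrite (leq_trans kn)].
have cI w : closed (\bigcap_n S n w) by apply: closed_bigI => n _; case: (mS n).
split => // O oO.
have [_ [q qP]] := fV.
have H ik : G [set w | (forall n, I n w `&` cball (q ik.1) ik.2.+1%:R^-1 !=set0) /\
                 cball (q ik.1) ik.2.+1%:R^-1 `<=` O].
  apply: sG_and => //; last exact: sG_prop.
  apply: sG_all => // n; apply: measurable_cmap_hit_compact => //; exact: findim_cball.
apply: (sG_eq _ (sG_ex sG H)) => w; split.
  move=> [[i k] /= [h BO]].
  have [f fP] := choice h.
  have FC : (f @ \oo) (cball (q i) k.+1%:R^-1).
    by exists 0%N => // n _ /=; case: (fP n).
  have [v [Bv clv]] := findim_cball fV _ FC.
  exists v; split; last exact: BO.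
  move=> n _; move/closed_normP: (proj1 (mS n) w); apply => e e0.
  have FS : (f @ \oo) (S n w).
    by exists n => // m /= nm; have [/IE + _] := fP m; apply.
  have [z [Sz]] := clv _ _ FS (nbhsx_ballx v _ e0).
  by rewrite -ball_normE /=; exists z.
move=> [v [Sv Ov]]; move/open_normP: oO => /(_ _ Ov)[e e0 eO].
have e20 : 0 < e / 2 by rewrite divr_gt0.
have [k _ /(_ _ (leqnn _)) /= kP] := near_infty_natSinv_lt (PosNum e20).
have [i vi] := qP v k.+1%:R^-1 ltac:(by rewrite invr_gt0).
exists (i, k); split.
  move=> n; exists v; split; first by apply/IE => ? _; exact: Sv.
  by rewrite /cball /= distrC ltW.
move=> y; rewrite /cball /= => iy; apply: eO.
by rewrite [e]splitr; apply: (@dist_lt _ _ (q i)); [exact: lt_trans kP|exact: le_lt_trans kP].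
Qed.

(* [random_vector] without the [measurableType] wrapper, so that it makes sense
   for any family [G]. *)
Definition rv (V : normedModType R) (x : T -> V) :=
  forall O : set V, open O -> G (x @^-1` O).

Lemma measurable_cmap_rv (V : normedModType R) (x : T -> V) : rv x -> measurable_cmap (fun w => [set x w]).
Proof.
move=> mx; split => [w|O oO].
  by apply/closed_normP => v H; apply: dist_eq => e /H[_ ->].
apply: (sG_eq _ (mx O oO)) => w; split => [Ow|[_ [-> ?//]]].
by exists (x w).
Qed.

Lemma rv_comp (V W : normedModType R) (x : T -> V) (phi : V -> W) :
  continuous phi -> rv x -> rv (phi \o x).
Proof.
move=> cphi mx O oO; rewrite comp_preimage; apply: mx.
by apply: open_comp => // ? _; exact: cphi.
Qed.

Lemma rv_cst (V : normedModType R) (v : V) : rv (fun=> v).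
Proof. by move=> O _; exact: sG_prop. Qed.

Lemma rv_if (V : normedModType R) (A : set T) (x y : T -> V) : G A ->
  rv x -> rv y -> rv (fun w => if `[<A w>] then x w else y w).
Proof.
move=> GA mx my O oO.
apply: (sG_eq _ (sGU sG (sGI sG GA (mx O oO)) (sGI sG (sGC sG GA) (my O oO)))) => w.
rewrite /preimage /=; split => [[[Aw h]|[Aw h]]|]; first by rewrite asboolT.
  by rewrite asboolF.
by case: asboolP => Aw h; [left|right].
Qed.

Lemma rv_pair (V W : normedModType R) (x : T -> V) (y : T -> W) :
  findim V -> findim W -> rv x -> rv y -> rv (fun w => (x w, y w) : (V * W)%type).
Proof.
move=> fV fW /measurable_cmap_rv mx /measurable_cmap_rv my O oO.
have [_ /(_ O oO)] := measurable_cmap_prod fV fW mx my.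
apply: sG_eq => w; split => [[[a b] [[/= -> ->]]]//|h].
by exists (x w, y w).
Qed.

End measurable_closed_maps.

(** * Measurable selections and Castaing representations *)

Section selection.
Context {R : realType} {T : Type} (G : set (set T)).
Hypothesis sG : sigma_algebra setT G.

Definition least (A : nat -> Prop) : nat :=
  xget 0%N [set i | A i /\ forall j, (j < i)%N -> ~ A j].

Lemma least_ex (A : nat -> Prop) : (exists i, A i) ->
  exists i, A i /\ forall j, (j < i)%N -> ~ A j.
Proof.
move=> [i Ai]; have exA : exists i, `[< A i >] by exists i; exact/asboolP.
case: (ex_minnP exA) => m /asboolP Am mmin; exists m; split=> // j jm /asboolP /mmin.
by rewrite leqNgt jm.
Qed.

Lemma leastP (A : nat -> Prop) : (exists i, A i) -> A (least A).
Proof. by move=> /least_ex /(xgetPex 0%N)[]. Qed.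

Lemma G_least (A : T -> nat -> Prop) i : (forall i, G [set w | A w i]) ->
  G [set w | least (A w) = i].
Proof.
move=> GA.
have GB k : G [set w | A w k /\ forall j : 'I_k, ~ A w j].
  apply: sG_and => //; apply: sG_all => // j; exact: (sGC sG (GA _)).
(* The value 0 is also the default of [least] when no index qualifies, so the event for [i = 0] has
   this second piece. *)
have GN : G [set w | i = 0%N /\ forall j : nat, ~ A w j].
  apply: sG_and => //; first exact: sG_prop.
  by apply: sG_all => // j; exact: (sGC sG (GA _)).
apply: (sG_eq _ (sGU sG (GB i) GN)) => w; split.
  move=> [[Ai mi]|[-> N]].
    have [Al ml] : A w (least (A w)) /\ forall j, (j < least (A w))%N -> ~ A w j.
      split; first by apply: leastP; exists i.
      move=> j; rewrite /least; case: xgetP => [k -> [_ mk]|_]; [exact: mk|by []].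
    apply/eqP; case: ltngtP => // [ji|ij]; first by have := mi (Ordinal ji).
    by have := ml _ ij.
  by rewrite /least; case: xgetP => // j -> [/N].
move=> <-; rewrite /least; case: xgetP => [j -> [Aj mj]|NA].
  by left; split => // k; exact: (mj k (ltn_ord k)).
right; split => // j Aj.
by have [k kk] := least_ex (ex_intro (A w) j Aj); exact: (NA k kk).
Qed.

Let r (k : nat) : R := (2 ^ k)%:R^-1.

Let r0 k : 0 < r k. Proof. by rewrite invr_gt0 ltr0n expn_gt0. Qed.

Let rS k : r k = r k.+1 + r k.+1.
Proof. by rewrite [LHS]splitr /r expnSr natrM invfM. Qed.

Let r_lt (e : R) : 0 < e -> exists k, r k < e.
Proof.
move=> e0; have [k _ /(_ _ (leqnn _)) /= kP] := near_infty_natSinv_lt (PosNum e0).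
exists k; apply: le_lt_trans kP; rewrite lef_pV2 ?posrE ?ltr0n ?expn_gt0//.
by rewrite ler_nat ltn_expl.
Qed.

Context {V : normedModType R}.
Hypothesis fV : findim V.

(** The Kuratowski and Ryll-Nardzewski construction: at level [k] take the least center whose ball
    of radius [r k] meets [S w] inside the previous ball. The centers form a Cauchy sequence whose
    limit adheres to [S w]. Closedness of [S w] is left out so that the lemma applies to its
    intersection with an open ball. *)
Lemma measurable_selection_closure (S : T -> set V) :
  (forall O : set V, open O -> G [set w | S w `&` O !=set0]) ->
  exists2 x : T -> V, rv G x & forall w, S w !=set0 -> closure (S w) (x w).
Proof.
move=> mS; have [_ [q qP]] := fV.
pose idx := fix idx (k : nat) (w : T) : nat :=
  if k is k'.+1 then
    least (fun i => S w `&` (ball (q i) (r k) `&` ball (q (idx k' w)) (r k')) !=set0)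
  else least (fun i => S w `&` ball (q i) (r 0) !=set0).
have G_idx k i : G [set w | idx k w = i].
  elim: k i => [|k IH] i /=; first by apply: G_least => j; exact: mS (ball_open _ _).
  apply: G_least => j.
  have H m : G [set w | idx k w = m /\ S w `&` (ball (q j) (r k.+1) `&` ball (q m) (r k)) !=set0].
    apply: sG_and => //.
    by apply: mS; apply: openI; exact: ball_open.
  apply: (sG_eq _ (sG_ex sG H)) => w; split => [[m [<- //]]|h].
  by exists (idx k w).
have idxP w k : S w !=set0 -> S w `&` ball (q (idx k w)) (r k) !=set0.
  move=> Sw; elim: k => [|k IH] /=.
    apply: (@leastP (fun i => S w `&` ball (q i) (r 0) !=set0)).
    case: Sw => v Sv; have [i vi] := qP v (r 0) (r0 _).
    by exists i, v; split => //; rewrite -ball_normE /= distrC.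
  have [v [Sv [Bv _]]] : S w `&` (ball (q (idx k.+1 w)) (r k.+1) `&` ball (q (idx k w)) (r k)) !=set0.
    apply: (@leastP (fun i => S w `&` (ball (q i) (r k.+1) `&` ball (q (idx k w)) (r k)) !=set0)).
    case: IH => v [Sv kv]; have [i vi] := qP v (r k.+1) (r0 _).
    by exists i, v; split => //; split => //; rewrite -ball_normE /= distrC.
  by exists v.
have stepP w k : S w !=set0 -> `|q (idx k w) - q (idx k.+1 w)| < r k + r k.+1.
  move=> Sw.
  have [v [Sv []]] : S w `&` (ball (q (idx k.+1 w)) (r k.+1) `&` ball (q (idx k w)) (r k)) !=set0.
    apply: (@leastP (fun i => S w `&` (ball (q i) (r k.+1) `&` ball (q (idx k w)) (r k)) !=set0)).
    have [v [Sv kv]] := idxP w k Sw; have [i vi] := qP v (r k.+1) (r0 _).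
    by exists i, v; split => //; split => //; rewrite -ball_normE /= distrC.
  rewrite -!ball_normE /= => h1 h2; apply: dist_lt h2 _; by rewrite distrC.
(* One step moves the center by less than [r k + r k.+1], which equals [3 * r k - 3 * r k.+1]; the
   bounds telescope. *)
have distP w k m : S w !=set0 -> `|q (idx k w) - q (idx (k + m)%N w)| <= 3 * r k - 3 * r (k + m)%N.
  move=> Sw; elim: m => [|m IH]; first by rewrite addn0 !subrr normr0.
  rewrite addnS -[_ - q (idx (k + m).+1 w)](subrKA (q (idx (k + m)%N w))).
  rewrite (le_trans (ler_normD _ _))//.
  have := stepP w (k + m)%N Sw; have := rS (k + m); lra.
have limP w : exists x, S w !=set0 -> forall k, `|q (idx k w) - x| <= 4 * r k.
  have [Sw|/asboolPn nS] := pselect (S w !=set0); last by exists 0 => /asboolP; rewrite (negbTE nS).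
  pose f k := q (idx k w).
  have FC : (f @ \oo) (cball (q (idx 0 w)) 3).
    exists 0%N => // k _ /=; rewrite /cball /=; have := distP w 0%N k Sw.
    rewrite add0n => /le_trans; apply; have := r0 k.
    by rewrite /r expn0 invr1; lra.
  have [x [_ clx]] := findim_cball fV _ FC.
  exists x => _ k; apply/ler_addgt0Pr => e e0.
  have FB : (f @ \oo) (cball (q (idx k w)) (3 * r k)).
    exists k => // m /= km; rewrite /cball /=; have := distP w k (m - k)%N Sw.
    rewrite subnKC // => /le_trans; apply; have := r0 m; lra.
  have [z [fz]] := clx _ _ FB (nbhsx_ballx x _ e0).
  rewrite -ball_normE /= => xz; rewrite -[_ - x](subrKA z) (le_trans (ler_normD _ _))//.
  rewrite [`|z - x|]distrC; move: fz; rewrite /cball /=; have := r0 k; lra.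
have [x0 x0P] := choice limP.
exists (fun w => if `[< S w !=set0 >] then x0 w else 0); last first.
  move=> w Sw; rewrite asboolT // => B /nbhs_ballP[e /= e0 eB].
  have [k ke] := r_lt (divr_gt0 e0 (ltr0n R 5)).
  have [s [Ss sk]] := idxP w k Sw.
  exists s; split => //; apply: eB; rewrite -ball_normE /=.
  rewrite -[_ - s](subrKA (q (idx k w))) (le_lt_trans (ler_normD _ _))//.
  move: sk; rewrite -ball_normE /= => sk; have := x0P w Sw k; rewrite distrC; lra.
have GS : G [set w | S w !=set0].
  by move: (mS _ openT); apply: sG_eq => w; rewrite setIT.
suff H O : open O -> G [set w | S w !=set0 /\ O (x0 w)].
  move=> O oO.
  apply: (sG_eq _ (sGU sG (H O oO) (sGI sG (sGC sG GS) (sG_prop sG (O 0))))) => w.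
  rewrite /preimage /=; split => [[[h1 h2]|[h1 h2]]|]; first by rewrite asboolT.
    by rewrite asboolF.
  by case: asboolP => Aw h; [left|right].
move=> oO.
(* The limit [x0] comes from choice, so its measurability is read off the indices: [x0 w] is in [O]
   iff for some [k] the ball of radius [4 * r k] around the [k]-th center lies in [O]. *)
have H ki : G [set w | S w !=set0 /\ (cball (q ki.2) (4 * r ki.1) `<=` O /\ idx ki.1 w = ki.2)].
  apply: sG_and => //; apply: sG_and => //; exact: sG_prop.
apply: (sG_eq _ (sG_ex sG H)) => w; split.
  move=> [[k i] [Sw /= [BO ki]]]; split => //; apply: BO; rewrite /cball /= -ki; exact: x0P.
move=> [Sw Ox]; move/open_normP: oO => /(_ _ Ox)[e e0 eO].
have [k ke] := r_lt (divr_gt0 e0 (ltr0n R 8)).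
exists (k, idx k w); split => //; split => //= y; rewrite /cball /= => ky; apply: eO.
rewrite -[_ - y](subrKA (q (idx k w))) (le_lt_trans (ler_normD _ _))//.
have := x0P w Sw k; rewrite distrC; lra.
Qed.

Lemma measurable_selection (S : T -> set V) : measurable_cmap G S ->
  exists2 x : T -> V, rv G x & forall w, S w !=set0 -> S w (x w).
Proof.
move=> [cS mS]; have [x mx xP] := measurable_selection_closure mS.
by exists x => // w /xP; rewrite -(proj1 (closure_id _) (cS w)).
Qed.

(** For each ball of a countable base, select in the closure of [S w] intersected with the ball
    where this is nonempty, and fall back on a fixed selection elsewhere. *)
Lemma castaing (S : T -> set V) : measurable_cmap G S ->
  exists x : nat -> T -> V, [/\ forall i, rv G (x i),
    forall i w, S w !=set0 -> S w (x i w) &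
    forall w v (e : R), S w v -> 0 < e -> exists i, `|v - x i w| < e].
Proof.
move=> mcS; have [cS mS] := mcS; have [_ [q qP]] := fV.
have [y my yP] := measurable_selection mcS.
have H (ik : nat * nat) : exists x : T -> V, [/\ rv G x, forall w, S w !=set0 -> S w (x w) &
    forall w, S w `&` ball (q ik.1) (r ik.2) !=set0 -> `|q ik.1 - x w| <= r ik.2].
  pose S' w := S w `&` ball (q ik.1) (r ik.2).
  have mS' O : open O -> G [set w | S' w `&` O !=set0].
    move=> oO; have := mS _ (openI (ball_open (q ik.1) (r ik.2)) oO).
    by apply: sG_eq => w; rewrite /S' setIA.
  have [x mx xP] := measurable_selection_closure mS'.
  have GS' : G [set w | S' w !=set0].
    by move: (mS' _ openT); apply: sG_eq => w; rewrite setIT.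
  exists (fun w => if `[< S' w !=set0 >] then x w else y w); split.
  - exact: rv_if.
  - move=> w Sw; case: asboolP => S'w; last exact: yP.
    have /closureI[] := xP w S'w.
    by rewrite -(proj1 (closure_id _) (cS w)).
  - move=> w S'w; rewrite asboolT //.
    have /closureI[_ +] := xP w S'w.
    have : ball (q ik.1) (r ik.2) `<=` cball (q ik.1) (r ik.2).
      by move=> v; rewrite -ball_normE /cball /= => /ltW.
    move/closure_subset; rewrite -(proj1 (closure_id _) (@cball_closed _ _ _ _)); exact.
have [f fP] := choice H.
exists (fun n => oapp f y (unpickle n)); split.
- by move=> n; case: unpickle => [ik|] //=; case: (fP ik).
- by move=> n w Sw; case: unpickle => [ik|] /=; [case: (fP ik) => _ + _; exact|exact: yP].
- move=> w v e Sv e0; have [k ke] := r_lt (divr_gt0 e0 (ltr0n R 2)).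
  have [i vi] := qP v (r k) (r0 k).
  exists (pickle (i, k)); rewrite pickleK /=.
  have [_ _ /(_ w)] := fP (i, k).
  have h : S w `&` ball (q i) (r k) !=set0.
    by exists v; split => //; rewrite -ball_normE /= distrC.
  move=> /(_ h) /= ix.
  by rewrite -[_ - _](subrKA (q i)) (le_lt_trans (ler_normD _ _))//; lra.
Qed.

End selection.

(** * Limits along ultrafilters *)

Section ultrafilters.

Lemma ultra_fmap {T U : Type} (f : T -> U) (F : set_system T) :
  UltraFilter F -> UltraFilter (f @ F).
Proof.
move=> uF; have pF := ultra_proper.
apply: Build_UltraFilter => G pG FG; apply/seteqP; split => [A GA|]; last exact: FG.
have [//|Fn] := in_ultra_setVsetC (f @^-1` A) uF.
have GnA : G (~` A) by apply: FG.
have : G (A `&` ~` A) by apply: filterI.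
by rewrite setICr => /filter_not_empty.
Qed.

(** Limits along an ultrafilter replace convergent subsequences: finitely many conditions that hold
    on members of [U] hold at a common index. *)
Lemma compact_ultra_lim {R : realType} {W : normedModType R} (C : set W) (U : set_system nat)
   (g : nat -> W) : UltraFilter U -> compact C -> U [set k | C (g k)] ->
  exists y, forall e, 0 < e -> U [set k | `|g k - y| < e].
Proof.
move=> uU; rewrite compact_ultra => cC UC.
have [y [_ gy]] := cC _ (ultra_fmap g uU) UC.
have pU : ProperFilter U := ultra_proper.
exists y => e e0.
have gy' : U (g @^-1` ball y e) := gy _ (nbhsx_ballx y _ e0).
apply: filterS gy' => k /=.
by rewrite -ball_normE /= distrC.
Qed.

Lemma ultra_ex (U : set_system nat) (A : set nat) : UltraFilter U -> U A -> exists k, A k.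
Proof. by move=> uU UA; have pU : ProperFilter U := ultra_proper; have [k] := filter_ex UA; exists k. Qed.

End ultrafilters.

(** * Recession directions of closed convex sets *)

Section recession_cones.
Context {R : realType}.

Section one_space.
Context {V : normedModType R}.
Implicit Types S : set V.

Definition cvx S := forall (t : R) x y, 0 <= t <= 1 -> S x -> S y ->
  S (t *: x + (1 - t) *: y).

Lemma convex_setP S : convex_set S <-> cvx S.
Proof.
split=> H.
  move=> t x y /andP[t0 t1] Sx Sy.
  have := H x y (@Itv01 R t t0 t1).
  by rewrite !inE => /(_ Sx Sy).
move=> x y t; rewrite !inE => Sx Sy; apply: H => //.
by apply/andP; split; [exact: ge0|exact: le1].
Qed.

(** Only the translation by [z] itself is required; for convex [S] the nonnegative multiples of [z]
    follow in [recdir_scale]. *)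
Definition recdir S : set V := [set z | forall s, S s -> S (s + z)].

(* The recession cone of the empty set is taken to be trivial. *)
Definition reccone S : set V := [set z | z = 0 \/ (S !=set0 /\ recdir S z)].

(** The convex combinations [t *: y + (1 - t) *: s] lie in [S] and tend to [s + z] as [t] tends to
    0. *)
Lemma recdir_lim S z : closed S -> cvx S ->
  (forall e, 0 < e -> exists t y, [/\ 0 < t, t <= 1, t < e, S y & `|t *: y - z| < e]) ->
  recdir S z.
Proof.
move=> /closed_normP cS xS H s Ss; apply: cS => e e0.
(* The error is [z - t *: y] plus [t *: s], hence at most the tolerance times 1 plus the norm of
   [s]. *)
have [t [y [t0 t1 te Sy yz]]] := H (e / (1 + `|s|)) ltac:(by rewrite divr_gt0 // ltr_wpDr).
exists (t *: y + (1 - t) *: s); first by apply: xS => //; rewrite (ltW t0).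
have -> : s + z - (t *: y + (1 - t) *: s) = (z - t *: y) + t *: s.
  by rewrite scalerBl scale1r opprD opprB addrC [in LHS]addrA [- _ + (_ - _)]addrA subrK addrC addrA.
rewrite (le_lt_trans (ler_normD _ _))// distrC normrZ gtr0_norm //.
have s0 := normr_ge0 s.
have h : t * `|s| <= e / (1 + `|s|) * `|s| by rewrite ler_wpM2r // ltW.
apply: lt_le_trans (ltr_leD yz h) _.
by rewrite -[X in X + _]mulr1 -mulrDr divfK //; apply/eqP; lra.
Qed.

(** Scaling the point at parameter k+1 by 1/(k+1) gives [z] up to [v]/(k+1). A ray from a single
    point thus decides whether [z] is a recession direction. *)
Lemma recdir_ray S v z : closed S -> cvx S -> (forall k : nat, S (v + k%:R *: z)) -> recdir S z.
Proof.
move=> cS xS H; apply: recdir_lim => // e e0.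
have e0' : 0 < e / (1 + `|v|) by rewrite divr_gt0 // ltr_wpDr.
have [k _ /(_ _ (leqnn _)) /= kP] := near_infty_natSinv_lt (PosNum e0').
have k0 : 0 < k.+1%:R^-1 :> R by rewrite invr_gt0.
have v0 := normr_ge0 v.
have h : e / (1 + `|v|) * (1 + `|v|) = e by rewrite divfK //; apply/eqP; lra.
exists k.+1%:R^-1, (v + k.+1%:R *: z); split => //.
- by rewrite invf_le1 // ler1n.
- apply: lt_le_trans kP _; rewrite ler_pdivrMr; last lra.
  by rewrite ler_peMr ?(ltW e0)//; lra.
- rewrite scalerDr scalerA mulVf ?pnatr_eq0// scale1r addrK normrZ gtr0_norm //.
  apply: (@le_lt_trans _ _ (k.+1%:R^-1 * (1 + `|v|))).
    by rewrite ler_pM2l //; lra.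
  by rewrite -[ltRHS]h ltr_pM2r //; lra.
Qed.

Lemma recdir_nat S z (k : nat) : recdir S z -> recdir S (k%:R *: z).
Proof.
move=> rz; elim: k => [|k IH] s Ss; first by rewrite scale0r addr0.
by rewrite -natr1 scalerDl scale1r addrA; apply/rz/IH.
Qed.

(** Integer multiples come from repeated translation; [s + c *: z] lies on the segment from [s] to
    [s + k.+1%:R *: z] once k+1 exceeds [c]. *)
Lemma recdir_scale S z (c : R) : cvx S -> recdir S z -> 0 <= c -> recdir S (c *: z).
Proof.
move=> xS rz c0 s Ss.
have [k ck] : exists k : nat, c < k.+1%:R.
  by exists (Num.trunc c); have /andP[] := Num.Theory.truncn_itv c0.
have k0 : 0 < k.+1%:R :> R by rewrite ltr0n.
have -> : s + c *: z = (c / k.+1%:R) *: (s + k.+1%:R *: z) + (1 - c / k.+1%:R) *: s.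
  rewrite scalerDr scalerBl scale1r scalerA divfK ?pnatr_eq0//.
  by rewrite [(c / _) *: s + _]addrC -addrA [(c / _) *: s + _]addrC subrK addrC.
apply: xS => //; last exact: recdir_nat.
by rewrite divr_ge0 ?(ltW k0)//= ler_pdivrMr // mul1r ltW.
Qed.

Lemma recdir0 S : recdir S 0. Proof. by move=> s; rewrite addr0. Qed.

Lemma reccone0 S : reccone S 0. Proof. by left. Qed.

Lemma reccone_recdir S z : reccone S z -> recdir S z.
Proof. by move=> [->|[]//]; exact: recdir0. Qed.

Lemma min_norm (A : set V) : findim V -> closed A -> A !=set0 ->
  exists2 y, A y & forall y', A y' -> `|y| <= `|y'|.
Proof.
move=> fV cA [y0 Ay0].
have cB := findim_cball (x := 0) (r := `|y0|) fV.
have cC : compact (A `&` cball 0 `|y0|).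
  apply: (subclosed_compact _ cB); first by apply: closedI => //; exact: cball_closed.
  by move=> ? [].
have C0 : A `&` cball 0 `|y0| !=set0 by exists y0; split => //; rewrite /cball /= sub0r normrN.
have [|y yA yP] := @compact_EVT_min _ R (fun y => `|y|) _ C0 cC.
  by apply: continuous_subspaceT => x; exact: norm_continuous.
move: yA; rewrite inE => -[Ay yy0]; exists y => // y' Ay'.
have [le|lt] := leP `|y'| `|y0|.
  by apply: yP; rewrite inE; split => //; rewrite /cball /= sub0r normrN.
by apply: le_trans (ltW lt); move: yy0; rewrite /cball /= sub0r normrN.
Qed.

End one_space.

(** * Projections of closed convex sets *)

Section projection.
Context {V W : normedModType R}.
Hypothesis fW : findim W.
Variable S : set (V * W)%type.
Hypotheses (cS : closed S) (xS : cvx S).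
Hypothesis sym : forall w : W, recdir S (0, w) -> recdir S (0, - w).

Let fiber_closed x : closed [set y | S (x, y)].
Proof.
apply/closed_normP => y H; move/closed_normP: cS; apply => e e0.
have [y' Sy yy] := H e e0; exists (x, y') => //.
by rewrite prod_normE /= subrr normr0 gt_max e0.
Qed.

Let minimal_fiber x : (exists y, S (x, y)) ->
  exists2 y, S (x, y) & forall y', S (x, y') -> `|y| <= `|y'|.
Proof. by move=> ex; have [y Sy yP] := min_norm fW (@fiber_closed x) ex; exists y. Qed.

(* If minimal-norm points of the fibers escaped to infinity faster than c k, a
   limit yhat of their directions would be a recession direction, hence so would
   - yhat, and subtracting `|y k| *: yhat would shorten y k. *)
Let minimal_fiber_bounded (U : set_system nat) (x : nat -> V) (y : nat -> W)
    (c : nat -> R) (C : R) : UltraFilter U ->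
  (forall k, S (x k, y k)) ->
  (forall k y', S (x k, y') -> `|y k| <= `|y'|) ->
  (forall k, 1 <= c k) -> (forall k, `|x k| <= C * c k) ->
  exists r, U [set k | `|y k| <= r * c k].
Proof.
move=> uU Sy ymin c1 xC; have pU : ProperFilter U := ultra_proper.
apply: contrapT => nU.
have big r : U [set k | r * c k < `|y k|].
  have [UA|] := in_ultra_setVsetC [set k | `|y k| <= r * c k] uU.
    by exfalso; apply: nU; exists r.
  by apply: filterS => k /= /negP; rewrite -ltNge.
pose g k := `|y k|^-1 *: y k.
have gC : U [set k | cball 0 1 (g k)].
  apply: filterS (big 0) => k /=; rewrite mul0r /cball /= sub0r normrN => y0.
  by rewrite normrZ gtr0_norm ?invr_gt0// mulVf // gt_eqF.
have [yh yhP] := compact_ultra_lim uU (findim_cball fW) gC.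
have C0 : 0 <= C.
  have := le_trans (normr_ge0 _) (xC 0%N); rewrite pmulr_lge0 //.
  exact: lt_le_trans (c1 _).
have recyh : recdir S (0, yh).
  apply: recdir_lim => // e e0.
  have ei : 0 < e^-1 by rewrite invr_gt0.
  (* With t the inverse of the norm of [y k], the summand 1 gives t <= 1, and (1 + C) / e gives both
     t < e and a norm of [t *: x k] below e. *)
  have [k /= [ky gk]] := ultra_ex uU (filterI (big (1 + (1 + C) / e)) (yhP e e0)).
  have q0 : 0 < (1 + C) / e by apply: divr_gt0 => //; lra.
  have h1 : 1 + (1 + C) / e < `|y k|.
    by apply: le_lt_trans ky; rewrite ler_peMr //; lra.
  have y0 : 0 < `|y k| by lra.
  exists `|y k|^-1, (x k, y k); split => //.
  - by rewrite invr_gt0.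
  - by rewrite invf_le1 //; lra.
  - rewrite -[ltRHS]invrK ltf_pV2 ?posrE //; apply: lt_trans h1.
    have Ce : 0 <= C / e by rewrite divr_ge0 // ltW.
    by rewrite mulrDl mul1r; lra.
  - rewrite prod_normE /= subr0 gt_max gk andbT normrZ gtr0_norm ?invr_gt0//.
    rewrite mulrC ltr_pdivrMr //; apply: le_lt_trans (xC k) _.
    apply: (@lt_trans _ _ (e * ((1 + (1 + C) / e) * c k))); last by rewrite ltr_pM2l.
    rewrite mulrA ltr_pM2r; last exact: lt_le_trans (c1 k).
    rewrite mulrDr mulr1 mulrCA mulfV ?gt_eqF// mulr1; lra.
have [k /= [ky gk]] := ultra_ex uU (filterI (big 0) (yhP (1/2) ltac:(lra))).
rewrite mul0r in ky.
have rm := recdir_scale xS (sym recyh) (ltW ky).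
have := rm _ (Sy k); rewrite [_ + _](_ : _ = (x k, y k - `|y k| *: yh)); last first.
  by congr pair; rewrite /= ?scaler0 ?addr0 ?scalerN.
move=> /ymin; apply/negP; rewrite -ltNge.
have -> : y k - `|y k| *: yh = `|y k| *: (g k - yh).
  by rewrite scalerBr /g scalerA mulfV ?gt_eqF// scale1r.
rewrite normrZ normr_id -[ltRHS]mulr1 ltr_pM2l //; lra.
Qed.

Let oo_ultra : exists U : set_system nat, UltraFilter U /\ \oo `<=` U.
Proof. exact: (@ultraFilterLemma nat \oo). Qed.

(** Over base points tending to [x] the minimal-norm fiber points are bounded (take [c = 1]), and an
    ultrafilter limit of them lies in the fiber over [x]. *)
Lemma closed_projection : closed [set x | exists y, S (x, y)].
Proof.
apply/closed_normP => x H.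
have H' (k : nat) : exists p : V * W, [/\ S p, `|x - p.1| < k.+1%:R^-1 &
    forall y', S (p.1, y') -> `|p.2| <= `|y'|].
  have [x' /minimal_fiber[y Sy yP] xx] := H k.+1%:R^-1 ltac:(by rewrite invr_gt0).
  by exists (x', y).
have [f fP] := choice H'.
have [U [uU oU]] := oo_ultra; have pU : ProperFilter U := ultra_proper.
have Sf k : S ((f k).1, (f k).2) by rewrite -surjective_pairing; have [] := fP k.
have fmin k y' : S ((f k).1, y') -> `|(f k).2| <= `|y'| by have [_ _] := fP k; apply.
have xC (k : nat) : `|(f k).1| <= (`|x| + 1) * 1.
  have [_ xf _] := fP k; rewrite mulr1 -[(f k).1](subrK x).
  rewrite (le_trans (ler_normD _ _))// addrC lerD2l distrC ltW //.
  by apply: lt_le_trans xf _; rewrite invf_le1 // ler1n.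
have [r] := minimal_fiber_bounded uU Sf fmin (fun=> lexx 1) xC.
have -> : [set k | `|(f k).2| <= r * 1] = [set k | cball 0 r (f k).2].
  by rewrite predeqE => k; rewrite /cball /= sub0r normrN mulr1.
move=> Ur; have [y yP] := compact_ultra_lim uU (findim_cball fW) Ur.
exists y; move/closed_normP: cS; apply => e e0.
have Ue : U [set k | k.+1%:R^-1 < e] by apply: oU; exact: (near_infty_natSinv_lt (PosNum e0)).
have [k /= [ke yk]] := ultra_ex uU (filterI Ue (yP e e0)).
exists (f k); first by have [] := fP k.
have [_ xf _] := fP k.
by rewrite prod_normE /= gt_max [`|y - _|]distrC yk (lt_trans xf).
Qed.

(** Over the ray from [v] in direction [x], minimal-norm fiber points grow at most linearly (take
    [c k = k.+1]); a limit of [k.+1%:R^-1 *: f k] is the missing component of the lifted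
    direction. *)
Lemma recdir_projection x : (exists p, S p) ->
  recdir [set x | exists y, S (x, y)] x -> exists y, recdir S (x, y).
Proof.
move=> [[v u0] Sv] rx.
have H (k : nat) : exists p : W, S (v + k.+1%:R *: x, p) /\
    forall y', S (v + k.+1%:R *: x, y') -> `|p| <= `|y'|.
  have /minimal_fiber[y Sy yP] := @recdir_nat _ _ _ k.+1 rx v (ex_intro _ _ Sv).
  by exists y.
have [f fP] := choice H.
have [U [uU oU]] := oo_ultra; have pU : ProperFilter U := ultra_proper.
have c1 k : 1 <= k.+1%:R :> R by rewrite ler1n.
have xC (k : nat) : `|v + k.+1%:R *: x| <= (`|v| + `|x|) * k.+1%:R.
  rewrite (le_trans (ler_normD _ _))// mulrDl normrZ normr_nat [k.+1%:R * _]mulrC lerD2r.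
  by rewrite ler_peMr.
have [r Ur] := minimal_fiber_bounded uU (fun k => proj1 (fP k)) (fun k => proj2 (fP k)) c1 xC.
have Ur' : U [set k | cball 0 r (k.+1%:R^-1 *: f k)].
  apply: filterS Ur => k /= fk; rewrite /cball /= sub0r normrN normrZ gtr0_norm ?invr_gt0//.
  by rewrite ler_pdivrMl // mulrC.
have [y yP] := compact_ultra_lim uU (findim_cball fW) Ur'.
exists y; apply: recdir_lim => // e e0.
have e0' : 0 < e / (1 + `|v|) by rewrite divr_gt0 // ltr_wpDr.
have Ue : U [set k | k.+1%:R^-1 < e / (1 + `|v|)].
  by apply: oU; exact: (near_infty_natSinv_lt (PosNum e0')).
have [k /= [ke yk]] := ultra_ex uU (filterI Ue (yP e e0)).
have v0 := normr_ge0 v.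
have h : e / (1 + `|v|) * (1 + `|v|) = e by rewrite divfK //; apply/eqP; lra.
have k0 : 0 < k.+1%:R^-1 :> R by rewrite invr_gt0.
exists k.+1%:R^-1, (v + k.+1%:R *: x, f k); split => //.
- by rewrite invf_le1 // ler1n.
- apply: lt_le_trans ke _; rewrite ler_pdivrMr; last lra.
  by rewrite ler_peMr ?(ltW e0)//; lra.
- by have [] := fP k.
- rewrite prod_normE /= gt_max yk andbT.
  rewrite scalerDr scalerA mulVf ?pnatr_eq0// scale1r addrK normrZ gtr0_norm //.
  apply: (@le_lt_trans _ _ (k.+1%:R^-1 * (1 + `|v|))).
    by rewrite ler_pM2l //; lra.
  by rewrite -[ltRHS]h ltr_pM2r //; lra.
Qed.

End projection.
End recession_cones.
Local Open Scope ereal_scope.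

(** * Measurability with respect to a sub-sigma-algebra *)

Section sub_sigma_algebra_measurability.
Context {d} {Omega : measurableType d} {R : realType} (G : set (set Omega)).
Hypothesis sG : sigma_algebra setT G.

Definition Gmeasurable (f : Omega -> \bar R) :=
  measurable_fun [set: g_sigma_algebraType G] (f : g_sigma_algebraType G -> \bar R).

Lemma GmeasE (A : set Omega) : measurable (A : set (g_sigma_algebraType G)) = G A.
Proof. by rewrite (measurable_g_measurableTypeE sG). Qed.

Lemma GmP (f : Omega -> \bar R) : Gmeasurable f <-> forall a : R, G [set w | f w <= a%:E].
Proof.
split=> [mf a|H].
  rewrite -GmeasE -[X in measurable X]setTI.
  exact: (@emeasurable_fun_infty_c _ (g_sigma_algebraType G)).
apply: (measurability _ (ErealGenOInfty.measurableE R)) => _ [_ [a ->]] <-.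
rewrite setTI GmeasE; apply: (sG_eq _ (sGC sG (H a))) => w /=.
by rewrite in_itv /= andbT ltNge; split => /negP.
Qed.

Lemma Gmeasurable_ltP (f : Omega -> \bar R) : (forall a : R, G [set w | f w < a%:E]) -> Gmeasurable f.
Proof.
move=> H; apply/GmP => a.
apply: (sG_eq _ (sG_all sG (fun n : nat => H (a + n.+1%:R^-1)%R))) => w; split.
  move=> h; apply/lee_addgt0Pr => e e0.
  have [k _ /(_ _ (leqnn _)) /= kP] := near_infty_natSinv_lt (PosNum e0).
  by apply: ltW; apply: lt_trans (h k) _; rewrite -EFinD lte_fin ltrD2l.
by move=> h n; apply: le_lt_trans h _; rewrite lte_fin ltrDl invr_gt0.
Qed.

Lemma rv_random_vector (V : normedModType R) (x : Omega -> V) :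
  random_vector G x <-> rv G x.
Proof.
split=> [mx O oO|H].
  rewrite -GmeasE -[X in measurable X]setTI; apply: mx => //.
  exact: sub_gen_smallest.
apply: (@measurability _ _ (g_sigma_algebraType G) (g_sigma_algebraType (@open V)) setT x (@open V)) => //.
by move=> _ [B oB] <-; rewrite setTI GmeasE; exact: H.
Qed.

Hypothesis GO : G `<=` (measurable : set (set Omega)).

Lemma Gmeasurable_measurable (f : Omega -> \bar R) : Gmeasurable f -> measurable_fun setT f.
Proof.
move=> mf _ B mB; rewrite setTI; apply: GO; rewrite -GmeasE -[X in measurable X]setTI.
exact: mf.
Qed.

End sub_sigma_algebra_measurability.

(** * Conditional expectations of nonnegative integrable functions *)

Section restricted_measures.
Context {d} {Omega : measurableType d} {R : realType} (P : probability Omega R).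
Context (G : set (set Omega)) (HG : Defs.sub_sigma_algebra G).

Let meas_sub (A : set (g_sigma_algebraType G)) : measurable A -> measurable (A : set Omega).
Proof. by rewrite (GmeasE (proj1 HG)) => /(proj2 HG). Qed.

(* The sigma-algebra is an argument only through [HG], so that the measure
   structure can be inferred. *)
Definition restr_prob (_ : Defs.sub_sigma_algebra G) : set (g_sigma_algebraType G) -> \bar R := P.

Let restr0 : restr_prob HG set0 = 0. Proof. exact: measure0. Qed.
Let restr_ge0 A : 0 <= restr_prob HG A. Proof. exact: measure_ge0. Qed.
Let restr_add : semi_sigma_additive (restr_prob HG).
Proof.
move=> F mF tF mUF; apply: (@measure_semi_sigma_additive _ _ _ P) => //.
  by move=> i; exact: meas_sub.
exact: meas_sub.
Qed.
HB.instance Definition _ := isMeasure.Build _ _ _ (restr_prob HG) restr0 restr_ge0 restr_add.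

Let restr_fin : fin_num_fun (restr_prob HG).
Proof. by move=> A mA; apply: (@fin_num_measure _ _ _ P); exact: meas_sub. Qed.
HB.instance Definition _ := Measure_isFinite.Build _ _ _ (restr_prob HG) restr_fin.

(** The restricted measure is the image of [P] under the identity, viewed as a map onto the smaller
    sigma-algebra. *)
Lemma ge0_integral_restr (A : set Omega) (f : Omega -> \bar R) : G A -> Gmeasurable G f ->
  (forall w, 0 <= f w) -> \int[restr_prob HG]_(w in A) f w = \int[P]_(w in A) f w.
Proof.
move=> GA mf f0.
have mid : measurable_fun setT (id : Omega -> g_sigma_algebraType G).
  by move=> _ B mB; rewrite setTI; exact: meas_sub.
have mA : measurable (A : set (g_sigma_algebraType G)) by rewrite (GmeasE (proj1 HG)).
rewrite -[RHS](@ge0_integral_pushforward _ _ _ _ _ _ mid P A f) //.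
exact: measurable_funTS.
Qed.

Section density.
Context (f : Omega -> \bar R) (f0 : forall w, 0 <= f w)
        (intf : P.-integrable [set: Omega] f).

(** The hypotheses are arguments so that the finite measure structure on [G] can be inferred, as for
    [restr_prob]. *)
Definition density_measure (_ : Defs.sub_sigma_algebra G) (_ : forall w, 0 <= f w)
    (_ : P.-integrable [set: Omega] f) : set (g_sigma_algebraType G) -> \bar R :=
  fun A => \int[P]_(w in A) f w.

Let nu := density_measure HG f0 intf.
Let nu0 : nu set0 = 0. Proof. exact: integral_set0. Qed.
Let nu_ge0 A : 0 <= nu A. Proof. by apply: integral_ge0 => w _. Qed.
Let nu_add : semi_sigma_additive nu.
Proof.
move=> F mF tF mUF; apply: (@semi_sigma_additive_nng_induced _ _ _ P f) => //.
- exact: measurable_int intf.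
- by move=> i; exact: meas_sub.
- exact: meas_sub.
Qed.
HB.instance Definition _ := isMeasure.Build _ _ _ nu nu0 nu_ge0 nu_add.

Let nu_fin : fin_num_fun nu.
Proof.
move=> A mA; apply: integrable_fin_num => //; first exact: meas_sub.
by apply: (integrableS measurableT _ _ intf) => //; exact: meas_sub.
Qed.
HB.instance Definition _ := Measure_isFinite.Build _ _ _ nu nu_fin.

Let nu_dom : nu `<< restr_prob HG.
Proof.
apply/null_content_dominatesP => A mA PA.
apply: null_set_integral => //; first exact: meas_sub.
apply: measurable_funTS; exact: measurable_int intf.
Qed.

(** The Radon-Nikodym derivative on [G] of the measure with density [f] relative to the restriction
    of [P]. *)
Lemma ge0_cond_expectation : exists c : Omega -> R, [/\ Gmeasurable G (EFin \o c),
  forall w, (0 <= c w)%R & forall A, G A -> \int[P]_(w in A) (c w)%:E = \int[P]_(w in A) f w].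
Proof.
pose g := Radon_Nikodym_SigmaFinite.f nu (restr_prob HG).
have g0 : forall w, 0 <= g w := Radon_Nikodym_SigmaFinite.f_ge0 nu_dom.
have gf : forall w, g w \is a fin_num := Radon_Nikodym_SigmaFinite.f_fin_num nu_dom.
have gE : EFin \o (fine \o g) = g by apply/funext => w; rewrite /= fineK.
have mg : Gmeasurable G g := measurable_int _ (Radon_Nikodym_SigmaFinite.f_integrable nu_dom).
exists (fine \o g); split.
- by rewrite gE.
- by move=> w; rewrite /= fine_ge0.
- move=> A GA; transitivity (\int[P]_(w in A) g w).
    by apply: eq_integral => w _; rewrite /= fineK.
  rewrite -ge0_integral_restr //.
  rewrite -Radon_Nikodym_SigmaFinite.f_integral //.
  by rewrite (GmeasE (proj1 HG)).
Qed.

End density.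
End restricted_measures.

(** * Integrals of functions with an integrable lower bound *)

Section integrals_bounded_below.
Context {d} {Omega : measurableType d} {R : realType} (P : probability Omega R).
Implicit Types (f g : Omega -> \bar R) (A : set Omega).

Lemma ae_of_null (N : set Omega) (Q : Omega -> Prop) : measurable N -> P N = 0 ->
  (forall w, ~ N w -> Q w) -> {ae P, forall w, Q w}.
Proof.
by move=> mN N0 H; exists N; split => // w /= nQ; apply: contrapT => /H.
Qed.

Lemma ae_null (Q : Omega -> Prop) : {ae P, forall w, Q w} ->
  exists N : set Omega, [/\ measurable N, P N = 0 & forall w, ~ N w -> Q w].
Proof.
move=> [N [mN N0 H]]; exists N; split=> // w nN.
by apply: contrapT => nQ; exact: (nN (H _ nQ)).
Qed.

Lemma ae_all (I : countType) (Q : I -> Omega -> Prop) :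
  (forall i, {ae P, forall w, Q i w}) -> {ae P, forall w, forall i, Q i w}.
Proof.
move=> H; have : {ae P, forall w, forall n : nat, if unpickle n is Some i then Q i w else True}.
  by apply: ae_foralln => n; case: unpickle => [i|]; [exact: H|exact: aeW].
by apply: filterS => w Hw i; have := Hw (pickle i); rewrite pickleK.
Qed.

(** Positive and negative parts are compared separately; subtraction of extended reals is monotone
    even at infinite values, so no integrability enters. *)
Lemma integral_le A f g : measurable A -> measurable_fun A f -> measurable_fun A g ->
  (forall w, A w -> f w <= g w) -> \int[P]_(w in A) f w <= \int[P]_(w in A) g w.
Proof.
move=> mA mf mg fg; rewrite [leLHS]integralE [leRHS]integralE.
have fg' : {in A, forall x : Omega, f x <= g x} by move=> w; rewrite inE; exact: fg.
apply: leeB; apply: ge0_le_integral => //; try exact: measurable_funepos; try exact: measurable_funeneg.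
  by move=> w Aw; apply: (funepos_le fg'); rewrite inE.
by move=> w Aw; apply: (funeneg_le fg'); rewrite inE.
Qed.

Lemma integral_ae_eq A f g : measurable A -> measurable_fun setT f ->
  measurable_fun setT g -> {ae P, forall w, f w = g w} ->
  \int[P]_(w in A) f w = \int[P]_(w in A) g w.
Proof.
move=> mA mf mg fg; apply: ae_eq_integral => //; try exact: measurable_funTS.
by apply: filterS fg => w.
Qed.

Lemma integral_ae_le_on A f g : measurable A -> measurable_fun setT f ->
  measurable_fun setT g -> {ae P, forall w, A w -> f w <= g w} ->
  \int[P]_(w in A) f w <= \int[P]_(w in A) g w.
Proof.
move=> mA mf mg fg.
have mfg : measurable_fun setT (fun w => mine (f w) (g w)) by exact: measurable_mine.
rewrite (@ae_eq_integral _ _ _ P A (fun w => mine (f w) (g w)) f) //; try exact: measurable_funTS.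
- apply: integral_le => //; try exact: measurable_funTS.
  by move=> w _; rewrite ge_min lexx orbT.
- by apply: filterS fg => w + Aw => /(_ Aw) /min_idPl ->.
Qed.

Lemma integral_ae_le A f g : measurable A -> measurable_fun setT f ->
  measurable_fun setT g -> {ae P, forall w, f w <= g w} ->
  \int[P]_(w in A) f w <= \int[P]_(w in A) g w.
Proof.
by move=> mA mf mg fg; apply: integral_ae_le_on => //; apply: filterS fg => w.
Qed.

(** If [f] has infinite integral, then so has the positive part of [f + e], because [f] is at most
    this part plus the absolute value of [e]; the negative part of [f + e] is dominated by that
    absolute value and has finite integral. *)
Lemma integral_ge0D A f (e : Omega -> R) : measurable A -> measurable_fun setT f ->
  (forall w, 0 <= f w) -> P.-integrable setT (EFin \o e) ->
  \int[P]_(w in A) (f w + (e w)%:E) = \int[P]_(w in A) f w + \int[P]_(w in A) (e w)%:E.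
Proof.
move=> mA mf f0 ie.
have mfA : measurable_fun A f by exact: measurable_funTS.
have ieA : P.-integrable A (EFin \o e) := integrableS measurableT mA (@subsetT _ _) ie.
have meA : measurable_fun A (EFin \o e) := measurable_int _ ieA.
have [foo|] := ltP (\int[P]_(w in A) f w) +oo.
  rewrite integralD //; apply/integrableP; split => //.
  by rewrite (eq_integral f) // => w _; rewrite gee0_abs.
rewrite leye_eq => /eqP foo; rewrite foo.
have finE : \int[P]_(w in A) (e w)%:E \is a fin_num by exact: integrable_fin_num ieA.
have /integrableP[_ absoo] := ieA.
rewrite addye; last by move: finE; rewrite fin_numE => /andP[].
have mh : measurable_fun A (fun w => f w + (e w)%:E) by exact: emeasurable_funD.
have mabs : measurable_fun A (fun w => `|(e w)%:E|).
  by apply: measurableT_comp.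
rewrite integralE.
have -> : \int[P]_(w in A) (fun w => f w + (e w)%:E)^\+ w = +oo.
  apply/eqP; rewrite -leye_eq.
  have : \int[P]_(w in A) f w <= \int[P]_(w in A) ((fun w => f w + (e w)%:E)^\+ w + `|(e w)%:E|).
    apply: ge0_le_integral => //.
      by apply: emeasurable_funD => //; exact: measurable_funepos.
    move=> w _; rewrite funeposE /=.
    have := f0 w; case: (f w) => [r| |] //= r0.
    rewrite -EFinD -EFin_max -EFinD lee_fin.
    have h1 : (r + e w <= Num.max (r + e w) 0)%R by rewrite le_max lexx.
    by have h2 := ler_norm (- e w); rewrite normrN in h2; lra.
  rewrite ge0_integralD //; last exact: measurable_funepos.
  rewrite foo leye_eq => /eqP.
  move: absoo; set a := \int[P]_(w in A) `|_|; set b := \int[P]_(w in A) _^\+ _.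
  by move: a b => [a| |] [b| |].
set I := \int[P]_(w in A) _.
have : I < +oo.
  apply: le_lt_trans absoo; apply: ge0_le_integral => //.
    exact: measurable_funeneg.
  move=> w _; rewrite funenegE /=.
  have := f0 w; case: (f w) => [r| |] //= r0; last by rewrite maxNye.
  rewrite lee_fin in r0; rewrite -?EFinD -?EFinN -EFin_max lee_fin ge_max normr_ge0 andbT.
  by have h2 := ler_norm (- e w); rewrite normrN in h2; lra.
by move: I => [r| |] // _; rewrite addye.
Qed.

Definition integrable_below f := exists2 m : Omega -> R, P.-integrable setT (EFin \o m) &
  {ae P, forall w, (m w)%:E <= f w}.

Lemma integrable_oppR (m : Omega -> R) : P.-integrable setT (EFin \o m) ->
  P.-integrable setT (EFin \o (fun w => - m w)%R).
Proof. by move=> im; have := integrableN im; apply: eq_integrable. Qed.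

Lemma maxe_shift (x : \bar R) (m : R) : (- m)%:E <= x -> maxe (x + m%:E) 0 = x + m%:E.
Proof.
move=> h; apply/max_idPl; move: h; case: x => [r| |] //=.
  by rewrite -EFinD !lee_fin; lra.
by rewrite addye // leey.
Qed.

Lemma integrable_below_nonneg f : integrable_below f -> exists2 m : Omega -> R,
  P.-integrable setT (EFin \o m) /\ (forall w, (0 <= m w)%R) &
  {ae P, forall w, (- m w)%:E <= f w}.
Proof.
move=> [m im mf]; exists (fun w => `|m w|%R).
  by split => //; exact: integrable_norm.
apply: filterS mf => w; apply: le_trans; rewrite lee_fin lerNl.
by rewrite -normrN ler_norm.
Qed.

Lemma integrable_belowD f g : integrable_below f -> integrable_below g -> integrable_below (fun w => f w + g w).
Proof.
move=> [m im mf] [n inn ng]; exists (fun w => (m w + n w)%R).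
  have := integrableD measurableT im inn; apply: eq_integrable => //.
apply: filterS2 mf ng => w h1 h2; rewrite EFinD; exact: leeD.
Qed.

(** The maximum with 0 changes [f + m] on a null set only, and makes it nonnegative everywhere, as
    additivity of nonnegative integrals demands. *)
Lemma integrable_below_shift A f (m : Omega -> R) : measurable A -> measurable_fun setT f ->
  P.-integrable setT (EFin \o m) -> {ae P, forall w, (- m w)%:E <= f w} ->
  \int[P]_(w in A) f w =
  \int[P]_(w in A) maxe (f w + (m w)%:E) 0 + \int[P]_(w in A) (- m w)%:E.
Proof.
move=> mA mf im mfle.
have mm : measurable_fun setT (EFin \o m) := measurable_int _ im.
have mF : measurable_fun setT (fun w => maxe (f w + (m w)%:E) 0).
  by apply: measurable_maxe => //; exact: emeasurable_funD.
have imN : P.-integrable setT (EFin \o (fun w => - m w)%R).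
  exact: integrable_oppR.
rewrite -integral_ge0D //; last by move=> w; rewrite le_max lexx orbT.
apply: integral_ae_eq => //.
  by apply: emeasurable_funD => //; exact: measurable_int imN.
apply: filterS mfle => w h.
rewrite (maxe_shift h).
by rewrite EFinN addeK.
Qed.

Lemma integral_integrable_belowD A f g : measurable A -> measurable_fun setT f ->
  measurable_fun setT g -> integrable_below f -> integrable_below g ->
  \int[P]_(w in A) (f w + g w) = \int[P]_(w in A) f w + \int[P]_(w in A) g w.
Proof.
move=> mA mf mg /integrable_below_nonneg[m [im m0] fm] /integrable_below_nonneg[n [inn n0] gn].
pose k w := (m w + n w)%R.
have ik : P.-integrable setT (EFin \o k).
  by have := integrableD measurableT im inn; apply: eq_integrable.
have mm : measurable_fun setT (EFin \o m) := measurable_int _ im.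
have mn : measurable_fun setT (EFin \o n) := measurable_int _ inn.
have mF : measurable_fun setT (fun w => maxe (f w + (m w)%:E) 0).
  by apply: measurable_maxe => //; exact: emeasurable_funD.
have mG : measurable_fun setT (fun w => maxe (g w + (n w)%:E) 0).
  by apply: measurable_maxe => //; exact: emeasurable_funD.
rewrite (integrable_below_shift mA mf im fm) (integrable_below_shift mA mg inn gn).
have imN : P.-integrable setT (EFin \o (fun w => - m w)%R) by exact: integrable_oppR.
have inN : P.-integrable setT (EFin \o (fun w => - n w)%R) by exact: integrable_oppR.
have ikN : P.-integrable setT (EFin \o (fun w => - k w)%R) by exact: integrable_oppR.
rewrite addeACA -ge0_integralD //; try exact: measurable_funTS; last 2 first.
- by move=> w _; rewrite le_max lexx orbT.
- by move=> w _; rewrite le_max lexx orbT.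
rewrite -(@integralD _ _ _ _ _ mA (EFin \o (fun w => - m w)%R) (EFin \o (fun w => - n w)%R)); last 2 first.
- exact: integrableS imN.
- exact: integrableS inN.
have -> : \int[P]_(w in A) ((EFin \o (fun w => - m w)%R) w + (EFin \o (fun w => - n w)%R) w)
   = \int[P]_(w in A) (- k w)%:E.
  by apply: eq_integral => w _; rewrite /= -EFinD /k opprD.
rewrite -integral_ge0D //.
- apply: integral_ae_eq => //; first exact: emeasurable_funD.
    apply: emeasurable_funD; first exact: emeasurable_funD.
    exact: measurable_int ikN.
  apply: filterS2 fm gn => w h1 h2.
  rewrite (maxe_shift h1).
  rewrite (maxe_shift h2).
  move: h1 h2; rewrite /k; case: (f w) => [r| |] //=; case: (g w) => [r'| |] //=.
  by move=> _ _; rewrite -!EFinD; congr EFin; lra.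
- exact: emeasurable_funD.
- by move=> w; apply: adde_ge0; rewrite le_max lexx orbT.
Qed.

Lemma integral_integrable_belowZ A f (c : R) : measurable A -> measurable_fun setT f -> integrable_below f ->
  (0 <= c)%R -> \int[P]_(w in A) (c%:E * f w) = c%:E * \int[P]_(w in A) f w.
Proof.
move=> mA mf /integrable_below_nonneg[m [im m0] fm] c0.
have mm : measurable_fun setT (EFin \o m) := measurable_int _ im.
have mF : measurable_fun setT (fun w => maxe (f w + (m w)%:E) 0).
  by apply: measurable_maxe => //; exact: emeasurable_funD.
have imN : P.-integrable setT (EFin \o (fun w => - m w)%R) by exact: integrable_oppR.
have imA : P.-integrable A (EFin \o (fun w => - m w)%R) by exact: integrableS imN.
have icN : P.-integrable setT (EFin \o (fun w => c * (- m w))%R).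
  by have := integrableZl measurableT c imN; apply: eq_integrable.
have finN : \int[P]_(w in A) (- m w)%:E \is a fin_num by exact: integrable_fin_num imA.
rewrite (integrable_below_shift mA mf im fm) muleDr //; last exact: fin_num_adde_defl.
have mFA : measurable_fun A (fun w => maxe (f w + (m w)%:E) 0) by exact: measurable_funTS.
rewrite -ge0_integralZl_EFin //; last by move=> w _; rewrite le_max lexx orbT.
rewrite -(integralZl mA imA) -[X in _ = _ + X]/(\int[P]_(w in A) (c * (- m w))%:E).
rewrite -integral_ge0D //.
- apply: integral_ae_eq => //; first exact: measurable_funeM.
    by apply: emeasurable_funD; [exact: measurable_funeM|exact: measurable_int icN].
  apply: filterS fm => w h.
  rewrite (maxe_shift h).
  rewrite EFinM -muleDr //; last by rewrite fin_num_adde_defl.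
  by rewrite EFinN addeK.
- exact: measurable_funeM.
- by move=> w; rewrite mule_ge0 // le_max lexx orbT.
Qed.

End integrals_bounded_below.

(** * Almost sure comparison from integrals over sets of a sub-sigma-algebra *)

Section comparison.
Context {d} {Omega : measurableType d} {R : realType} (P : probability Omega R).
Context (G : set (set Omega)) (HG : Defs.sub_sigma_algebra G).

Lemma Gmeasurable_setlt (f g : Omega -> \bar R) : Gmeasurable G f -> Gmeasurable G g -> G [set w | f w < g w].
Proof.
move=> mf mg; rewrite -(GmeasE (proj1 HG)) -[X in measurable X]setTI.
exact: (@measurable_lte _ (g_sigma_algebraType G)).
Qed.

(** For rationals p < q the event that g < p and q < f is in [G]; comparing integrals over it gives
    q times its probability <= p times its probability, so it is null. This covers infinite values
    and infinite integrals. *)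
Lemma ae_le_of_integral (f g : Omega -> \bar R) : Gmeasurable G f -> Gmeasurable G g ->
  (forall A, G A -> \int[P]_(w in A) f w <= \int[P]_(w in A) g w) ->
  {ae P, forall w, f w <= g w}.
Proof.
move=> mf mg H; have [sG GO] := HG.
have mf' := Gmeasurable_measurable sG GO mf; have mg' := Gmeasurable_measurable sG GO mg.
have null (pq : rat * rat) : (ratr pq.1 < ratr pq.2 :> R)%R ->
    P [set w | g w < (ratr pq.1)%:E /\ (ratr pq.2)%:E < f w] = 0.
  set p : R := ratr pq.1; set q : R := ratr pq.2 => pq'.
  pose A := [set w | g w < p%:E /\ q%:E < f w].
  have GA : G A.
    by apply: (sGI sG); apply: Gmeasurable_setlt => //; exact: measurable_cst.
  have mA : measurable A := GO _ GA.
  have h1 : \int[P]_(w in A) g w <= \int[P]_(w in A) (cst p%:E) w.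
    by apply: integral_le => //; [exact: measurable_funTS|move=> w [/ltW]].
  have h2 : \int[P]_(w in A) (cst q%:E) w <= \int[P]_(w in A) f w.
    by apply: integral_le => //; [exact: measurable_funTS|move=> w [_ /ltW]].
  have h12 := le_trans (le_trans h2 (H A GA)) h1.
  have [r r0 PAr] : exists2 r : R, (0 <= r)%R & P A = r%:E.
    exists (fine (P A)); first exact: fine_ge0.
    by rewrite fineK //; exact: fin_num_measure.
  have : (q * r)%:E <= (p * r)%:E.
    by move: h12; rewrite !integral_cst // !EFinM -PAr.
  rewrite lee_fin PAr => h; congr EFin.
  by apply/eqP; rewrite eq_le r0 andbT leNgt; apply/negP => r1; nra.
have : {ae P, forall w, forall pq : rat * rat, (ratr pq.1 < ratr pq.2 :> R)%R ->
    ~ (g w < (ratr pq.1)%:E /\ (ratr pq.2)%:E < f w)}.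
  apply: ae_all => pq; have [pq'|npq] := boolP (ratr pq.1 < ratr pq.2 :> R)%R; last first.
    by apply: aeW.
  apply: ae_of_null (null _ pq') _; last by [].
  apply: GO; apply: (sGI sG); apply: Gmeasurable_setlt => //; exact: measurable_cst.
apply: filterS => w Hw; rewrite leNgt; apply/negP => gf.
(* Two rationals p < q between [g w] and [f w] are wanted; three real points a < b < c leave an
   interval for each. *)
have [a /andP[ga af]] : exists a : R, (g w < a%:E < f w).
  move: gf; case: (g w) => [r| |]; case: (f w) => [s| |] // rs.
  - by exists ((r + s) / 2)%R; rewrite !lte_fin; rewrite lte_fin in rs; lra.
  - by exists (r + 1)%R; rewrite lte_fin ltry andbT; lra.
  - by exists (s - 1)%R; rewrite lte_fin ltNyr /=; lra.
  - by exists 0%R; rewrite ltNyr ltry.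
have [b /andP[ab bf]] : exists b : R, (a%:E < b%:E < f w).
  move: af; case: (f w) => [s| |] //=; rewrite ?lte_fin => as'.
    by exists ((a + s) / 2)%R; rewrite !lte_fin; lra.
  by exists (a + 1)%R; rewrite lte_fin ltry andbT; lra.
have [c /andP[bc cf]] : exists c : R, (b%:E < c%:E < f w).
  move: bf; case: (f w) => [s| |] //=; rewrite ?lte_fin => as'.
    by exists ((b + s) / 2)%R; rewrite !lte_fin; lra.
  by exists (b + 1)%R; rewrite lte_fin ltry andbT; lra.
have [p] := @rat_in_itvoo R a b ab; have [q] := @rat_in_itvoo R b c bc.
rewrite !in_itv /= => /andP[q1 q2] /andP[p1 p2].
apply: (Hw (p, q)) => /=; first by lra.
split; first by apply: lt_trans ga _; rewrite lte_fin.
by apply: lt_trans cf; rewrite lte_fin.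
Qed.

End comparison.

(** * Lower limits of extended reals *)

Section limit_inferior.
Context {R : realType}.
Implicit Types (u : (\bar R)^nat) (a : \bar R).

Lemma limn_einfE u : limn_einf u = ereal_sup (range (einfs u)).
Proof. by rewrite limn_einf_lim; apply: cvg_lim => //; exact: cvg_einfs_sup. Qed.

Lemma limn_einf_ge u a : (exists N, forall n, (N <= n)%N -> a <= u n) -> a <= limn_einf u.
Proof.
move=> [N uN]; rewrite limn_einfE; apply: (@le_trans _ _ (einfs u N)).
  by apply: le_ereal_inf_tmp => _ [n /= Nn <-]; exact: uN.
by apply: ereal_sup_ubound; exists N.
Qed.

Lemma limn_einf_le_freq u a : (forall N, exists2 n, (N <= n)%N & u n <= a) ->
  limn_einf u <= a.
Proof.
move=> ua; rewrite limn_einfE; apply: ge_ereal_sup => _ [N _ <-].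
have [n Nn un] := ua N.
by apply: le_trans un; apply: ereal_inf_lbound; exists n => /=.
Qed.

Lemma limn_einf_le u a : (forall n, u n <= a) -> limn_einf u <= a.
Proof. by move=> ua; apply: limn_einf_le_freq => N; exists N. Qed.

Lemma le_of_lt_real (x y : \bar R) : (forall a : R, a%:E < x -> a%:E <= y) -> x <= y.
Proof.
move=> H; rewrite leNgt; apply/negP; case: x y H => [r| |] [s| |] //= H.
- rewrite lte_fin => sr.
  have /H : ((r + s) / 2)%:E < r%:E by rewrite lte_fin; lra.
  by rewrite lee_fin; lra.
- move=> _; have /H : (r - 1)%:E < r%:E by rewrite lte_fin; lra.
  by rewrite leeNy_eq.
- by move=> _; have /H := ltry (s + 1)%R; rewrite lee_fin; lra.
- by move=> _; have /H := ltry (0 : R)%R; rewrite leeNy_eq.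
Qed.

Lemma lt_ereal_mid (x y : \bar R) : x < y -> y < +oo -> exists a : R, x <= a%:E < y.
Proof.
case: x y => [r| |] [s| |] //=; rewrite ?lte_fin => xy _.
  by exists r; rewrite lexx lte_fin.
by exists (s - 1)%R; rewrite leNye lte_fin; lra.
Qed.

End limit_inferior.

(** * Countable gluing along measurable indices *)

Section gluing.
Context {d} {Omega : measurableType d} {R : realType} (P : probability Omega R).
Context (G : set (set Omega)) (sG : sigma_algebra setT G)
        (GO : G `<=` (measurable : set (set Omega))).

Lemma Gmeasurable_glue (idx : Omega -> nat) (f : nat -> Omega -> \bar R) :
  (forall i, G [set w | idx w = i]) -> (forall i, Gmeasurable G (f i)) ->
  Gmeasurable G (fun w => f (idx w) w).
Proof.
move=> Gi mf; apply/(GmP sG) => a.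
have H i : G [set w | idx w = i /\ f i w <= a%:E].
  by apply: (sG_and sG) => //; exact: (proj1 (GmP sG _) (mf i) a).
apply: (sG_eq _ (sG_ex sG H)) => w; split => [[i [<- //]]|h].
by exists (idx w).
Qed.

(** [A] is cut along the level sets of [idx], which belong to [G], and the nonnegative integrals are
    summed. This lets conditioned functions be evaluated at a random index. *)
Lemma integral_glue (idx : Omega -> nat) (f g : nat -> Omega -> \bar R) :
  (forall i, G [set w | idx w = i]) ->
  (forall i, measurable_fun setT (f i)) -> (forall i, measurable_fun setT (g i)) ->
  (forall i w, 0 <= f i w) -> (forall i w, 0 <= g i w) ->
  (forall i A, G A -> \int[P]_(w in A) f i w = \int[P]_(w in A) g i w) ->
  forall A, G A -> \int[P]_(w in A) f (idx w) w = \int[P]_(w in A) g (idx w) w.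
Proof.
move=> Gi mf mg f0 g0 fg A GA.
have smO := sigma_algebra_measurable Omega.
have mglue (h : nat -> Omega -> \bar R) : (forall i, measurable_fun setT (h i)) ->
    measurable_fun setT (fun w => h (idx w) w).
  move=> mh _ B mB; rewrite setTI.
  have H i : measurable [set w | idx w = i /\ B (h i w)].
    by apply: (sG_and smO); [exact: GO|rewrite -[X in measurable X]setTI; exact: mh].
  apply: (sG_eq _ (sG_ex smO H)) => w; split => [[i [<- //]]|?].
  by exists (idx w).
pose F i := A `&` [set w | idx w = i].
have GF i : G (F i) by exact: (sGI sG).
have AE : A = \bigcup_i F i.
  rewrite predeqE => w; split => [Aw|[i _ []]//].
  by exists (idx w).
have tF : trivIset setT F.
  by apply/trivIsetP => i j _ _ /eqP ij; rewrite predeqE => w; split => // -[[_ h1] [_ h2]]; case: ij; rewrite -h1 -h2.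
have E (h : nat -> Omega -> \bar R) : (forall i, measurable_fun setT (h i)) -> (forall i w, 0 <= h i w) ->
   \int[P]_(w in A) h (idx w) w = \sum_(0 <= i <oo) \int[P]_(w in F i) h i w.
  move=> mh h0; rewrite [in LHS]AE ge0_integral_bigcup //.
  - apply: eq_eseriesr => i _; apply: eq_integral => w.
    by rewrite inE => -[_ <-].
  - by move=> i; exact: GO.
  - by apply: measurable_funTS; exact: mglue.
by rewrite !E //; apply: eq_eseriesr => i _; exact: fg.
Qed.

End gluing.

(** * Normal integrands *)

Section normal_integrands.
Context {d} {Omega : measurableType d} {R : realType}.
Context {V : normedModType R} (fV : findim V).
Context (G : set (set Omega)) (sG : sigma_algebra setT G).

Lemma normal_integrand_measurable_cmap (h : V -> Omega -> \bar R) :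
  normal_integrand G h <-> measurable_cmap G (fun w => epi (h ^~ w)).
Proof. by split. Qed.

Lemma epi_hit (h : V -> Omega -> \bar R) (U : set V) (a : R) : normal_integrand G h -> open U ->
  G [set w | exists2 x, U x & h x w < a%:E].
Proof.
move=> [_ mh] oU.
have oO : open (U `*` [set r : R^o | (r < a)%R]).
  apply/open_normP => -[x r] [/= Ux ra]; move/open_normP: oU => /(_ _ Ux)[e e0 eU].
  exists (Num.min e (a - r))%R; first by rewrite lt_min e0 subr_gt0.
  move=> [y s]; rewrite prod_normE /= gt_max !lt_min => /andP[/andP[xy _] /andP[_ rs]].
  split => /=; first exact: eU.
  by have := ler_norm (s - r)%R; rewrite distrC; lra.
apply: (sG_eq _ (mh _ oO)) => w; split.
  move=> [[x r] [/= hr [Ux ra]]]; exists x => //.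
  by apply: le_lt_trans hr _; rewrite lte_fin.
move=> [x Ux hx]; have [r /andP[hr ra]] := lt_ereal_mid hx (ltry _).
by exists (x, r).
Qed.

(** The value at [x w] is at most [a] iff the epigraph meets the random singleton (x w, a), and
    intersections of measurable closed maps are measurable. *)
Lemma Gmeasurable_normal (h : V -> Omega -> \bar R) (x : Omega -> V) :
  normal_integrand G h -> rv G x -> Gmeasurable G (fun w => h (x w) w).
Proof.
move=> mh mx; apply/(GmP sG) => a.
have mxa := measurable_cmap_rv (rv_pair sG fV (findim_R R) mx (rv_cst sG (a : R^o))).
have fVR : findim ((V * R^o)%type : normedModType R) by apply: findim_prod.
have := measurable_cmap_setI sG fVR mh mxa => /(@measurable_cmap_nonempty _ _ _ _ _).
apply: sG_eq => w; split => [[[y b] [/= h1 [<- <-]]]//|h1].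
by exists (x w, a).
Qed.

Lemma epi_lt_open (h : V -> Omega -> \bar R) w (a : R) : normal_integrand G h ->
  open [set x | a%:E < h x w].
Proof.
move=> [/(_ w)/closed_normP ch _]; apply/open_normP => x /= ax.
apply: contrapT => nex.
have : epi (h ^~ w) (x, a : R^o).
  apply: ch => e e0; apply: contrapT => ney; apply: nex; exists e => // y xy.
  rewrite ltNge; apply/negP => ya; apply: ney; exists (y, a) => //.
  by rewrite prod_normE /= subrr normr0 gt_max xy.
by rewrite /epi /= leNgt ax.
Qed.

End normal_integrands.

Lemma measurable_limn_einf {d} {T : measurableType d} {R : realType} (f : nat -> T -> \bar R) :
  (forall k, measurable_fun setT (f k)) -> measurable_fun setT (fun w => limn_einf (f ^~ w)).
Proof.
move=> mf; rewrite /limn_einf; apply: measurableT_comp => //.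
apply: (@measurable_fun_limn_esup _ _ _ _ (fun k w => - f k w)) => k.
exact: measurableT_comp.
Qed.

(** * Construction of the conditional expectation of an integrand *)

Section conditional_expectation_of_integrand.
Context {d} {Omega : measurableType d} {R : realType} (P : probability Omega R).
Context (G : set (set Omega)) (HG : Defs.sub_sigma_algebra G).
Context {V : normedModType R} (fV : findim V).
Context (h : V -> Omega -> \bar R) (nh : normal_integrand measurable h).
Context (m : Omega -> R) (im : P.-integrable setT (EFin \o m)) (m0 : forall w, (0 <= m w)%R).
Hypothesis hm : {ae P, forall w, forall x, (- m w)%:E <= h x w}.
Context (q : nat -> V) (qP : forall v (e : R), (0 < e)%R -> exists i, (`|v - q i| < e)%R).

Let sG := proj1 HG.
Let GO := proj2 HG.
Let smO := sigma_algebra_measurable Omega.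
Let mm : measurable_fun setT (EFin \o m) := measurable_int _ im.

(** An index [j] encodes the center [q j.1.1], the radius 1/(j.1.2 + 1) and, in [trunc_inf], the
    truncation level [j.2]. *)
Let U (j : nat * nat * nat) : set V := ball (q j.1.1) (j.1.2.+1%:R^-1)%R.

Let inf_on (B : set V) w : \bar R := ereal_inf [set h x w | x in B].

(** After the shift by [m] the maximum with 0 is inactive almost surely; the cap makes the function
    integrable, as required by [ge0_cond_expectation]. The shift is undone after conditioning by
    subtracting [e], the conditional expectation of [m]. *)
Let trunc_inf (j : nat * nat * nat) w : \bar R :=
  mine (maxe (inf_on (U j) w + (m w)%:E) 0) (j.2%:R : R)%:E.

Let trunc_inf_ge0 j w : 0 <= trunc_inf j w.
Proof. by rewrite /trunc_inf le_min le_max lexx orbT lee_fin ler0n. Qed.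

Let trunc_inf_meas j : measurable_fun setT (trunc_inf j).
Proof.
have mi : measurable_fun setT (inf_on (U j)).
  apply: (Gmeasurable_measurable smO (@subset_refl _ _)); apply: (Gmeasurable_ltP smO) => a.
  apply: (sG_eq _ (epi_hit a nh (ball_open (q j.1.1) (j.1.2.+1%:R^-1)%R))) => w.
  split=> [[x Ux xa]|/ereal_inf_lt[_ [x Ux <-] xa]]; last by exists x.
  by apply/ereal_inf_ltP; exists (h x w) => //; exists x.
apply: measurable_mine => //; apply: measurable_maxe => //.
exact: emeasurable_funD.
Qed.

Let trunc_inf_int j : P.-integrable setT (trunc_inf j).
Proof.
apply: (@le_integrable _ _ _ P setT measurableT _ (cst (j.2%:R : R)%:E)) => //.
  move=> w _; rewrite !gee0_abs //; first by rewrite ge_min lexx orbT.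
  by rewrite lee_fin ler0n.
exact: finite_measure_integrable_cst.
Qed.

Let cP : exists c : nat * nat * nat -> Omega -> R, forall j, [/\ Gmeasurable G (EFin \o c j),
  forall w, (0 <= c j w)%R & forall A, G A ->
    \int[P]_(w in A) (c j w)%:E = \int[P]_(w in A) trunc_inf j w].
Proof.
have H j := ge0_cond_expectation HG (trunc_inf_ge0 j) (trunc_inf_int j).
by have [c cH] := choice H; exists c.
Qed.

Let eP : exists e : Omega -> R, [/\ Gmeasurable G (EFin \o e),
  forall w, (0 <= e w)%R & forall A, G A ->
    \int[P]_(w in A) (e w)%:E = \int[P]_(w in A) (m w)%:E].
Proof.
have m0E w : 0 <= (EFin \o m) w by rewrite lee_fin.
by have [e eH] := ge0_cond_expectation HG m0E im; exists e.
Qed.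

Let c := projT1 (cid cP).
Let e := projT1 (cid eP).
Let mc j : Gmeasurable G (EFin \o c j). Proof. by have [] := projT2 (cid cP) j. Qed.
Let c0 j w : (0 <= c j w)%R. Proof. by have [] := projT2 (cid cP) j. Qed.
Let cI j A : G A -> \int[P]_(w in A) (c j w)%:E = \int[P]_(w in A) trunc_inf j w.
Proof. by have [_ _] := projT2 (cid cP) j; apply. Qed.
Let me : Gmeasurable G (EFin \o e). Proof. by have [] := projT2 (cid eP). Qed.
Let e0 w : (0 <= e w)%R. Proof. by have [] := projT2 (cid eP). Qed.
Let eI A : G A -> \int[P]_(w in A) (e w)%:E = \int[P]_(w in A) (m w)%:E.
Proof. by have [_ _] := projT2 (cid eP); apply. Qed.

Let me' : measurable_fun setT (EFin \o e). Proof. exact: (Gmeasurable_measurable sG GO me). Qed.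

Let ie : P.-integrable setT (EFin \o e).
Proof.
apply/integrableP; split => //.
have /integrableP[_] := im; apply: le_lt_trans.
rewrite (eq_integral (fun w => (e w)%:E)); last by move=> w _; rewrite /= ger0_norm.
by rewrite (eI (sGT sG)) le_eqVlt; apply/orP; left; apply/eqP/eq_integral => w _; rewrite /= ger0_norm.
Qed.

(* [h x w] is the supremum of its infima over rational balls around [x]; the
   conditional expectation is the same supremum of the conditioned infima. *)
Let sup_at (x : V) w : \bar R := ereal_sup [set (c j w)%:E | j in [set j | U j x]].

Definition cexp (x : V) w : \bar R := sup_at x w - (e w)%:E.

Let sup_at_ge0 x w : 0 <= sup_at x w.
Proof.
have [i xi] := @qP x (1%:R^-1)%R ltac:(by rewrite invr_gt0).
apply: (@le_trans _ _ (c (i, 0%N, 0%N) w)%:E); first by rewrite lee_fin.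
apply: ereal_sup_ubound; exists (i, 0%N, 0%N) => //=.
by rewrite /U -ball_normE /= distrC.
Qed.

Lemma cexp_ge x w : (- e w)%:E <= cexp x w.
Proof. by rewrite /cexp EFinN leeDr. Qed.

Lemma cexp_lower_integrable : P.-integrable setT (EFin \o (fun w => - e w)%R).
Proof. exact: integrable_oppR. Qed.

Let cexp_leP x w (a : R) : cexp x w <= a%:E <-> forall j, U j x -> (c j w - e w <= a)%R.
Proof.
rewrite /cexp leeBlDr //; split=> [sa j Uj|H].
  rewrite lerBlDr -lee_fin EFinD; apply: le_trans sa.
  by apply: ereal_sup_ubound; exists j.
apply: ge_ereal_sup => _ [j Uj <-].
by rewrite -EFinD lee_fin -lerBlDr; exact: H.
Qed.

Let fVR : findim ((V * R^o)%type : normedModType R). Proof. exact: findim_prod. Qed.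

Let above (t : Omega -> R) w : set (V * R^o) := [set p | (t w <= p.2)%R].

Let above_measurable_cmap (t : Omega -> R) : Gmeasurable G (EFin \o t) -> measurable_cmap G (above t).
Proof.
move=> mt; split.
  move=> w; apply/closed_normP => -[x a] H; rewrite /above /=.
  apply/ler_addgt0Pr => r r0; have [[y b] /= tb] := H r r0.
  rewrite /above /= in tb; rewrite prod_normE /= gt_max => /andP[_ ab].
  by have := ler_norm (b - a)%R; rewrite distrC; lra.
move=> O oO; have [_ [p pP]] := fVR.
have H (l : nat) : G [set w | O (p l) /\ (t w < (p l).2)%R].
  apply: (sG_and sG); first exact: sG_prop.
  have := Gmeasurable_setlt HG mt (@measurable_cst _ _ (g_sigma_algebraType G) _ setT ((p l).2 : R)%:E).
  by apply: sG_eq => w /=; rewrite lte_fin.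
apply: (sG_eq _ (sG_ex sG H)) => w; split.
  by move=> [l [Ol tl]]; exists (p l); split => //; rewrite /above /= ltW.
move=> [[x a] [ta Oxa]]; move/open_normP: oO => /(_ _ Oxa)[r r0 rO].
have [l xl] := pP (x, (a + r / 2)%R : R^o) (r / 2)%R ltac:(by rewrite divr_gt0).
exists l; move: xl ta; rewrite prod_normE /= gt_max /above /= => /andP[xl al] ta.
split.
  apply: rO; rewrite prod_normE /= gt_max; apply/andP; split; first lra.
  rewrite ltr_norml in al; rewrite ltr_norml; move/andP: al => [a1 a2]; apply/andP; split; lra.
rewrite ltr_norml in al; move/andP: al => [a1 a2]; lra.
Qed.

(** The epigraph is a countable intersection: for each [j], either the point is outside the open
    ball [U j] or its height is at least [c j w - e w]. *)
Lemma cexp_normal : normal_integrand G cexp.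
Proof.
pose S (n : nat) w : set (V * R^o) :=
  if unpickle n is Some j then (~` U j `*` setT) `|` above (fun w => c j w - e w)%R w else setT.
have SE w : epi (cexp ^~ w) = \bigcap_n S n w.
  rewrite predeqE => -[x a]; rewrite /epi /= cexp_leP; split=> [H n _|H j Uj].
    rewrite /S; case: unpickle => [j|] //.
    by have [Uj|nUj] := pselect (U j x); [right; exact: H|left].
  by have := H (pickle j) I; rewrite /S pickleK => -[[]//|].
apply/normal_integrand_measurable_cmap.
have -> : (fun w => epi (cexp ^~ w)) = (fun w => \bigcap_n S n w) by apply/funext.
apply: measurable_cmap_bigcap => // n; rewrite /S; case: unpickle => [j|]; last exact: measurable_cmap_cst.
apply: measurable_cmap_setU => //.
  apply: measurable_cmap_cst => //; apply/closed_normP => -[x a] H; split => //= Ux.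
  move/open_normP: (ball_open (q j.1.1) (j.1.2.+1%:R^-1)%R) => /(_ _ Ux)[r r0 rU].
  by have [[y b] [/= + _]] := H r r0; rewrite prod_normE /= gt_max => + /andP[/rU].
apply: above_measurable_cmap.
rewrite (_ : EFin \o _ = (fun w => (c j w)%:E - (e w)%:E)) //.
apply: (@emeasurable_funB _ (g_sigma_algebraType G) R setT (fun w => (c j w)%:E) (fun w => (e w)%:E)); [exact: mc|exact: me].
Qed.

Section at_a_random_vector.
Context (x : Omega -> V) (mx : rv G x).

Let H w : \bar R := maxe (h (x w) w + (m w)%:E) 0.

Let mhx : measurable_fun setT (fun w => h (x w) w).
Proof.
have mx' : rv measurable x by move=> O oO; apply: GO; exact: mx.
exact: (Gmeasurable_measurable smO (@subset_refl _ _) (Gmeasurable_normal fV smO nh mx')).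
Qed.

Let mH : measurable_fun setT H.
Proof. by apply: measurable_maxe => //; exact: emeasurable_funD. Qed.

Let H0 w : 0 <= H w. Proof. by rewrite le_max lexx orbT. Qed.

Let mcx : Gmeasurable G (fun w => cexp (x w) w).
Proof. exact: Gmeasurable_normal cexp_normal mx. Qed.

Let msup : Gmeasurable G (fun w => sup_at (x w) w).
Proof.
rewrite (_ : (fun w => _) = (fun w => cexp (x w) w + (e w)%:E)).
  exact: (@emeasurable_funD _ (g_sigma_algebraType G)).
by apply/funext => w; rewrite /cexp subeK.
Qed.

Let msup' := Gmeasurable_measurable sG GO msup.

Let GU j : G [set w | U j (x w)].
Proof. exact: (mx (ball_open _ _)). Qed.

(** On the event that [x] is in [U j], [trunc_inf j] is at most [H] truncated at any level
    [k >= j.2], so [c j] is at most the conditional expectation [ck k]. Hence the supremum is below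
    the lower limit of the [ck k], and Fatou's lemma applies. *)
Let sup_le A : G A -> \int[P]_(w in A) sup_at (x w) w <= \int[P]_(w in A) H w.
Proof.
move=> GA.
pose Hk (k : nat) w := mine (H w) (k%:R : R)%:E.
have mHk k : measurable_fun setT (Hk k) by apply: measurable_mine.
have Hk0 k w : 0 <= Hk k w by rewrite le_min H0 lee_fin ler0n.
have iHk k : P.-integrable setT (Hk k).
  apply: (@le_integrable _ _ _ P setT measurableT _ (cst (k%:R : R)%:E)) => //.
    move=> w _; rewrite !gee0_abs //; first by rewrite ge_min lexx orbT.
    by rewrite lee_fin ler0n.
  exact: finite_measure_integrable_cst.
have [ck ckP] := choice (fun k => ge0_cond_expectation HG (Hk0 k) (iHk k)).
have mck k : Gmeasurable G (EFin \o ck k) by have [] := ckP k.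
have le_ck : {ae P, forall w, forall jk : (nat * nat * nat) * nat, U jk.1 (x w) ->
    (jk.1.2 <= jk.2)%N -> (c jk.1 w)%:E <= (ck jk.2 w)%:E}.
  apply: ae_all => -[j k] /=.
  have [jk|] := boolP (j.2 <= k)%N; last by move=> _; apply: aeW.
  pose f w := ((EFin \o c j) \_ [set w | U j (x w)]) w.
  pose g w := ((EFin \o ck k) \_ [set w | U j (x w)]) w.
  have mU : measurable ([set w | U j (x w)] : set (g_sigma_algebraType G)).
    by rewrite (GmeasE sG); exact: GU.
  have mres u : Gmeasurable G u -> Gmeasurable G (u \_ [set w | U j (x w)]).
    move=> mu; have := @measurable_restrictT _ _ (g_sigma_algebraType G) _ _ u mU.
    by move=> [+ _]; apply; exact: measurable_funTS.
  have : {ae P, forall w, f w <= g w}.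
    apply: (ae_le_of_integral HG); [exact: mres|exact: mres|].
    move=> B GB; rewrite -!integral_mkcondr.
    have GBU : G (B `&` [set w | U j (x w)]) by exact: (sGI sG).
    rewrite (cI _ GBU); have [_ _ ->//] := ckP k.
    apply: integral_le; [exact: GO|exact: measurable_funTS|exact: measurable_funTS|].
    move=> w [_ /= Ux]; rewrite /trunc_inf /Hk le_min; apply/andP; split; last first.
      by rewrite ge_min lee_fin ler_nat jk orbT.
    rewrite ge_min; apply/orP; left; rewrite ge_max H0 andbT /H le_max; apply/orP; left.
    by rewrite leeD2r //; apply: ereal_inf_lbound; exists (x w).
  by apply: filterS => w + Ux _; rewrite /f /g !patchE mem_set.
have : \int[P]_(w in A) sup_at (x w) w <= \int[P]_(w in A) limn_einf (fun k => (ck k w)%:E).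
  apply: integral_ae_le => //; first exact: GO.
    by apply: measurable_limn_einf => k; exact: (Gmeasurable_measurable sG GO (mck k)).
  apply: filterS le_ck => w Hw; apply: ge_ereal_sup => _ [j Uj <-].
  by apply: limn_einf_ge; exists j.2 => k jk; exact: (Hw (j, k)).
move/le_trans; apply.
have ft := @fatou _ _ _ P A (GO GA) (fun k w => (ck k w)%:E).
apply: (le_trans (ft _ _)).
- by move=> k; apply: measurable_funTS; exact: (Gmeasurable_measurable sG GO (mck k)).
- by move=> k w _; rewrite lee_fin; have [] := ckP k.
apply: limn_einf_le => k; have [_ _ ->//] := ckP k.
apply: integral_le; [exact: GO|exact: measurable_funTS|exact: measurable_funTS|].
by move=> w _; rewrite /Hk ge_min lexx.
Qed.

(** [eta n] is the truncated infimum over a ball around a center chosen [G]-measurably near [x w],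
    so gluing bounds its integral by that of the supremum. Lower semicontinuity puts [H] below the
    lower limit of the [eta n], and Fatou's lemma concludes. *)
Let sup_ge A : G A -> \int[P]_(w in A) H w <= \int[P]_(w in A) sup_at (x w) w.
Proof.
move=> GA.
pose idx n w := least (fun i => U (i, n, n) (x w)).
have Uidx n w : U (idx n w, n, n) (x w).
  apply: (@leastP (fun i => U (i, n, n) (x w))).
  have [i xi] := @qP (x w) (n.+1%:R^-1)%R ltac:(by rewrite invr_gt0).
  by exists i; rewrite /U -ball_normE /= distrC.
have Gidx n i : G [set w | idx n w = i] by apply: (G_least sG) => j; exact: GU.
pose eta n w := trunc_inf (idx n w, n, n) w.
have meta n : measurable_fun setT (eta n).
  apply: (Gmeasurable_measurable smO (@subset_refl _ _)).
  apply: (@Gmeasurable_glue _ _ _ _ smO (idx n) (fun i => trunc_inf (i, n, n))).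
    by move=> i; apply: GO; exact: Gidx.
  move=> i; apply/(GmP smO) => a.
  by rewrite -[X in measurable X]setTI; exact: emeasurable_fun_infty_c.
have etaI n : \int[P]_(w in A) eta n w <= \int[P]_(w in A) sup_at (x w) w.
  rewrite -(@integral_glue _ _ _ P _ sG GO (idx n) (fun i w => (c (i, n, n) w)%:E)
     (fun i => trunc_inf (i, n, n))) //; last 3 first.
  - by move=> i; exact: (Gmeasurable_measurable sG GO (mc _)).
  - by move=> i w; rewrite lee_fin.
  - by move=> i B GB; exact: cI.
  apply: integral_le; [exact: GO| |exact: measurable_funTS|].
    apply: measurable_funTS; apply: (Gmeasurable_measurable sG GO).
    apply: (@Gmeasurable_glue _ _ _ _ sG (idx n) (fun i w => (c (i, n, n) w)%:E)) => // i.
    exact: mc.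
  by move=> w _; apply: ereal_sup_ubound; exists (idx n w, n, n) => //; exact: Uidx.
have Heta w : H w <= limn_einf (fun n => eta n w).
  apply: le_of_lt_real => a aH; apply: limn_einf_ge.
  have [a0|a0] := leP a 0%R.
    exists 0%N => n _; apply: (@le_trans _ _ 0); first by rewrite lee_fin.
    exact: trunc_inf_ge0.
  have ah : (a - m w)%:E < h (x w) w.
    rewrite EFinB lteBlDr //; move: aH; rewrite /H lt_max => /orP[//|].
    by rewrite lte_fin ltNge (ltW a0).
  have oh := epi_lt_open w (a - m w)%R nh.
  move/open_normP: oh => /(_ _ ah)[r r0 rh].
  have [k _ kP] := near_infty_natSinv_lt (PosNum (divr_gt0 r0 (ltr0n R 2))).
  (* From here on twice the radius 1/(n+1) is below [r], so the ball stays where [h] exceeds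
     [a - m w], and the truncation level [n] exceeds [a]. *)
  exists (maxn k (Num.trunc a).+1) => n; rewrite geq_max => /andP[kn an].
  have := kP n kn => /= {}kP.
  rewrite /eta /trunc_inf le_min; apply/andP; split; last first.
    rewrite lee_fin; apply: (@le_trans _ _ (Num.trunc a).+1%:R); last by rewrite ler_nat.
    by apply: ltW; have /andP[_] := Num.Theory.truncn_itv (ltW a0).
  rewrite le_max; apply/orP; left; rewrite -leeBlDr // -EFinB.
  apply: le_ereal_inf_tmp => _ [y Uy <-]; apply: ltW; apply: rh.
  have := Uidx n w; move: Uy; rewrite /U -!ball_normE /= => qy qx.
  rewrite [r]splitr; apply: (@dist_lt _ _ (q (idx n w))).
    by rewrite distrC; exact: lt_trans kP.
  exact: lt_trans kP.
apply: (@le_trans _ _ (\int[P]_(w in A) limn_einf (fun n => eta n w))).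
  apply: integral_le; [exact: GO|exact: measurable_funTS| |by move=> w _].
  by apply: measurable_funTS; exact: measurable_limn_einf.
apply: (le_trans (@fatou _ _ _ P A (GO GA) eta _ _)).
- by move=> n; exact: measurable_funTS.
- by move=> n w _; exact: trunc_inf_ge0.
exact: limn_einf_le.
Qed.

Lemma cexp_cond_expectation :
  is_cond_expectation P G (fun w => h (x w) w) (fun w => cexp (x w) w).
Proof.
split; first exact: mcx.
move=> A GA; have mA := GO GA.
have hx : {ae P, forall w, (- m w)%:E <= h (x w) w} by apply: filterS hm => w; apply.
rewrite (integrable_below_shift mA mhx im hx) -/H.
have -> : \int[P]_(w in A) H w = \int[P]_(w in A) sup_at (x w) w.
  by apply/eqP; rewrite eq_le sup_le // sup_ge.
rewrite (_ : \int[P]_(w in A) (- m w)%:E = \int[P]_(w in A) (- e w)%:E).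
  by rewrite -integral_ge0D //; exact: integrable_oppR.
have intN u : (forall w, (0 <= u w)%R) ->
    \int[P]_(w in A) (- u w)%:E = - \int[P]_(w in A) (u w)%:E.
  move=> u0; rewrite -integral_ge0N //; last by move=> w _; rewrite lee_fin.
by rewrite !intN // eI.
Qed.

End at_a_random_vector.
End conditional_expectation_of_integrand.

(** * Extended-real convex functions through their epigraphs *)

Section convex_functions.
Context {R : realType} {V : normedModType R}.
Implicit Types f : V -> \bar R.

Lemma le_of_epi f (x : V) (b : \bar R) :
  (forall a : R, b <= a%:E -> f x <= a%:E) -> f x <= b.
Proof.
move=> H; case: b H => [r|_|H]; [by apply|exact: leey|].
rewrite leNgt; apply/negP => fx.
have [fy|] := ltP (f x) +oo; last first.
  by rewrite leye_eq => /eqP fE; have := H 0%R (leNye _); rewrite fE leye_eq.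
have [a /andP[_ af]] := lt_ereal_mid fx fy.
by have := H a (leNye _); rewrite leNgt af.
Qed.

Lemma cvx_epi_le f (t : R) x y : cvx (epi f) -> (forall x, -oo < f x) -> (0 <= t <= 1)%R ->
  f (t *: x + (1 - t) *: y)%R <= t%:E * f x + (1 - t)%:E * f y.
Proof.
move=> cf fN /andP[t0 t1].
have [->|tn0] := eqVneq t 0%R.
  by rewrite scale0r add0r subr0 scale1r mul0e mul1e add0e.
have [->|tn1] := eqVneq t 1%R.
  by rewrite scale1r subrr scale0r addr0 mul0e mul1e adde0.
have tp : (0 < t)%R by rewrite lt_neqAle eq_sym tn0.
have sp : (0 < 1 - t)%R by rewrite subr_gt0 lt_neqAle tn1.
have := fN x; have := fN y; case Ex: (f x) => [r| |] //; case Ey: (f y) => [s| |] // _ _.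
- have : epi f (t *: ((x, r) : V * R^o) + (1 - t) *: ((y, s) : V * R^o))%R.
    by apply: cf; rewrite ?t0 ?t1 // /epi /= ?Ex ?Ey.
  by rewrite /epi.
- by rewrite gt0_muley ?lte_fin // -EFinM addey // leey.
- by rewrite gt0_muley ?lte_fin // -EFinM addye // leey.
- by rewrite !gt0_muley ?lte_fin // addye // leey.
Qed.

(* The vectors [z] at which the recession function of [f] is nonpositive. *)
Definition fun_reccone f : set V := [set z | reccone (epi f) (z, 0%R : R^o)].

Lemma fun_reccone0 f : fun_reccone f 0%R. Proof. exact: reccone0. Qed.

Lemma recdir_epi0 f z : recdir (epi f) (z, 0%R : R^o) <-> forall x, f (x + z)%R <= f x.
Proof.
split=> [rz x|H [x a]].
  apply: le_of_epi => a fa; have := rz (x, a) fa; by rewrite /epi /= addr0.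
by rewrite /epi /= addr0; apply: le_trans.
Qed.

Lemma epi_nonempty f : epi f !=set0 <-> dom f !=set0.
Proof.
split=> [[[x a]]|[x fx]]; rewrite /epi /=.
  by move=> fa; exists x; rewrite /dom /=; apply: le_lt_trans fa (ltry _).
have [fN|] := ltP -oo (f x).
  exists (x, fine (f x)); rewrite /epi /= fineK //.
  by apply: fin_real; rewrite fN.
by rewrite leeNy_eq => /eqP fE; exists (x, 0%R); rewrite /epi /= fE leNye.
Qed.

End convex_functions.

(** * Operations on random vectors *)

Section random_vectors.
Context {R : realType} {T : Type} (G : set (set T)).
Hypothesis sG : sigma_algebra setT G.

Lemma rv_lin {V : normedModType R} (a b : R) (x y : T -> V) : findim V ->
  rv G x -> rv G y -> rv G (fun w => a *: x w + b *: y w)%R.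
Proof.
move=> fV mx my.
have c : continuous (fun p : (V * V)%type => a *: p.1 + b *: p.2)%R.
  move=> p; apply: cvgD; first by apply: cvgZr; exact: cvg_fst.
  by apply: cvgZr; exact: cvg_snd.
exact: (rv_comp c (rv_pair sG fV fV mx my)).
Qed.

Lemma rv_add {V : normedModType R} (x y : T -> V) : findim V ->
  rv G x -> rv G y -> rv G (fun w => x w + y w)%R.
Proof.
move=> fV mx my; have := rv_lin 1 1 fV mx my.
by congr (rv G _); apply/funext => w; rewrite !scale1r.
Qed.

Lemma rv_opp {V : normedModType R} (x : T -> V) : findim V ->
  rv G x -> rv G (fun w => - x w)%R.
Proof.
move=> fV mx; have := rv_lin (-1) 0 fV mx mx.
by congr (rv G _); apply/funext => w; rewrite scale0r addr0 scaleN1r.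
Qed.

Lemma rv_fst {V W : normedModType R} (x : T -> (V * W)%type) : rv G x -> rv G (fun w => (x w).1).
Proof. by apply: rv_comp => p; exact: cvg_fst. Qed.

Lemma rv_snd {V W : normedModType R} (x : T -> (V * W)%type) : rv G x -> rv G (fun w => (x w).2).
Proof. by apply: rv_comp => p; exact: cvg_snd. Qed.

End random_vectors.

(** * Monotonicity, uniqueness, convexity and recession for conditional expectations *)

Section properties_of_conditional_expectations.
Context {d} {Omega : measurableType d} {R : realType} (P : probability Omega R).
Context (G : set (set Omega)) (HG : Defs.sub_sigma_algebra G).
Context {V : normedModType R} (fV : findim V).

Let sG := proj1 HG.
Let GO := proj2 HG.
Let smO := sigma_algebra_measurable Omega.
Let fVR : findim ((V * R^o)%type : normedModType R). Proof. exact: findim_prod. Qed.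

Lemma rv_Gmeasurable (a : Omega -> R) : rv G (a : Omega -> R^o) -> Gmeasurable G (EFin \o a).
Proof.
move=> ma; apply: (Gmeasurable_ltP sG) => r.
have := ma [set b : R^o | (b < r)%R] ltac:(exact: open_lt).
by apply: sG_eq => w; rewrite /preimage /= lte_fin.
Qed.

Lemma rv_ambient (x : Omega -> V) : rv G x -> rv measurable x.
Proof. by move=> mx O oO; apply: GO; exact: mx. Qed.

Lemma measurable_normal (h : V -> Omega -> \bar R) x : normal_integrand measurable h ->
  rv G x -> measurable_fun setT (fun w => h (x w) w).
Proof.
move=> nh mx; apply: (Gmeasurable_measurable smO (@subset_refl _ _)).
exact: (Gmeasurable_normal fV smO nh (rv_ambient mx)).
Qed.

(** The null set may depend on [v], so the inequality is tested on a Castaing representation of the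
    epigraph of [g'] and extended by closedness of the epigraph of [g]. *)
Lemma ae_epi_sub (g g' : V -> Omega -> \bar R) (z : Omega -> V) :
  normal_integrand G g -> normal_integrand G g' ->
  (forall v, rv G v -> {ae P, forall w, g (v w + z w)%R w <= g' (v w) w}) ->
  {ae P, forall w, forall x, g (x + z w)%R w <= g' x w}.
Proof.
move=> ng ng' H.
have [p [mp pS pd]] := castaing sG fVR (proj1 (normal_integrand_measurable_cmap G g') ng').
have : {ae P, forall w, forall i, g ((p i w).1 + z w)%R w <= g' (p i w).1 w}.
  by apply: ae_all => i; apply: H; exact: rv_fst.
apply: filterS => w Hw x; apply: (@le_of_epi _ _ (fun x => g (x + z w)%R w)) => a xa.
have Se : epi (g' ^~ w) !=set0 by exists (x, a).
have : epi (g ^~ w) ((x + z w)%R, a : R^o); last by [].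
move/closed_normP: (proj1 ng w); apply => r r0.
have [i] := pd w (x, a) r xa r0.
rewrite prod_normE /= gt_max => /andP[xi ai].
exists (((p i w).1 + z w)%R, (p i w).2).
  by rewrite /epi /=; apply: le_trans (Hw i) _; exact: pS i w Se.
by rewrite prod_normE /= gt_max ai andbT opprD addrACA subrr addr0.
Qed.

(** The shift [z] lets one statement serve both for monotonicity ([z = 0]) and for passing a
    recession direction of [h] on to its conditional expectation ([h' = h]). *)
Lemma cond_expectation_le (h h' g g' : V -> Omega -> \bar R) (z : Omega -> V) :
  normal_integrand measurable h -> normal_integrand measurable h' -> rv G z ->
  is_cond_expectation_integrand P G h g -> is_cond_expectation_integrand P G h' g' ->
  {ae P, forall w, forall x, h (x + z w)%R w <= h' x w} ->
  {ae P, forall w, forall x, g (x + z w)%R w <= g' x w}.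
Proof.
move=> nh nh' mz [ng hg] [ng' hg'] hh'; apply: ae_epi_sub => // v mv.
have mvz : rv G (fun w => v w + z w)%R by exact: rv_add.
have [mg Ig] := hg _ (proj2 (rv_random_vector sG _) mvz).
have [mg' Ig'] := hg' _ (proj2 (rv_random_vector sG _) mv).
apply: (ae_le_of_integral HG) => // A GA; rewrite Ig // Ig' //.
apply: integral_ae_le; first exact: GO.
- exact: (measurable_normal (x := fun w => v w + z w)%R).
- exact: measurable_normal.
by apply: filterS hh' => w; apply.
Qed.

Lemma cond_expectation_unique (h h' g g' : V -> Omega -> \bar R) :
  normal_integrand measurable h -> normal_integrand measurable h' ->
  is_cond_expectation_integrand P G h g -> is_cond_expectation_integrand P G h' g' ->
  {ae P, forall w, forall x, h x w = h' x w} ->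
  {ae P, forall w, forall x, g x w = g' x w}.
Proof.
move=> nh nh' hg hg' hh'.
have m0 := rv_cst sG (0 : V)%R.
have h1 : {ae P, forall w, forall x, g (x + 0)%R w <= g' x w}.
  apply: (cond_expectation_le nh nh' m0 hg hg').
  by apply: filterS hh' => w E x; rewrite addr0 E.
have h2 : {ae P, forall w, forall x, g' (x + 0)%R w <= g x w}.
  apply: (cond_expectation_le nh' nh m0 hg' hg).
  by apply: filterS hh' => w E x; rewrite addr0 E.
apply: filterS2 h1 h2 => w H1 H2 x; apply/eqP; rewrite eq_le.
by have := H1 x; have := H2 x; rewrite addr0 => -> ->.
Qed.

Lemma integrable_below_normal (h : V -> Omega -> \bar R) (x : Omega -> V) :
  lower_bounded P h -> integrable_below P (fun w => h (x w) w).
Proof. by move=> [m im hm]; exists m => //; apply: filterS hm => w; apply. Qed.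

Lemma lower_bounded_gtNy (h : V -> Omega -> \bar R) : lower_bounded P h ->
  {ae P, forall w, forall x, -oo < h x w}.
Proof.
move=> [m im hm]; apply: filterS hm => w H x; apply: lt_le_trans (H x).
exact: ltNyr.
Qed.

(** Almost sure statements reach only countably many points and weights; closedness extends them to
    all points, one argument at a time, and finally to real weights. *)
Lemma closed_convex_of_dense (S D : set (V * R^o)) : closed S ->
  (forall p (r : R), S p -> (0 < r)%R -> exists2 p', D p' & (`|p - p'| < r)%R) ->
  (forall (t : rat) p p', (0 <= (ratr t : R) <= 1)%R -> D p -> D p' ->
    S (ratr t *: p + (1 - ratr t) *: p')%R) -> cvx S.
Proof.
move=> cS dD xD.
have ext (A : set (V * R^o)) : closed A -> D `<=` A -> S `<=` A.
  move=> /closed_normP cA DA p Sp; apply: cA => r r0.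
  by have [p' /DA Ap' pp'] := dD p r Sp r0; exists p'.
have step1 (t : rat) p p' : (0 <= (ratr t : R) <= 1)%R -> D p -> S p' ->
    S (ratr t *: p + (1 - ratr t) *: p')%R.
  move=> t01 Dp; apply: (ext [set p' | S (ratr t *: p + (1 - ratr t) *: p')%R]).
    apply: (closed_comp _ cS) => x _; apply: cvgD; first exact: cvg_cst.
    by apply: cvgZr.
  by move=> x Dx; exact: xD.
have step2 (t : rat) p p' : (0 <= (ratr t : R) <= 1)%R -> S p -> S p' ->
    S (ratr t *: p + (1 - ratr t) *: p')%R.
  move=> t01 Sp Sp'; apply: (ext [set p | S (ratr t *: p + (1 - ratr t) *: p')%R]) Sp.
    apply: (closed_comp _ cS) => x _; apply: cvgD; last exact: cvg_cst.
    by apply: cvgZr.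
  by move=> x Dx; exact: step1.
move=> t p p' /andP[t0 t1] Sp Sp'.
have : closed [set t : R^o | S (t *: p + (1 - t) *: p')%R].
  apply: (closed_comp _ cS) => x _; apply: cvgD; apply: cvgZl => //.
  by apply: cvgB => //; exact: cvg_cst.
move/closed_normP; apply => r r0.
(* If [t < r], a rational between [t - r] and [t] could be negative, so the weight 0 is used
   instead. *)
have [tr|tr] := ltP t r.
  exists 0%R; last by rewrite subr0 ger0_norm.
  by have := @step2 0%R _ _ _ Sp Sp'; rewrite /= rmorph0; apply; rewrite lexx ler01.
have [s] := @rat_in_itvoo R (t - r)%R t ltac:(lra).
rewrite in_itv /= => /andP[s1 s2]; exists (ratr s).
  by apply: step2 => //; apply/andP; split; lra.
by rewrite ger0_norm; lra.
Qed.

(** The convexity inequality of [h] at two measurable points with a rational weight is integrated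
    over sets of [G], where [h] and [g] have equal integrals. *)
Lemma cond_expectation_convex (h g : V -> Omega -> \bar R) :
  normal_integrand measurable h -> convex_integrand h ->
  lower_bounded P h -> lower_bounded P g ->
  is_cond_expectation_integrand P G h g ->
  {ae P, forall w, cvx (epi (g ^~ w))}.
Proof.
move=> nh xh lh lg [ng hg].
have [p [mp pS pd]] := castaing sG fVR (proj1 (normal_integrand_measurable_cmap G g) ng).
pose pt (t : rat) i j w : V := (ratr t *: (p i w).1 + (1 - ratr t) *: (p j w).1)%R.
have mpt t i j : rv G (pt t i j) by apply: rv_lin => //; exact: rv_fst.
have key : {ae P, forall w, forall tij : rat * nat * nat, (0 <= (ratr tij.1.1 : R) <= 1)%R ->
   g (pt tij.1.1 tij.1.2 tij.2 w) w <=
   (ratr tij.1.1)%:E * g (p tij.1.2 w).1 w + (1 - ratr tij.1.1)%:E * g (p tij.2 w).1 w}.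
  apply: ae_all => -[[t i] j] /=.
  have [/andP[t0 t1]|nt] := boolP (0 <= (ratr t : R) <= 1)%R; last by apply: aeW.
  have s0 : (0 <= 1 - (ratr t : R))%R by lra.
  have cE v : rv G v -> is_cond_expectation P G (fun w => h (v w) w) (fun w => g (v w) w).
    by move=> mv; apply: hg; apply/(rv_random_vector sG).
  have mi : rv G (fun w => (p i w).1) by exact: rv_fst.
  have mj : rv G (fun w => (p j w).1) by exact: rv_fst.
  have [m1 I1] := cE _ (mpt t i j); have [m2 I2] := cE _ mi; have [m3 I3] := cE _ mj.
  have mh v : rv G v -> measurable_fun setT (fun w => h (v w) w) by exact: measurable_normal.
  have mg v : rv G v -> measurable_fun setT (fun w => g (v w) w).
    by move=> mv; apply: (Gmeasurable_measurable sG GO); have [] := cE _ mv.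
  have lz (f : V -> Omega -> \bar R) v (c : R) : lower_bounded P f -> (0 <= c)%R ->
      integrable_below P (fun w => c%:E * f (v w) w).
    move=> lf c0; have [m im fm] := integrable_below_normal v lf.
    exists (fun w => c * m w)%R.
      by have := integrableZl measurableT c im; apply: eq_integrable.
    by apply: filterS fm => w ?; rewrite EFinM lee_wpmul2l // lee_fin.
  suff : {ae P, forall w, g (pt t i j w) w <=
      (ratr t)%:E * g (p i w).1 w + (1 - ratr t)%:E * g (p j w).1 w}.
    by apply: filterS => w.
  apply: (ae_le_of_integral HG) => //.
    by apply: (@emeasurable_funD _ (g_sigma_algebraType G)); apply: measurable_funeM.
  move=> A GA; have mA := GO GA.
  rewrite integral_integrable_belowD //; [|apply: measurable_funeM; exact: mg|
    apply: measurable_funeM; exact: mg|exact: lz|exact: lz].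
  rewrite !integral_integrable_belowZ //; [|exact: mg|exact: integrable_below_normal|exact: mg|exact: integrable_below_normal].
  rewrite I1 // I2 // I3 //.
  rewrite -!integral_integrable_belowZ //; [|exact: mh|exact: integrable_below_normal|exact: mh|exact: integrable_below_normal].
  rewrite -integral_integrable_belowD //; [|apply: measurable_funeM; exact: mh|
    apply: measurable_funeM; exact: mh|exact: lz|exact: lz].
  apply: integral_ae_le => //; first exact: mh.
    by apply: emeasurable_funD; apply: measurable_funeM; exact: mh.
  have hN' := lower_bounded_gtNy lh; apply: filterS hN' => w hN.
  by apply: (@cvx_epi_le _ _ (h ^~ w) (ratr t)); [exact/convex_setP/xh| |rewrite t0].
apply: filterS key => w Hw.
pose D := [set pp | epi (g ^~ w) pp /\ exists i, pp = p i w].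
apply: (@closed_convex_of_dense _ D); first exact: (proj1 ng w).
  move=> pp r Sp r0; have [i pi] := pd w pp r Sp r0.
  by exists (p i w) => //; split; [apply: pS; exists pp|exists i].
move=> t _ _ t01 [/[swap] -[i ->] Si] [/[swap] -[j ->] Sj].
rewrite /epi /=; apply: le_trans (Hw (t, i, j) t01) _ => /=.
move/andP: t01 => [t0 t1].
rewrite -[leRHS]/((ratr t * (p i w).2 + (1 - ratr t) * (p j w).2)%:E).
rewrite [leRHS]EFinD !EFinM; apply: leeD.
  by rewrite lee_wpmul2l ?lee_fin.
by rewrite lee_wpmul2l ?lee_fin ?subr_ge0.
Qed.

(** Let (v, a) be a selection of the epigraph of [g]. Along [y k], that is v + (k+1) z, the values
    of [g] stay below [a], so on events where [a] is bounded the integrals of h(y k) plus the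
    integrable bound [mu] are bounded uniformly in [k]. By Fatou's lemma these sums divided by k+1
    have lower limit 0: for every slope [r > 0] the epigraph of [h] contains (y k, r (k+1)) for
    arbitrarily large [k], and [recdir_lim] yields the direction (z, 0). *)
Lemma fun_reccone_cond_expectation (h g : V -> Omega -> \bar R) (z : Omega -> V) :
  normal_integrand measurable h -> convex_integrand h -> lower_bounded P h ->
  is_cond_expectation_integrand P G h g -> rv G z ->
  {ae P, forall w, fun_reccone (g ^~ w) (z w)} -> {ae P, forall w, fun_reccone (h ^~ w) (z w)}.
Proof.
move=> nh xh lh [ng hg] mz gz.
have mg := proj1 (normal_integrand_measurable_cmap G g) ng.
have [p mp pS] := measurable_selection sG fVR mg.
pose A := [set w | epi (g ^~ w) !=set0].
have GA : G A := measurable_cmap_nonempty mg.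
pose v w := (p w).1; pose a w : R := (p w).2.
have mv : rv G v by exact: rv_fst.
have ma : Gmeasurable G (EFin \o a) by apply: rv_Gmeasurable; exact: rv_snd.
pose y (k : nat) w : V := (1 *: v w + k.+1%:R *: z w)%R.
have my k : rv G (y k) by exact: rv_lin.
have [m [im m0] hm] := integrable_below_nonneg (integrable_below_normal (fun=> 0%R : V) lh).
have [m1 im1 hm1] := lh.
pose mu w := `|m1 w|%R.
have imu : P.-integrable setT (EFin \o mu) by exact: integrable_norm.
have hmu : {ae P, forall w, forall x, (- mu w)%:E <= h x w}.
  apply: filterS hm1 => w H x; apply: le_trans (H x); rewrite lee_fin lerNl.
  by rewrite /mu -normrN ler_norm.
pose F (k : nat) w := maxe (h (y k w) w + (mu w)%:E) 0.
have mmu : measurable_fun setT (EFin \o mu) := measurable_int _ imu.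
have mhy k : measurable_fun setT (fun w => h (y k w) w) by exact: measurable_normal.
have mF k : measurable_fun setT (F k).
  by apply: measurable_maxe => //; exact: emeasurable_funD.
have F0 k w : 0 <= F k w by rewrite /F le_max lexx orbT.
pose f (k : nat) w := (k.+1%:R^-1 : R)%:E * F k w.
have f0 k w : 0 <= f k w by rewrite mule_ge0 // lee_fin invr_ge0.
have mf k : measurable_fun setT (f k) by exact: measurable_funeM.
pose B (n : nat) := A `&` [set w | (a w)%:E <= (n%:R : R)%:E].
have GB n : G (B n) by apply: (sGI sG) => //; exact: (proj1 (GmP sG _) ma n%:R).
have mB n : measurable (B n) := GO (GB n).
have small n : {ae P, forall w, B n w -> limn_einf (f ^~ w) = 0}.
  have ml : measurable_fun setT (fun w => limn_einf (f ^~ w)).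
    exact: measurable_limn_einf.
  have l0 w : 0 <= limn_einf (f ^~ w) by apply: limn_einf_ge; exists 0%N.
  have FI : exists C : R, forall k, \int[P]_(w in B n) F k w <= C%:E.
    have imuN : P.-integrable (B n) (EFin \o (fun w => - mu w)%R).
      by apply: (integrableS measurableT) => //; exact: integrable_oppR.
    pose r := fine (\int[P]_(w in B n) (- mu w)%:E).
    have rE : \int[P]_(w in B n) (- mu w)%:E = r%:E.
      by rewrite fineK //; exact: integrable_fin_num imuN.
    (* On [B n] the values of [g] at [y k] are at most [a <= n], and the probability of [B n] is at
       most 1; [r] is the integral of [- mu]. *)
    exists (n%:R - r)%R => k.
    suff : \int[P]_(w in B n) F k w + r%:E <= (n%:R : R)%:E.
      by rewrite EFinB leeBrDr.
    have hyk : {ae P, forall w, (- mu w)%:E <= h (y k w) w} by apply: filterS hmu => w; apply.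
    rewrite -rE -(integrable_below_shift (mB n) (mhy k) imu hyk).
    have [mgy <-//] := hg _ (proj2 (rv_random_vector sG _) (my k)).
    apply: (@le_trans _ _ (\int[P]_(w in B n) (cst (n%:R : R)%:E) w)).
      apply: integral_ae_le_on => //; first exact: (Gmeasurable_measurable sG GO mgy).
      apply: filterS gz => w /reccone_recdir rz [Aw an]; apply: le_trans an.
      have := recdir_nat k.+1 rz (pS w Aw).
      by rewrite /epi /= scaler0 addr0 /y scale1r.
    rewrite integral_cst // -[leRHS]mule1 lee_wpmul2l ?lee_fin //.
    exact: probability_le1.
  have [C CP] := FI.
  have C0 : (0 <= C)%R.
    by rewrite -lee_fin; apply: le_trans (CP 0%N); apply: integral_ge0.
  have L0 : \int[P]_(w in B n) limn_einf (f ^~ w) <= 0.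
    apply: (le_trans (@fatou _ _ _ P (B n) (mB n) f _ _)) => //.
      by move=> k; exact: measurable_funTS.
    apply/lee_addgt0Pr => r r0; rewrite add0e.
    apply: limn_einf_le_freq => N.
    have rC : (0 < r / (1 + C))%R by rewrite divr_gt0 //; lra.
    have [K _ KP] := near_infty_natSinv_lt (PosNum rC).
    exists (maxn N K); first by rewrite leq_maxl.
    have /= kP := KP _ (leq_maxr N K).
    rewrite /f ge0_integralZl_EFin //; last exact: measurable_funTS.
    apply: (@le_trans _ _ (((maxn N K).+1%:R^-1 : R)%:E * C%:E)).
      by rewrite lee_wpmul2l // lee_fin invr_ge0.
    rewrite -EFinM lee_fin; apply: (@le_trans _ _ (r / (1 + C) * C)%R).
      by rewrite ler_wpM2r // ltW.
    rewrite mulrAC ler_pdivrMr; last lra.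
    by rewrite ler_pM2l //; lra.
  have Labs : \int[P]_(w in B n) `|limn_einf (f ^~ w)| = 0.
    rewrite (eq_integral (fun w => limn_einf (f ^~ w))); last by move=> w _; rewrite gee0_abs.
    by apply/eqP; rewrite eq_le L0 integral_ge0.
  have [H _] := @ae_eq_integral_abs _ _ _ P (B n) (mB n) (fun w => limn_einf (f ^~ w))
     (measurable_funTS ml).
  exact: (H Labs).
have small' : {ae P, forall w, forall n, B n w -> limn_einf (f ^~ w) = 0} by exact: ae_all.
apply: filterS3 gz hmu small' => w zw muw Lw.
(* Where the epigraph of [g] is empty its cone is trivial, so [z w] is 0. *)
have [Aw|nAw] := pselect (A w); last first.
  case: zw => [zE|[]//]; have -> : z w = 0%R by case: zE.
  exact: fun_reccone0.
have Bw : B (Num.trunc (a w)).+1 w.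
  split => //; rewrite /= lee_fin ltW //.
  have [a0|a0] := leP 0%R (a w); last by apply: lt_le_trans a0 _; rewrite ler0n.
  by have /andP[_] := Num.Theory.truncn_itv a0.
have L0 := Lw _ Bw.
have freq (r : R) (N : nat) : (0 < r)%R -> exists2 k, (N <= k)%N & epi (h ^~ w) (y k w, (r * k.+1%:R)%R : R^o).
  move=> r0; apply: contrapT => nex.
  have : r%:E <= limn_einf (f ^~ w).
    apply: limn_einf_ge; exists N => k Nk; rewrite leNgt; apply/negP => fr; apply: nex.
    exists k => //; rewrite /epi /=.
    move: fr; rewrite /f muleC lte_pdivrMr // => fr.
    have : h (y k w) w + (mu w)%:E <= (r * k.+1%:R)%:E.
      by rewrite EFinM; apply: le_trans (ltW fr); rewrite /F le_max lexx.
    apply: le_trans; rewrite leeDl // lee_fin; exact: normr_ge0.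
  by rewrite L0 lee_fin leNgt r0.
have [k0 _ hk0] := freq 1%R 0%N ltr01.
right; split; first by exists (y k0 w, (1 * k0.+1%:R)%R : R^o).
apply: recdir_lim; first exact: (proj1 nh w).
  exact/convex_setP/xh.
move=> e e0.
have v0 := normr_ge0 (v w).
have e0' : (0 < e / (1 + `|v w|))%R by rewrite divr_gt0 // ltr_wpDr.
have [K _ KP] := near_infty_natSinv_lt (PosNum e0').
have [k Kk hk] := freq (e / 2)%R K ltac:(lra).
have /= kP := KP _ Kk.
have kp : (0 < k.+1%:R^-1 :> R)%R by rewrite invr_gt0.
have he : (e / (1 + `|v w|) * (1 + `|v w|) = e)%R by rewrite divfK //; apply/eqP; lra.
exists (k.+1%:R^-1)%R, (y k w, (e / 2 * k.+1%:R)%R : R^o); split => //.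
- by rewrite invf_le1 // ler1n.
- apply: lt_le_trans kP _; rewrite ler_pdivrMr; last lra.
  by rewrite ler_peMr ?(ltW e0)//; lra.
- rewrite prod_normE /= gt_max; apply/andP; split.
    rewrite /y scale1r scalerDr scalerA mulVf ?pnatr_eq0// scale1r addrK normrZ gtr0_norm //.
    apply: (@le_lt_trans _ _ (k.+1%:R^-1 * (1 + `|v w|))%R).
      by rewrite ler_pM2l //; lra.
    by rewrite -[ltRHS]he ltr_pM2r //; lra.
  rewrite subr0 (_ : _ *: _ = e / 2 :> R)%R; first by rewrite gtr0_norm; lra.
  by rewrite /GRing.scale /= mulrCA mulVf ?pnatr_eq0// mulr1.
Qed.

End properties_of_conditional_expectations.

(** * Recession functions versus recession directions *)

Section recession_function.
Context {R : realType} {V : normedModType R} (g : V -> \bar R) (m : R).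
Hypotheses (cg : closed (epi g)) (xg : cvx (epi g)) (dg : dom g !=set0).
Hypothesis gm : forall x, m%:E <= g x.

Let gN x : -oo < g x. Proof. exact: lt_le_trans (ltNyr _) (gm x). Qed.

Let xbar := xget 0%R (dom g).
Let gxbar : g xbar < +oo. Proof. exact: (xgetPex 0%R dg). Qed.
Let c := fine (g xbar).
Let cE : g xbar = c%:E.
Proof. by rewrite fineK //; apply: fin_real; rewrite gN gxbar. Qed.

Let quot z (a : R) : \bar R := (g (xbar + a *: z)%R - g xbar) * (a^-1)%:E.

Let quot_ge z a : (0 < a)%R -> ((m - c) / a)%:E <= quot z a.
Proof.
move=> a0; rewrite /quot EFinM lee_wpmul2r ?lee_fin ?invr_ge0 ?(ltW a0) //.
by rewrite EFinB cE leeB.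
Qed.

Let quot_le0 z a : (0 < a)%R -> (quot z a <= 0) = (g (xbar + a *: z)%R <= c%:E).
Proof.
move=> a0; rewrite /quot cE; have := gN (xbar + a *: z)%R.
case: (g (xbar + a *: z)%R) => [r| |] // _.
  by rewrite -EFinB -EFinM !lee_fin pmulr_lle0 ?invr_gt0 // subr_le0.
by rewrite addye // gt0_mulye ?lte_fin ?invr_gt0 // !leye_eq.
Qed.

Let quot_mono z (a b : R) : (0 < a)%R -> (a <= b)%R -> quot z a <= quot z b.
Proof.
move=> a0 ab; have b0 : (0 < b)%R by exact: lt_le_trans ab.
have := @cvx_epi_le _ _ g (a / b)%R (xbar + b *: z)%R xbar xg gN.
have -> : ((a / b) *: (xbar + b *: z) + (1 - a / b) *: xbar = xbar + a *: z)%R.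
  rewrite scalerDr scalerBl scale1r scalerA divfK ?gt_eqF //.
  by rewrite [((a / b) *: xbar + _)%R]addrC -addrA [((a / b) *: xbar + _)%R]addrC subrK addrC.
have ab0 : (0 < a / b)%R by rewrite divr_gt0.
have ab1 : (a / b <= 1)%R by rewrite ler_pdivrMr // mul1r.
rewrite (ltW ab0) ab1 => /(_ isT); rewrite /quot cE.
have ga := gN (xbar + a *: z)%R; have := gN (xbar + b *: z)%R.
case: (g (xbar + b *: z)%R) => [s| |] // _.
- move: ga; case: (g (xbar + a *: z)%R) => [r| |] // _.
  rewrite -!EFinB -!EFinM -!EFinD !lee_fin => h.
  rewrite ler_pdivrMr // mulrAC -mulrA; lra.
- by rewrite addye // gt0_mulye ?lte_fin ?invr_gt0 // leey.
Qed.

(** Difference quotients are monotone for positive [a] only; [Num.max a 1] makes them monotone on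
    the whole line without changing the limit at +oo. *)
Let recE z : recession g z = ereal_sup (range (fun a => quot z (Num.max a 1)%R)).
Proof.
apply: cvg_lim => //.
have : (fun a => quot z (Num.max a 1)%R) x @[x --> +oo%R] -->
   ereal_sup (range (fun a => quot z (Num.max a 1)%R)).
  apply: nondecreasing_cvge => a b ab; apply: quot_mono.
    by rewrite lt_max ltr01 orbT.
  by rewrite ge_max !le_max ab lexx orbT.
apply: cvg_trans; apply: near_eq_cvg; near=> a.
have /max_idPl -> // : (1 <= a)%R.
by near: a; exact: nbhs_pinfty_ge.
Unshelve. all: by end_near. Qed.

(** The lower bound [m] keeps the quotient at [b] above (m - c)/b, which tends to 0. Nonnegativity
    is what splits a sum of recession functions into its terms. *)
Lemma recession_ge0 z : 0 <= recession g z.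
Proof.
rewrite recE; apply: le_of_lt_real => a; rewrite lte_fin => a0.
pose b := (Num.max ((c - m) / (- a)) 1)%R.
have b1 : (1 <= b)%R by rewrite le_max lexx orbT.
have b0 : (0 < b)%R by lra.
apply: (@le_trans _ _ (quot z b)); last first.
  by apply: ereal_sup_ubound; exists b => //; congr quot; apply/max_idPl.
apply: le_trans (quot_ge z b0); rewrite lee_fin ler_pdivlMr //.
have : ((c - m) / (- a) <= b)%R by rewrite le_max lexx.
by rewrite ler_pdivrMr ?oppr_gt0 //; lra.
Qed.

(** Nonpositivity says that [g] stays below its value [c] along the ray from [xbar], which puts a
    horizontal ray in the epigraph. *)
Lemma recession_le0P z : recession g z <= 0 <-> fun_reccone g z.
Proof.
have ne : epi g !=set0 by apply/epi_nonempty.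
rewrite recE; split=> [le0|/reccone_recdir rz].
  right; split => //; apply: (@recdir_ray _ _ _ (xbar, c : R^o)) => // k.
  rewrite /epi /= scaler0 addr0; case: k => [|k]; first by rewrite scale0r addr0 cE.
  rewrite -quot_le0 ?ltr0n //; apply: le_trans le0.
  apply: ereal_sup_ubound; exists k.+1%:R => //; congr quot; apply/max_idPl.
  by rewrite ler1n.
apply: ge_ereal_sup => _ [a _ <-].
set b := (Num.max a 1)%R; have b0 : (0 < b)%R by rewrite lt_max ltr01 orbT.
rewrite quot_le0 //.
have := recdir_scale xg rz (ltW b0) (s := (xbar, c : R^o)).
by rewrite /epi /= cE lexx scaler0 addr0; apply.
Qed.

End recession_function.

(** * One stage of the recursion at a fixed outcome *)

Section pointwise_stage.
Context {R : realType} {X C : normedModType R} (fX : findim X) (fC : findim C).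

Lemma recdir_epi_dir {V : normedModType R} (f : V -> \bar R) (m : R) z (a : R) : (forall x, m%:E <= f x) ->
  epi f !=set0 -> recdir (epi f) (z, a : R^o) -> (0 <= a)%R.
Proof.
move=> fm [[x b] fb] rz; rewrite leNgt; apply/negP => a0.
have [k kP] : exists k : nat, ((b - m) / (- a) < k.+1%:R)%R.
  have [h|h] := leP 0%R ((b - m) / - a)%R.
    by exists (Num.trunc ((b - m) / - a)%R); have /andP[] := Num.Theory.truncn_itv h.
  by exists 0%N; apply: lt_trans h _; rewrite ltr0n.
have := recdir_nat k.+1 rz fb; rewrite /epi /=.
move/(le_trans (fm _)); rewrite lee_fin /GRing.scale /= => h.
by move: kP; rewrite ltr_pdivrMr ?oppr_gt0 //; lra.
Qed.

Definition inf_control (E : X * C -> \bar R) (x : X) : \bar R :=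
  ereal_inf [set E (x, v) | v in [set: C]].

(* [K] and [E] stand for K_(t+1) and E_(t+1) Qtilde_(t+1), so that the value is
   Qtilde_t. *)
Definition stage_value (K : X * C * X -> \bar R) (E : X * C -> \bar R) (z : X * C) : \bar R :=
  ereal_inf [set K (z, y) + inf_control E y | y in [set: X]].

Context (K : X * C * X -> \bar R) (E : X * C -> \bar R) (mK mE : R).
Hypotheses (Km : forall x, mK%:E <= K x) (Em : forall p, mE%:E <= E p).

Let inf_control_le p : inf_control E p.1 <= E p.
Proof. by apply: ereal_inf_lbound; exists p.2 => //; rewrite -surjective_pairing. Qed.

Let inf_control_ge x : mE%:E <= inf_control E x.
Proof. by apply: le_ereal_inf_tmp => _ [v _ <-]. Qed.

Lemma stage_value_le z p : stage_value K E z <= K (z, p.1) + E p.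
Proof.
apply: (@le_trans _ _ (K (z, p.1) + inf_control E p.1)); last by rewrite leeD2l.
by apply: ereal_inf_lbound; exists p.1.
Qed.

Lemma stage_value_ge z : (mK + mE)%:E <= stage_value K E z.
Proof. by apply: le_ereal_inf_tmp => _ [y _ <-]; rewrite EFinD leeD. Qed.

Lemma stage_value_lt z (r : R) : stage_value K E z < r%:E ->
  exists p a, epi K ((z, p.1), a : R^o) /\ epi E (p, (r - a)%R : R^o).
Proof.
move=> /ereal_inf_lt[_ [y _ <-]] h.
have Ky : K (z, y) \is a fin_num.
  apply: fin_real; rewrite (lt_le_trans (ltNyr _) (Km _)) /=.
  rewrite ltNge leye_eq; apply/negP => /eqP KE; move: h; rewrite KE addye //.
  by have := inf_control_ge y; case: (inf_control E y).
have KE : K (z, y) = (fine (K (z, y)))%:E by rewrite fineK.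
move: h; rewrite KE -lteBrDl // => /ereal_inf_lt[_ [u _ <-]] h.
exists (y, u), (fine (K (z, y))); split; first by rewrite /epi /= -KE.
by rewrite /epi /= EFinB ltW.
Qed.

(** Near-minimizers are translated by [p], so attainment is not involved. When the domain of [E] is
    empty the stage value is identically +oo, hence the guard on the second hypothesis. *)
Lemma stage_value_mono z p : fun_reccone K (z, p.1) -> (dom E !=set0 -> fun_reccone E p) ->
  forall v, stage_value K E (v + z)%R <= stage_value K E v.
Proof.
move=> /reccone_recdir/recdir_epi0 Kz Ep v; apply: le_of_epi => r vr.
apply/lee_addgt0Pr => e e0.
have [|q [a [Ka Eq]]] := @stage_value_lt v (r + e)%R.
  by apply: le_lt_trans vr _; rewrite lte_fin; lra.
have dE : dom E !=set0 by apply/epi_nonempty; eexists; exact: Eq.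
have /reccone_recdir/recdir_epi0 Eq' := Ep dE.
apply: (le_trans (stage_value_le _ (q + p)%R)).
rewrite -EFinD (_ : r + e = a + (r + e - a))%R; last by lra.
rewrite [leRHS]EFinD; apply: leeD.
  exact: (le_trans (Kz (v, q.1)) Ka).
exact: (le_trans (Eq' q) Eq).
Qed.

Hypotheses (cK : closed (epi K)) (cE : closed (epi E)) (xK : cvx (epi K)) (xE : cvx (epi E)).
Hypothesis sym : forall p, fun_reccone K (0, p.1)%R -> fun_reccone E p -> fun_reccone K (0, - p.1)%R /\ fun_reccone E (- p)%R.

(** Elements are ((z, r), (p, a)): the total height [r] is split into [a] for [K] and [r - a] for
    [E]. The projection onto (z, r) turns out to be the epigraph of the stage value. *)
Let S : set ((X * C * R^o) * ((X * C) * R^o)) :=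
  [set q | epi K ((q.1.1, q.2.1.1), q.2.2) /\ epi E (q.2.1, (q.1.2 - q.2.2)%R)].

Let closed_S : closed S.
Proof.
apply: closedI.
  apply: (@closed_comp _ _ (fun q : (X * C * R^o) * ((X * C) * R^o) => ((q.1.1, q.2.1.1), q.2.2)) _ _ cK).
  move=> q _; apply: cvg_pair_nbhs; first apply: cvg_pair_nbhs.
  - by do 2 apply: cvg_pr1.
  - by do 2 apply: cvg_pr1; apply: cvg_pr2.
  - by do 2 apply: cvg_pr2.
apply: (@closed_comp _ _ (fun q : (X * C * R^o) * ((X * C) * R^o) => (q.2.1, (q.1.2 - q.2.2)%R : R^o)) _ _ cE).
move=> q _; apply: cvg_pair_nbhs; first by apply: cvg_pr1; apply: cvg_pr2.
apply: cvgB; first by apply: cvg_pr2; apply: cvg_pr1.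
by do 2 apply: cvg_pr2.
Qed.

Let cvx_S : cvx S.
Proof.
move=> t q q' t01 [Kq Eq] [Kq' Eq']; split; first exact: (xK t01 Kq Kq').
have := xE t01 Eq Eq'; congr (epi E _); congr pair => /=.
by rewrite /GRing.scale /=; lra.
Qed.

Let recdir_S q : S !=set0 -> recdir S q ->
  recdir (epi K) ((q.1.1, q.2.1.1), q.2.2) /\ recdir (epi E) (q.2.1, (q.1.2 - q.2.2)%R : R^o).
Proof.
move=> [s Ss] rq; split.
  apply: (@recdir_ray _ _ _ ((s.1.1, s.2.1.1), s.2.2)) => // k.
  by have [] := recdir_nat k rq Ss.
apply: (@recdir_ray _ _ _ (s.2.1, (s.1.2 - s.2.2)%R : R^o)) => // k.
have [_] := recdir_nat k rq Ss; congr (epi E _); congr pair => /=.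
by rewrite /GRing.scale /=; lra.
Qed.

Let S_epi q : S q -> epi K !=set0 /\ epi E !=set0.
Proof. by move=> [Kq Eq]; split; eexists; [exact: Kq|exact: Eq]. Qed.

Let sym_S q : recdir S (0, q)%R -> recdir S (0, - q)%R.
Proof.
have [[s Ss]|S0] := pselect (S !=set0); last by move=> _ s Ss; case: S0; exists s.
move=> /(recdir_S (ex_intro _ s Ss))[/= rK rE]; have [eK eE] := S_epi Ss.
(* The lower bounds make both height components, a and -a, nonnegative; the direction is therefore
   horizontal and [sym] applies. *)
have a0 := recdir_epi_dir Km eK rK; have a1 := recdir_epi_dir Em eE rE.
have qE : q = (q.1, 0%R : R^o).
  by rewrite [LHS]surjective_pairing; congr pair; apply/eqP; rewrite eq_le a0 andbT; lra.
rewrite qE /= in rK rE; rewrite subr0 in rE.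
have [||/reccone_recdir rK' /reccone_recdir rE'] := sym (p := q.1); [by right|by right|].
move=> u [Ku Eu]; rewrite qE; split => /=.
  have := rK' _ Ku; congr (epi K _).
  rewrite /= subr0.
  transitivity ((u.1.1 + 0)%R, (u.2.1.1 - q.1.1)%R, (u.2.2 + 0)%R : R^o) => //.
  by congr pair; rewrite addr0.
have := rE' _ Eu; congr (epi E _); rewrite /= subr0 addr0.
transitivity ((u.2.1 - q.1)%R, (u.1.2 - u.2.2 + 0)%R : R^o) => //.
by congr pair; rewrite addr0.
Qed.

Let fW : findim (((X * C) * R^o)%type : normedModType R).
Proof. by apply: findim_prod => //; exact: findim_prod. Qed.

Let proj_closed : closed [set za | exists q, S (za, q)].
Proof. exact: (closed_projection fW closed_S cvx_S sym_S). Qed.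

(** Near-minimizers put (z, r + e/2) in the projection of [S] for every e > 0, and this projection
    is closed. Joint attainment in the next state and control is contained in this. *)
Lemma epi_stage_value z (r : R) : epi (stage_value K E) (z, r : R^o) <->
  exists p a, epi K ((z, p.1), a : R^o) /\ epi E (p, (r - a)%R : R^o).
Proof.
split=> [zr|[p [a [Ka Ep]]]]; last first.
  rewrite /epi /=; apply: le_trans (stage_value_le z p) _.
  apply: (@le_trans _ _ (a%:E + (r - a)%:E)); first exact: leeD.
  by rewrite -EFinD addrC subrK.
suff : [set za | exists q, S (za, q)] (z, r : R^o).
  by move=> [[p a] [Ka Ep]]; exists p, a.
move/closed_normP: proj_closed; apply => e e0.
have [|p [a [Ka Ep]]] := @stage_value_lt z (r + e / 2)%R.
  by apply: le_lt_trans zr _; rewrite lte_fin /= ltrDl divr_gt0.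
exists (z, (r + e / 2)%R : R^o); first by exists (p, a : R^o).
by rewrite prod_normE /= subrr normr0 opprD addNKr normrN gt_max e0 /= gtr0_norm ?divr_gt0 // ltr_pdivrMr // ltr_pMr // ltr1n.
Qed.

Let epi_stage_valueE : epi (stage_value K E) = [set za | exists q, S (za, q)].
Proof.
rewrite predeqE => -[z r]; split => [/epi_stage_value[p [a [Ka Ep]]]|[[p a] [Ka Ep]]].
  by exists (p, a : R^o).
by apply/epi_stage_value; exists p, a.
Qed.

Lemma closed_epi_stage_value : closed (epi (stage_value K E)).
Proof. by rewrite epi_stage_valueE; exact: proj_closed. Qed.

Lemma cvx_epi_stage_value : cvx (epi (stage_value K E)).
Proof.
rewrite epi_stage_valueE => t z z' t01 [q Sq] [q' Sq'].
by exists (t *: q + (1 - t) *: q')%R; exact: (cvx_S t01 Sq Sq').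
Qed.

Lemma fun_reccone_stage_value z : fun_reccone (stage_value K E) z -> exists p, fun_reccone K (z, p.1) /\ fun_reccone E p.
Proof.
move=> [zE|[e0 rz]].
  have -> : z = 0%R by case: zE.
  by exists 0%R; split; exact: fun_reccone0.
move: e0 rz; rewrite epi_stage_valueE => -[za [q0 Sq0]] rz.
have [[p a] rp] := recdir_projection fW closed_S cvx_S sym_S (ex_intro _ _ Sq0) rz.
have [/= rK rE] := recdir_S (ex_intro _ _ Sq0) rp.
have [eK eE] := S_epi Sq0.
have a0 := recdir_epi_dir Km eK rK; have a1 := recdir_epi_dir Em eE rE.
have aE : a = 0%R by apply/eqP; rewrite eq_le a0 andbT; lra.
rewrite aE subr0 in rK rE.
by exists p; split; right.
Qed.

Lemma stage_attained z : exists p, K (z, p.1) + E p <= stage_value K E z.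
Proof.
have gev : stage_value K E z \is a fin_num \/ stage_value K E z = +oo.
  have := stage_value_ge z; case: (stage_value K E z) => [r| |] //; by [left|right].
case: gev => [vf|->]; last by exists 0%R; exact: leey.
have : epi (stage_value K E) (z, fine (stage_value K E z) : R^o) by rewrite /epi /= fineK.
move=> /epi_stage_value[p [a [Ka Ep]]]; exists p; rewrite -(fineK vf).
apply: (@le_trans _ _ (a%:E + (fine (stage_value K E z) - a)%:E)); first exact: leeD.
by rewrite -EFinD addrC subrK.
Qed.

Let T : set ((X * R^o) * C) := [set q | epi E ((q.1.1, q.2), q.1.2)].

Let closed_T : closed T.
Proof.
apply: (@closed_comp _ _ (fun q : (X * R^o) * C => ((q.1.1, q.2), q.1.2)) _ _ cE).
move=> q _; apply: cvg_pair_nbhs; first apply: cvg_pair_nbhs.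
- by do 2 apply: cvg_pr1.
- exact: cvg_snd.
- by apply: cvg_pr2; apply: cvg_pr1.
Qed.

Let cvx_T : cvx T. Proof. by move=> t q q' t01 Eq Eq'; exact: (xE t01 Eq Eq'). Qed.

(** Only the control is projected out here: this is [sym] at p = (0, u), where the condition on [K]
    concerns the zero direction. *)
Let sym_T u : recdir T (0, u)%R -> recdir T (0, - u)%R.
Proof.
have [[s Ts]|T0] := pselect (T !=set0); last by move=> _ s Ts; case: T0; exists s.
move=> ru.
have rE : recdir (epi E) ((0%R, u) : X * C, 0%R : R^o).
  apply: (@recdir_ray _ _ _ ((s.1.1, s.2), s.1.2)) => // k.
  exact: (recdir_nat k ru Ts).
have eE : epi E !=set0 by exists ((s.1.1, s.2), s.1.2).
have [||_ /reccone_recdir rE'] := sym (p := (0%R, u)); [exact: fun_reccone0|by right|].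
move=> q Tq; have := rE' _ Tq; congr (epi E _).
transitivity ((q.1.1 - 0)%R, (q.2 - u)%R, (q.1.2 + 0)%R : R^o) => //.
by rewrite oppr0.
Qed.

Lemma epi_inf_control x (r : R) : epi (inf_control E) (x, r : R^o) <->
  exists u, epi E ((x, u), r : R^o).
Proof.
split=> [xr|[u Eu]]; last by rewrite /epi /=; apply: le_trans (inf_control_le (x, u)) Eu.
suff : [set xa | exists u, T (xa, u)] (x, r : R^o) by [].
move/closed_normP: (closed_projection fC closed_T cvx_T sym_T); apply => e e0.
have /ereal_inf_lt[_ [u _ <-] ur] : inf_control E x < (r + e / 2)%:E.
  by apply: le_lt_trans xr _; rewrite lte_fin /= ltrDl divr_gt0.
exists (x, (r + e / 2)%R : R^o); first by exists u; exact: ltW.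
by rewrite prod_normE /= subrr normr0 opprD addNKr normrN gt_max e0 /= gtr0_norm ?divr_gt0 // ltr_pdivrMr // ltr_pMr // ltr1n.
Qed.

Let epi_inf_controlE : epi (inf_control E) = [set xa | exists u, T (xa, u)].
Proof. by rewrite predeqE => -[x r]; exact: epi_inf_control. Qed.

Lemma closed_epi_inf_control : closed (epi (inf_control E)).
Proof. by rewrite epi_inf_controlE; exact: (closed_projection fC closed_T cvx_T sym_T). Qed.

Lemma cvx_epi_inf_control : cvx (epi (inf_control E)).
Proof.
rewrite epi_inf_controlE => t z z' t01 [q Sq] [q' Sq'].
by exists (t *: q + (1 - t) *: q')%R; exact: (cvx_T t01 Sq Sq').
Qed.

End pointwise_stage.

(** * Closed sets and closed cones *)

Section closed_sets.
Context {R : realType} {V W : normedModType R}.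

Lemma closed_eqset (f g : V -> W) : continuous f -> continuous g -> closed [set x | f x = g x].
Proof.
move=> cf cg.
have -> : [set x | f x = g x] = (fun x => f x - g x)%R @^-1` [set 0%R].
  by rewrite predeqE => x; split=> /= [->|/eqP]; [rewrite subrr|rewrite subr_eq0 => /eqP].
apply: closed_comp.
  by move=> x _; apply: cvgB; [exact: cf|exact: cg].
by apply/closed_normP => v H; apply: dist_eq => e /H[_ ->].
Qed.

Lemma closed_leset (f g : V -> R^o) : continuous f -> continuous g -> closed [set x | (f x <= g x)%R].
Proof.
move=> cf cg.
have -> : [set x | (f x <= g x)%R] = (fun x => g x - f x)%R @^-1` [set r : R^o | (0 <= r)%R].
  by rewrite predeqE => x /=; rewrite subr_ge0.
apply: closed_comp; last exact: closed_ge.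
by move=> x _; apply: cvgB; [exact: cg|exact: cf].
Qed.

Lemma closed_reccone (S : set V) : closed S -> closed (reccone S).
Proof.
move=> cS; have [[s0 Ss0]|S0] := pselect (S !=set0).
  apply/closed_normP => z H; right; split; first by exists s0.
  move=> s Ss; move/closed_normP: cS; apply => e e0.
  have [z' /reccone_recdir rz' zz'] := H e e0.
  by exists (s + z')%R; [exact: rz'|rewrite opprD addrACA subrr add0r].
apply/closed_normP => z H; left; apply: dist_eq => e /H[z' [->//|[]//]].
Qed.

End closed_sets.

Lemma closed_fun_reccone {R : realType} {V : normedModType R} (f : V -> \bar R) :
  closed (epi f) -> closed (fun_reccone f).
Proof.
move=> /closed_reccone cf; apply: (@closed_comp _ _ (fun z => (z, 0%R : R^o)) _ _ cf).
by move=> z _; apply: cvg_pair_nbhs => //; exact: cvg_cst.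
Qed.

(** * Measurability of recession cones *)

Section recession_maps.
Context {R : realType} {T : Type} (G : set (set T)) (sG : sigma_algebra setT G).
Context {V : normedModType R} (fV : findim V).

(** By [recdir_ray] it suffices to test the rays from one measurable selection [p], so the cone is a
    countable intersection of affine preimages of the epigraph. Adding 0 covers the empty epigraph.
    [Rm] is measurable at all [w], and is the cone where [h] is convex. *)
Lemma measurable_cmap_fun_reccone (h : V -> T -> \bar R) : measurable_cmap G (fun w => epi (h ^~ w)) ->
  exists2 Rm : T -> set V, measurable_cmap G Rm & forall w, cvx (epi (h ^~ w)) ->
    Rm w = fun_reccone (h ^~ w).
Proof.
move=> mh; have fVR : findim ((V * R^o)%type : normedModType R) by apply: findim_prod.
have [p mp pS] := measurable_selection sG fVR mh.
pose S (n : nat) w : set V := [set z | epi (h ^~ w) ((p w).1 + n.+1%:R *: z, (p w).2)%R].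
have mS n : measurable_cmap G (S n).
  have mhp := measurable_cmap_prod sG fVR fVR mh (measurable_cmap_rv mp).
  apply: (@measurable_cmap_map _ _ _ sG _ _ _ [set q : (V * R^o) * (V * R^o) | q.1.2 = q.2.2]
     (fun q : (V * R^o) * (V * R^o) => n.+1%:R^-1 *: (q.1.1 - q.2.1))%R (S n) _ mhp).
  - exact: findim_prod.
  - by apply: closed_eqset => q; apply: cvg_pr2; [exact: cvg_fst|exact: cvg_snd].
  - move=> q; apply: cvgZr; apply: cvgB; apply: cvg_pr1; [exact: cvg_fst|exact: cvg_snd].
  - move=> w; apply: (@closed_comp _ _ (fun z => ((p w).1 + n.+1%:R *: z, (p w).2)%R) _ _ (proj1 mh w)).
    move=> z _; apply: cvg_pair_nbhs; last exact: cvg_cst.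
    by apply: cvgD; [exact: cvg_cst|exact: cvgZr].
  - move=> w u; split.
      move=> Su; exists (((p w).1 + n.+1%:R *: u, (p w).2)%R, p w); split => //=.
      by rewrite addrAC subrr add0r scalerA mulVf ?pnatr_eq0 // scale1r.
    move=> [[[x a] b] [[/= xa bE] /= aE <-]].
    by rewrite /S /= scalerA mulfV ?pnatr_eq0 // scale1r -bE -aE addrC subrK.
exists (fun w => (\bigcap_n S n w) `|` [set 0%R]).
  apply: measurable_cmap_setU => //; first exact: measurable_cmap_bigcap.
  apply: measurable_cmap_cst => //.
  by apply/closed_normP => v H; apply: dist_eq => e /H[_ ->].
move=> w xw; rewrite predeqE => z; split.
  move=> [Sz|->]; last exact: fun_reccone0.
  have pw : epi (h ^~ w) (p w) by apply: pS; eexists; exact: (Sz 0%N).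
  right; split; first by exists (p w).
  apply: (@recdir_ray _ _ _ (p w)) => // [|k]; first exact: (proj1 mh w).
  case: k => [|k]; first by rewrite scale0r addr0.
  have := Sz k I; rewrite /S /=; congr (epi _ _).
  by rewrite [RHS]surjective_pairing /= scaler0 addr0.
move=> [zE|[e0 rz]]; first by right; case: zE.
left => n _; have := recdir_nat n.+1 rz (pS w e0); rewrite /S /=; congr (epi _ _).
by rewrite [LHS]surjective_pairing /= scaler0 addr0.
Qed.

End recession_maps.

(** * Normal integrands modified off a set of full measure *)

Section normal_on_good_sets.
Context {d} {Omega : measurableType d} {R : realType}.
Let smO := sigma_algebra_measurable Omega.

(** Closedness is known on [Gd] only, while a normal integrand must be closed at every [w]; the
    constant 0 fills in outside. *)
Lemma normal_on {V : normedModType R} (Gd : set Omega) (f : V -> Omega -> \bar R) :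
  measurable Gd -> (forall w, Gd w -> closed (epi (f ^~ w))) ->
  (forall O, open O -> measurable [set w | Gd w /\ epi (f ^~ w) `&` O !=set0]) ->
  normal_integrand measurable (fun x w => if `[< Gd w >] then f x w else 0).
Proof.
move=> mG cf mf.
have c0 : closed (epi (fun _ : V => 0 : \bar R)).
  have -> : epi (fun _ : V => 0) = [set q : V * R^o | (0 <= q.2)%R].
    by rewrite predeqE => q; rewrite /epi /= lee_fin.
  by apply: closed_leset => q; [exact: cvg_cst|exact: cvg_snd].
have E w : epi (fun x => if `[< Gd w >] then f x w else 0) =
    if `[< Gd w >] then epi (f ^~ w) else epi (fun _ : V => 0).
  by case: ifP.
split => [w|O oO]; first by rewrite E; case: asboolP => [/cf|].
have H1 := mf O oO.
have H2 : measurable [set w | ~ Gd w /\ epi (fun _ : V => 0 : \bar R) `&` O !=set0].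
  by apply: (sG_and smO); [exact: (sGC smO mG)|exact: sG_prop].
apply: (sG_eq _ (sGU smO H1 H2)) => w; rewrite E; case: asboolP => Gw; split.
- by move=> [[]|[]].
- by left.
- by move=> [[]|[]].
- by right.
Qed.

Context {X C : normedModType R} (fX : findim X) (fC : findim C).
Context (K : X * C * X -> Omega -> \bar R) (E : X * C -> Omega -> \bar R).
Hypotheses (nK : normal_integrand measurable K) (nE : normal_integrand measurable E).
Context (Gd : set Omega) (mGd : measurable Gd).

Let fXC : findim ((X * C)%type : normedModType R). Proof. exact: findim_prod. Qed.
Let fE : findim ((X * C * R^o)%type : normedModType R). Proof. exact: findim_prod. Qed.
Let fK : findim ((X * C * X * R^o)%type : normedModType R).
Proof. by apply: findim_prod => //; exact: findim_prod. Qed.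

(** The epigraph is the set of (z, a + b) for points of the two epigraphs, of heights [a] and [b],
    with matching next state; hitting [O] becomes hitting a closed set and an open set with the
    product map. *)
Lemma stage_value_normal :
  (forall w, Gd w -> closed (epi (stage_value (K ^~ w) (E ^~ w)))) ->
  (forall w, Gd w -> forall z (r : R), epi (stage_value (K ^~ w) (E ^~ w)) (z, r : R^o) <->
    exists p a, epi (K ^~ w) ((z, p.1), a : R^o) /\ epi (E ^~ w) (p, (r - a)%R : R^o)) ->
  normal_integrand measurable
    (fun z w => if `[< Gd w >] then stage_value (K ^~ w) (E ^~ w) z else 0).
Proof.
move=> cS eS; apply: normal_on => // O oO.
have mKE := measurable_cmap_prod smO fK fE nK nE.
pose D : set ((X * C * X * R^o) * (X * C * R^o)) := [set q | q.1.1.2 = q.2.1.1].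
pose phi (q : (X * C * X * R^o) * (X * C * R^o)) : X * C * R^o := (q.1.1.1, q.1.2 + q.2.2)%R.
have cD : closed D.
  apply: closed_eqset => q; first by apply: cvg_pr2; apply: cvg_pr1; exact: cvg_fst.
  by do 2 apply: cvg_pr1; exact: cvg_snd.
have oO' : open (phi @^-1` O).
  apply: open_comp => // q _; apply: cvg_pair_nbhs; first by do 2 apply: cvg_pr1; exact: cvg_fst.
  by apply: cvgD; apply: cvg_pr2; [exact: cvg_fst|exact: cvg_snd].
have H := measurable_cmap_hit smO (findim_prod fK fE) mKE cD oO'.
apply: (sG_eq _ (sGI smO mGd H)) => w; split.
  move=> [Gw [[[[z y] a] [p b]] [[/= Ka Eb] /= yp Oq]]]; split => //.
  exists (z, a + b)%R; split => //; apply/(eS w Gw); exists p, a; split; first by rewrite -yp.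
  by rewrite addrAC subrr add0r.
move=> [Gw [[z r] [/(eS w Gw)[p [a [Ka Ea]]] Ozr]]]; split => //.
exists (((z, p.1), a : R^o), (p, (r - a)%R : R^o)); split => //.
by rewrite /phi /preimage /= addrC subrK.
Qed.

Lemma inf_control_normal :
  (forall w, Gd w -> closed (epi (inf_control (E ^~ w)))) ->
  (forall w, Gd w -> forall x (r : R), epi (inf_control (E ^~ w)) (x, r : R^o) <->
    exists u, epi (E ^~ w) ((x, u), r : R^o)) ->
  normal_integrand measurable
    (fun x w => if `[< Gd w >] then inf_control (E ^~ w) x else 0).
Proof.
move=> cS eS; apply: normal_on => // O oO.
pose phi (q : X * C * R^o) : X * R^o := (q.1.1, q.2)%R.
have oO' : open (phi @^-1` O).
  apply: open_comp => // q _; apply: cvg_pair_nbhs; first by do 2 apply: cvg_pr1.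
  exact: cvg_snd.
have H := measurable_cmap_hit smO fE nE closedT oO'.
apply: (sG_eq _ (sGI smO mGd H)) => w; split.
  move=> [Gw [[[x u] r] [/= Er _ Oq]]]; split => //.
  by exists (x, r); split => //; apply/(eS w Gw); exists u.
move=> [Gw [[x r] [/(eS w Gw)[u Eu] Oxr]]]; split => //.
by exists ((x, u), r : R^o).
Qed.

End normal_on_good_sets.

(** * Measurable minimizers and measurable lifts of directions *)

Section measurable_stage.
Context {d} {Omega : measurableType d} {R : realType}.
Context (G : set (set Omega)) (HG : Defs.sub_sigma_algebra G).
Context {X C : normedModType R} (fX : findim X) (fC : findim C).
Context (K : X * C * X -> Omega -> \bar R) (E : X * C -> Omega -> \bar R).
Hypotheses (nK : normal_integrand G K) (nE : normal_integrand G E).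

Let sG := proj1 HG.
Let fXC : findim ((X * C)%type : normedModType R). Proof. exact: findim_prod. Qed.
Let fXCX : findim ((X * C * X)%type : normedModType R). Proof. exact: findim_prod. Qed.
Let fE : findim ((X * C * R^o)%type : normedModType R). Proof. exact: findim_prod. Qed.
Let fK : findim ((X * C * X * R^o)%type : normedModType R). Proof. exact: findim_prod. Qed.

Lemma Gmeasurable_rv (t : Omega -> R) : Gmeasurable G (EFin \o t) -> rv G (t : Omega -> R^o).
Proof.
move=> mt O oO.
have mO : measurable (O : set R) by exact: open_measurable.
have mEO : measurable (EFin @` (O : set R)) by exact: measurable_image_EFin.
have := mt measurableT _ mEO; rewrite setTI (GmeasE sG).
by apply: sG_eq => w; rewrite /preimage /=; split => [[r Or [<-]]//|Ot]; exists (t w).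
Qed.

(** The infimum [v] is measurable. Its real part [t] serves as a threshold: minimizers are selected
    among pairs of epigraph points whose heights sum to at most [t]. Where the minimum is +oo any
    point will do. *)
Lemma measurable_argmin (z : Omega -> (X * C)%type) : rv G z ->
  exists2 p : Omega -> (X * C)%type, rv G p & forall w,
    (forall x, -oo < K x w) -> (forall x, -oo < E x w) ->
    (exists p0, forall q, K (z w, p0.1) w + E p0 w <= K (z w, q.1) w + E q w) ->
    forall q, K (z w, (p w).1) w + E (p w) w <= K (z w, q.1) w + E q w.
Proof.
move=> mz; have mKE := measurable_cmap_prod sG fK fE nK nE.
pose A w : set ((X * C * X * R^o) * (X * C * R^o)) :=
  [set q | [/\ epi (K ^~ w) q.1, epi (E ^~ w) q.2, q.1.1.1 = z w & q.1.1.2 = q.2.1.1]].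
pose v w : \bar R := ereal_inf [set (q.1.2 + q.2.2 : R)%:E | q in A w].
have fKE := findim_prod fK fE.
pose W := ((X * C * X * R^o) * (X * C * R^o))%type.
have mv : Gmeasurable G v.
  apply: (Gmeasurable_ltP sG) => r.
  have mS := measurable_cmap_prod sG fKE fXC mKE (measurable_cmap_rv mz).
  pose D : set (W * (X * C)) := [set q | q.1.1.1.1 = q.2] `&` [set q | q.1.1.1.2 = q.1.2.1.1].
  have cD : closed D.
    apply: closedI; apply: closed_eqset => q.
    - by do 3 apply: cvg_pr1; exact: cvg_fst.
    - exact: cvg_snd.
    - by apply: cvg_pr2; do 2 apply: cvg_pr1; exact: cvg_fst.
    - by do 2 apply: cvg_pr1; apply: cvg_pr2; exact: cvg_fst.
  have oO : open [set q : W * (X * C) | (q.1.1.2 + q.1.2.2 < r)%R].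
    apply: (@open_comp _ _ (fun q : W * (X * C) => q.1.1.2 + q.1.2.2 : R^o)%R [set s : R^o | (s < r)%R]).
      move=> q _; apply: cvgD; apply: cvg_pr2; [apply: cvg_pr1|apply: cvg_pr2]; exact: cvg_fst.
    exact: open_lt.
  apply: (sG_eq _ (measurable_cmap_hit sG (findim_prod fKE fXC) mS cD oO)) => w; split.
    move=> [[[[[z0 y] a] [p b]] z1] [[[/= Ka Eb] /= ->] [/= zE yE] ab]].
    apply/ereal_inf_ltP; exists (a + b)%:E; last by rewrite lte_fin.
    by exists (((z0, y), a : R^o), (p, b : R^o)).
  move=> /ereal_inf_lt[_ [q [Kq Eq zE yE] <-]]; rewrite lte_fin => qr.
  by exists (q, z w).
pose t w := fine (v w).
have mt : rv G (t : Omega -> R^o).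
  apply: Gmeasurable_rv; apply/measurable_EFinP.
  by apply: (@measurableT_comp _ _ _ (g_sigma_algebraType G) _ _ fine _ v).
have mzt := measurable_cmap_rv (rv_pair sG fXC (findim_R R) mz mt).
have fZ : findim ((X * C * R^o)%type : normedModType R) := fE.
have mS := measurable_cmap_prod sG fKE fZ mKE mzt.
pose D : set (W * (X * C * R^o)) := [set q | q.1.1.1.1 = q.2.1] `&` ([set q | q.1.1.1.2 = q.1.2.1.1]
   `&` [set q | (q.1.1.2 + q.1.2.2 <= q.2.2)%R]).
have cD : closed D.
  apply: closedI; last apply: closedI.
  - apply: closed_eqset => q; last by apply: cvg_pr1; exact: cvg_snd.
    by do 3 apply: cvg_pr1; exact: cvg_fst.
  - apply: closed_eqset => q; last by do 2 apply: cvg_pr1; apply: cvg_pr2; exact: cvg_fst.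
    by apply: cvg_pr2; do 2 apply: cvg_pr1; exact: cvg_fst.
  - apply: closed_leset => q; last by apply: cvg_pr2; exact: cvg_snd.
    apply: cvgD; apply: cvg_pr2; [apply: cvg_pr1|apply: cvg_pr2]; exact: cvg_fst.
have mSD := measurable_cmap_setI sG (findim_prod fKE fZ) mS (measurable_cmap_cst sG cD).
have [s ms sS] := measurable_selection sG (findim_prod fKE fZ) mSD.
exists (fun w => (s w).1.2.1).
  apply: (@rv_fst _ _ _ _ _ (fun w => (s w).1.2)).
  by apply: (@rv_snd _ _ _ _ _ (fun w => (s w).1)); exact: rv_fst.
move=> w KN EN [p0 p0min] q; apply: le_trans (p0min q).
have [->|/eqP noty] := pselect (K (z w, p0.1) w + E p0 w = +oo); first exact: leey.
have lty : K (z w, p0.1) w + E p0 w < +oo by rewrite ltey.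
have Kf : K (z w, p0.1) w \is a fin_num.
  apply: fin_real; rewrite KN /=; move: lty; have := EN p0.
  by case: (K _ w) => // [r _ _|]; [exact: ltry|case: (E p0 w)].
have Ef : E p0 w \is a fin_num.
  apply: fin_real; rewrite EN /=; move: lty; have := KN (z w, p0.1).
  by case: (E p0 w) => // [r _ _|]; [exact: ltry|case: (K _ w)].
pose k := fine (K (z w, p0.1) w); pose b := fine (E p0 w).
have Kk : K (z w, p0.1) w = k%:E by rewrite fineK.
have Eb : E p0 w = b%:E by rewrite fineK.
have vE : v w = (k + b)%:E.
  apply/eqP; rewrite eq_le; apply/andP; split.
    apply: ereal_inf_lbound; exists (((z w, p0.1), k : R^o), (p0, b : R^o)) => //.
    by split => //; rewrite /epi /= ?Kk ?Eb.
  apply: le_ereal_inf_tmp => _ [[[[z1 y] a] [p c]] [/= Ka Ec z1E yE] <-].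
  rewrite EFinD -Kk -Eb; apply: le_trans (p0min p) _.
  by rewrite EFinD; apply: leeD => //; rewrite -z1E -yE.
have tE : t w = (k + b)%R by rewrite /t vE.
have [|] := sS w.
  exists ((((z w, p0.1), k : R^o), (p0, b : R^o)), (z w, t w : R^o)); split; last first.
    by split => //; split => //; rewrite /= tE.
  by split => //; split => //; rewrite /epi /= ?Kk ?Eb.
case: (s w) => -[[[z1 y] a] [p c]] [z2 r] [/= [Ka Ec] zE] [/= z1E [/= yE ac]].
have [z2E rE] : z2 = z w /\ r = t w by case: zE.
rewrite z1E z2E yE in Ka; rewrite Kk Eb -EFinD -tE -rE.
by apply: (@le_trans _ _ (a + c)%:E); [rewrite EFinD; apply: leeD|rewrite lee_fin].
Qed.

(** Makes the pointwise lift of [fun_reccone_stage_value] measurable, so that a direction at one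
    time can be continued as an adapted process. *)
Lemma measurable_recession_lift (z : Omega -> (X * C)%type) : rv G z ->
  exists2 p : Omega -> (X * C)%type, rv G p & forall w,
    cvx (epi (K ^~ w)) -> cvx (epi (E ^~ w)) ->
    (exists p0, fun_reccone (K ^~ w) (z w, p0.1) /\ fun_reccone (E ^~ w) p0) ->
    fun_reccone (K ^~ w) (z w, (p w).1) /\ fun_reccone (E ^~ w) (p w).
Proof.
move=> mz.
have [RK mRK RKE] := measurable_cmap_fun_reccone sG fXCX nK; have [RE mRE REE] := measurable_cmap_fun_reccone sG fXC nE.
have mS := measurable_cmap_prod sG (findim_prod fXCX fXC) fXC (measurable_cmap_prod sG fXCX fXC mRK mRE) (measurable_cmap_rv mz).
pose D : set ((X * C * X) * (X * C) * (X * C)) := [set q | q.1.1.1 = q.2] `&` [set q | q.1.1.2 = q.1.2.1].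
have cD : closed D.
  apply: closedI; apply: closed_eqset => q.
  - by do 2 apply: cvg_pr1; exact: cvg_fst.
  - exact: cvg_snd.
  - by apply: cvg_pr2; apply: cvg_pr1; exact: cvg_fst.
  - by apply: cvg_pr1; apply: cvg_pr2; exact: cvg_fst.
have fS := findim_prod (findim_prod fXCX fXC) fXC.
have mSD := measurable_cmap_setI sG fS mS (measurable_cmap_cst sG cD).
have [s ms sS] := measurable_selection sG fS mSD.
exists (fun w => (s w).1.2); first by apply: rv_snd; apply: rv_fst.
move=> w xK xE [p0 [Kp0 Ep0]].
have [|[[/= sK sE] /= sz] [/= e1 e2]] := sS w.
  exists (((z w, p0.1), p0), z w); split => //; split => //; split => /=.
    by rewrite RKE.
  by rewrite REE.
rewrite -RKE // -REE //; split => //.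
by rewrite -sz -e1 -e2 -surjective_pairing.
Qed.

Lemma recession_castaing : exists p : nat -> Omega -> (X * C)%type, (forall i, rv G (p i)) /\
  forall w, cvx (epi (K ^~ w)) -> cvx (epi (E ^~ w)) ->
    (forall i, fun_reccone (K ^~ w) (0%R, (p i w).1) /\ fun_reccone (E ^~ w) (p i w)) /\
    forall p0, fun_reccone (K ^~ w) (0%R, p0.1) -> fun_reccone (E ^~ w) p0 ->
      forall e : R, (0 < e)%R -> exists i, (`|p0 - p i w| < e)%R.
Proof.
have [RK mRK RKE] := measurable_cmap_fun_reccone sG fXCX nK; have [RE mRE REE] := measurable_cmap_fun_reccone sG fXC nE.
pose L w := [set p : X * C | RK w (0%R, p.1) /\ RE w p].
have mL : measurable_cmap G L.
  pose W := ((X * C * X) * (X * C))%type.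
  apply: (@measurable_cmap_map _ _ _ sG _ _ _ ([set q : W | q.1.1 = 0%R] `&` [set q : W | q.1.2 = q.2.1])
     snd L (findim_prod fXCX fXC) (measurable_cmap_prod sG fXCX fXC mRK mRE)).
  - apply: closedI; apply: closed_eqset => q.
    + by apply: cvg_pr1; exact: cvg_fst.
    + exact: cvg_cst.
    + by apply: cvg_pr2; exact: cvg_fst.
    + by apply: cvg_pr1; exact: cvg_snd.
  - by move=> q; exact: cvg_snd.
  - move=> w; apply: closedI; last exact: (proj1 mRE w).
    apply: (@closed_comp _ _ (fun p : X * C => (0%R, p.1)) _ _ (proj1 mRK w)).
    by move=> p _; apply: cvg_pair_nbhs; [exact: cvg_cst|exact: cvg_fst].
  - move=> w p; split=> [[Kp Ep]|[[[z y] q] [[/= Kz Eq] [/= z0 yq] <-]]].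
      by exists ((0%R, p.1), p).
    by split => //; rewrite -yq -z0.
have [p [mp pL pd]] := castaing sG fXC mL.
exists p; split => // w xK xE.
have L0 : L w !=set0 by exists 0%R; rewrite /L /= RKE // REE //; split; exact: fun_reccone0.
split=> [i|p0 Kp0 Ep0 e e0].
  by have := pL i w L0; rewrite /L /= RKE // REE.
by apply: pd => //; rewrite /L /= RKE // REE.
Qed.

End measurable_stage.

(** * Existence of conditional expectations of integrands *)

Section existence_of_conditional_expectations.
Context {d} {Omega : measurableType d} {R : realType} (P : probability Omega R).

Lemma cond_expectation_integrand_exists {V : normedModType R} (G : set (set Omega))
    (h : V -> Omega -> \bar R) : findim V -> Defs.sub_sigma_algebra G ->
  normal_integrand measurable h -> lower_bounded P h ->
  exists2 g, is_cond_expectation_integrand P G h g & lower_bounded P g.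
Proof.
move=> fV HG nh [m im hm].
have [_ [q qP]] := fV.
have imu : P.-integrable setT (EFin \o (fun w => `|m w|%R)) by exact: integrable_norm.
have mu0 w : (0 <= `|m w|)%R by exact: normr_ge0.
have hmu : {ae P, forall w, forall x, (- `|m w|)%:E <= h x w}.
  apply: filterS hm => w H x; apply: le_trans (H x).
  by rewrite lee_fin lerNl -normrN ler_norm.
exists (cexp HG nh imu mu0 q).
  split; first exact: cexp_normal.
  move=> x mx; apply: cexp_cond_expectation => //.
  by apply/(rv_random_vector (proj1 HG)).
eexists; first exact: (cexp_lower_integrable HG imu mu0).
by apply: aeW => w x; exact: cexp_ge.
Qed.

Lemma lower_bounded_real {V : normedModType R} (h : V -> Omega -> \bar R) : lower_bounded P h ->
  {ae P, forall w, exists m : R, forall x, m%:E <= h x w}.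
Proof. by move=> [m im hm]; apply: filterS hm => w H; exists (m w). Qed.

Lemma normal_ambient {V : normedModType R} (G : set (set Omega)) (h : V -> Omega -> \bar R) :
  Defs.sub_sigma_algebra G -> normal_integrand G h -> normal_integrand measurable h.
Proof. by move=> [_ GO] [ch mh]; split => // O /mh /GO. Qed.

Lemma rv_sub {V : normedModType R} (G G' : set (set Omega)) (x : Omega -> V) :
  G `<=` G' -> rv G x -> rv G' x.
Proof. by move=> GG' mx O /mx /GG'. Qed.

End existence_of_conditional_expectations.

(** * The backward induction step *)

Section stage.
Context {d} {Omega : measurableType d} {R : realType} (P : probability Omega R).
Context (N M T : nat) (F : nat -> set (set Omega)) (HF : filtration T F).
Local Notation X := ('rV[R]_N).
Local Notation C := ('rV[R]_M).
Context (K : nat -> X * C * X -> Omega -> \bar R) (J : X -> Omega -> \bar R).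
Hypotheses (HK : forall t, (t <= T)%N -> lb_convex_normal_integrand P (F t) (K t))
  (HJ : lb_convex_normal_integrand P (F T) J)
  (HJdom : {ae P, forall w, dom (J ^~ w) !=set0}).

Let HG t : (t <= T)%N -> Defs.sub_sigma_algebra (F t). Proof. by case: HF => H _; exact: H. Qed.
Let HFF s t : (s <= t <= T)%N -> F s `<=` F t. Proof. by case: HF => _ H; exact: H. Qed.
Let fX : findim (X : normedModType R). Proof. exact: findim_rV. Qed.
Let fC : findim (C : normedModType R). Proof. exact: findim_rV. Qed.
Let fXC : findim ((X * C)%type : normedModType R). Proof. exact: findim_prod. Qed.

(** The recession condition written term by term and restricted to the costs after time [s]; the
    pair [z r] consists of state and control. *)
Definition recession_tail (s : nat) (z : nat -> Omega -> X * C) w :=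
  (forall r, (s < r <= T)%N -> fun_reccone (K r ^~ w) (z r.-1 w, (z r w).1)) /\
  fun_reccone (J ^~ w) (z T w).1.

Definition adapted_from (s : nat) (z : nat -> Omega -> X * C) :=
  forall r, (s <= r <= T)%N -> rv (F r) (z r).

(* A zero cost at stage 0 lets the choice of the initial state and control be
   treated like the other stages. *)
Hypothesis K0 : K 0%N = fun _ _ => 0.

Hypothesis Hsym : forall z, adapted_from 0 z -> {ae P, forall w, recession_tail 0 z w} ->
  {ae P, forall w, recession_tail 0 (fun r w => - z r w)%R w}.

(* [E] stands for E_s Qtilde_s. The last two clauses identify the recession
   directions of [E] with the initial values of adapted recession directions of
   the tail problem; it is through them that the linearity assumption on whole
   processes reaches a single stage. *)
Definition stage_invariant (s : nat) (E : X * C -> Omega -> \bar R) :=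
  [/\ normal_integrand (F s) E, lower_bounded P E, {ae P, forall w, cvx (epi (E ^~ w))},
    (forall z, rv (F s) z -> {ae P, forall w, fun_reccone (E ^~ w) (z w)} ->
      exists zs, [/\ zs s = z, adapted_from s zs & {ae P, forall w, recession_tail s zs w}]) &
    (forall zs, adapted_from s zs -> {ae P, forall w, recession_tail s zs w} ->
      {ae P, forall w, dom (E ^~ w) !=set0 -> fun_reccone (E ^~ w) (zs s w)})].

Definition stage_symmetric s (E : X * C -> Omega -> \bar R) w :=
  forall p, fun_reccone (K s ^~ w) (0%R, p.1) -> fun_reccone (E ^~ w) p ->
    fun_reccone (K s ^~ w) (0%R, - p.1)%R /\ fun_reccone (E ^~ w) (- p)%R.

Let cvxK s w : (s <= T)%N -> cvx (epi (K s ^~ w)).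
Proof. by move=> /HK[_ xK _]; exact/convex_setP/xK. Qed.

Lemma stage_linear s E : (s <= T)%N -> stage_invariant s E ->
  {ae P, forall w, stage_symmetric s E w}.
Proof.
move=> sT [nE lE xE ext back].
have [nK _ lK] := HK sT.
have [p [mp pP]] := recession_castaing (HG sT) fX fC nK nE.
have key : {ae P, forall w, forall i, fun_reccone (K s ^~ w) (0%R, - (p i w).1)%R /\
    fun_reccone (E ^~ w) (- p i w)%R}.
  apply: ae_all => i.
  have Ep : {ae P, forall w, fun_reccone (E ^~ w) (p i w)}.
    by apply: filterS xE => w xEw; have [/(_ i)[]] := pP w (@cvxK _ w sT) xEw.
  have Kp : {ae P, forall w, fun_reccone (K s ^~ w) (0%R, (p i w).1)}.
    by apply: filterS xE => w xEw; have [/(_ i)[]] := pP w (@cvxK _ w sT) xEw.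
  have [zs [zsE mzs tzs]] := ext _ (mp i) Ep.
  (* Before [s] the process is zero, so the cost at time [s], in direction (0, (p i w).1), is the
     only link between the two pieces. *)
  pose z r : Omega -> X * C := if (r < s)%N then fun=> 0%R else zs r.
  have mz : adapted_from 0 z.
    move=> r /andP[_ rT]; rewrite /z; case: ltnP => sr; last by apply: mzs; rewrite sr.
    exact: (rv_cst (proj1 (HG rT)) (0%R : X * C)).
  have tz : {ae P, forall w, recession_tail 0 z w}.
    apply: filterS2 Kp tzs => w Kpw [tK tJ]; split; last first.
      by rewrite /z ltnNge sT.
    move=> r /andP[r0 rT]; have [sr|rs|rs] := ltngtP s r.
    - have s1 : (r.-1 < s)%N = false by apply/negbTE; rewrite -leqNgt -ltnS prednK.
      by rewrite /z s1 ltnNge (ltnW sr) /=; apply: tK; rewrite sr.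
    - have s1 : (r.-1 < s)%N by apply: leq_ltn_trans rs; exact: leq_pred.
      by rewrite /z s1 rs; exact: fun_reccone0.
    - have s0 : (0 < s)%N by rewrite rs.
      by rewrite -rs /z (prednK s0) leqnn ltnn zsE.
  have tN := Hsym mz tz.
  have mN : adapted_from s (fun r w => - z r w)%R.
    move=> r /andP[sr rT]; have mzr := mz r rT.
    exact: (rv_opp (proj1 (HG rT)) fXC mzr).
  have tN' : {ae P, forall w, recession_tail s (fun r w => - z r w)%R w}.
    apply: filterS tN => w [tK tJ]; split => // r /andP[sr rT]; apply: tK.
    by rewrite rT (leq_ltn_trans _ sr).
  have bN := back _ mN tN'.
  have zsp : z s = p i by rewrite /z ltnn zsE.
  apply: filterS3 bN tN Ep => w bw [tK _] Ew; split; last first.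
    (* Where the domain is empty the cone is trivial and [p i w] is 0. *)
    have [dE|dE] := pselect (dom (E ^~ w) !=set0); first by rewrite -zsp; exact: bw.
    case: Ew => [pE|[/epi_nonempty//]].
    have -> : p i w = 0%R by case: pE.
    by rewrite oppr0; exact: fun_reccone0.
  (* The tail condition says nothing about time 0, but the zero cost there has every direction as a
     recession direction. *)
  case: (posnP s) => [s0|s0].
    rewrite s0 K0; right; split; first by exists (0%R, 0%R : R^o); rewrite /epi /=.
    by apply/recdir_epi0.
  have z1 : z s.-1 = fun=> 0%R by rewrite /z prednK // leqnn.
  have := tK s; rewrite s0 sT => /(_ isT).
  by rewrite z1 zsp [(- (0 : X * C))%R]oppr0.
apply: filterS2 xE key => w xEw kw p0 Kp0 Ep0.
have [_ pd] := pP w (@cvxK _ w sT) xEw.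
split.
  move/closed_normP: (closed_fun_reccone (proj1 nK w)); apply => e e0.
  have [i pi] := pd _ Kp0 Ep0 e e0; have [Ki _] := kw i.
  exists (0%R, - (p i w).1)%R => //; rewrite prod_normE /= subrr normr0 gt_max e0 /=.
  rewrite -opprD normrN; apply: le_lt_trans pi.
  by rewrite [leRHS]prod_normE le_max lexx.
move/closed_normP: (closed_fun_reccone (proj1 nE w)); apply => e e0.
have [i pi] := pd _ Kp0 Ep0 e e0; have [_ Ei] := kw i.
by exists (- p i w)%R => //; rewrite -opprD normrN.
Qed.

(** The hypotheses of the pointwise stage that hold only almost surely. *)
Definition stage_good s (E : X * C -> Omega -> \bar R) w :=
  [/\ exists m : R, forall x, m%:E <= K s x w, exists m : R, forall x, m%:E <= E x w,
    cvx (epi (E ^~ w)) & stage_symmetric s E w].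

Lemma stage_good_ae s E : (s <= T)%N -> stage_invariant s E -> {ae P, forall w, stage_good s E w}.
Proof.
move=> sT iE; have sy := stage_linear sT iE; have [nE lE xE _ _] := iE; have [_ _ lK] := HK sT.
have lK' := lower_bounded_real lK; have lE' := lower_bounded_real lE.
by apply: filterS2 (filterI lK' lE') (filterI xE sy) => w [? ?] [? ?].
Qed.

Let good_set s E : (s <= T)%N -> stage_invariant s E -> exists Gd : set Omega,
  [/\ measurable Gd, {ae P, forall w, Gd w} & forall w, Gd w -> stage_good s E w].
Proof.
move=> sT /(stage_good_ae sT)/ae_null[Nn [mN N0 H]]; exists (~` Nn); split => //.
  exact: measurableC.
exact: (ae_of_null mN N0).
Qed.

Lemma control_minimum s E : (s <= T)%N -> stage_invariant s E -> exists2 Jn : X -> Omega -> \bar R,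
  lb_convex_normal_integrand P measurable Jn &
  {ae P, forall w, forall x, Jn x w = inf_control (E ^~ w) x}.
Proof.
move=> sT iE; have [Gd [mGd aGd gG]] := good_set sT iE.
have [nE [m im mE] _ _ _] := iE; have [nK _ _] := HK sT.
exists (fun x w => if `[< Gd w >] then inf_control (E ^~ w) x else 0); last first.
  by apply: filterS aGd => w Gw x; rewrite asboolT.
split.
- apply: (inf_control_normal fX fC (normal_ambient (HG sT) nE) mGd).
    move=> w /gG[[m1 K1] [m2 E2] xE sy].
    exact: (closed_epi_inf_control fC (proj1 nE w) xE sy).
  move=> w /gG[[m1 K1] [m2 E2] xE sy].
  exact: (epi_inf_control fC (proj1 nE w) xE sy).
- move=> w; apply/convex_setP; case: asboolP => [/gG[[m1 K1] [m2 E2] xE sy]|_].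
    exact: (cvx_epi_inf_control fC (proj1 nE w) xE sy).
  move=> t x y /andP[t0 t1]; rewrite /epi /= !lee_fin => x0 y0.
  by rewrite addr_ge0 // mulr_ge0 // subr_ge0.
- exists m => //; apply: filterS2 mE aGd => w H Gw x; rewrite asboolT //.
  by apply: le_ereal_inf_tmp => _ [v _ <-].
Qed.

Lemma stage_integrand s E : (s <= T)%N -> stage_invariant s E ->
  exists2 Q : X * C -> Omega -> \bar R, lb_convex_normal_integrand P measurable Q &
  {ae P, forall w, forall z, Q z w = stage_value (K s ^~ w) (E ^~ w) z}.
Proof.
move=> sT iE; have [Gd [mGd aGd gG]] := good_set sT iE.
have [nE [m im mE] _ _ _] := iE; have [nK _ [m' im' mK]] := HK sT.
exists (fun z w => if `[< Gd w >] then stage_value (K s ^~ w) (E ^~ w) z else 0); last first.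
  by apply: filterS aGd => w Gw x; rewrite asboolT.
split.
- apply: (stage_value_normal fX fC (normal_ambient (HG sT) nK) (normal_ambient (HG sT) nE) mGd).
    move=> w /gG[[m1 K1] [m2 E2] xE sy].
    exact: (closed_epi_stage_value fX fC K1 E2 (proj1 nK w) (proj1 nE w) (@cvxK _ w sT) xE sy).
  move=> w /gG[[m1 K1] [m2 E2] xE sy].
  exact: (epi_stage_value fX fC K1 E2 (proj1 nK w) (proj1 nE w) (@cvxK _ w sT) xE sy).
- move=> w; apply/convex_setP; case: asboolP => [/gG[[m1 K1] [m2 E2] xE sy]|_].
    exact: (cvx_epi_stage_value fX fC K1 E2 (proj1 nK w) (proj1 nE w) (@cvxK _ w sT) xE sy).
  move=> t x y /andP[t0 t1]; rewrite /epi /= !lee_fin => x0 y0.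
  by rewrite addr_ge0 // mulr_ge0 // subr_ge0.
- exists (fun w => m' w + m w)%R.
    by have := integrableD measurableT im' im; apply: eq_integrable.
  apply: filterS3 mK mE aGd => w H1 H2 Gw x; rewrite asboolT //.
  exact: stage_value_ge.
Qed.

(** A direction of [E'] is one of [Q], lifts measurably to time [s.+1], and is continued there by
    the invariant of [E]. Conversely, translation along a tail direction does not increase [Q], by
    [stage_value_mono], nor [E'], by [cond_expectation_le]. *)
Lemma stage_step s E : (s < T)%N -> stage_invariant s.+1 E -> exists Q E',
  [/\ stage_invariant s E', lb_convex_normal_integrand P measurable Q,
    {ae P, forall w, forall z, Q z w = stage_value (K s.+1 ^~ w) (E ^~ w) z} &
    is_cond_expectation_integrand P (F s) Q E'].
Proof.
move=> sT iE; have [Q lQ QE] := stage_integrand sT iE; have [nQ xQ bQ] := lQ.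
have sT' := ltnW sT.
have [E' cE lE'] := cond_expectation_integrand_exists fXC (HG sT') nQ bQ.
exists Q, E'; split => //.
have good := stage_good_ae sT iE; have [nE lE xE ext back] := iE.
have [nK _ _] := HK sT.
split => //.
- by case: cE.
- exact: (cond_expectation_convex (HG sT') fXC nQ xQ bQ lE' cE).
- move=> z mz zE'.
  have zQ := fun_reccone_cond_expectation (HG sT') fXC nQ xQ bQ cE mz zE'.
  have mz' : rv (F s.+1) z by apply: rv_sub mz; apply: HFF; rewrite leqnSn sT.
  have [p mp pP] := measurable_recession_lift (HG sT) fX fC nK nE mz'.
  have lift : {ae P, forall w, fun_reccone (K s.+1 ^~ w) (z w, (p w).1) /\ fun_reccone (E ^~ w) (p w)}.
    apply: filterS3 good zQ QE => w [[m1 K1] [m2 E2] xEw sy] zw Qw.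
    apply: pP => //; first exact: cvxK.
    apply: (fun_reccone_stage_value fX fC K1 E2 (proj1 nK w) (proj1 nE w) (@cvxK _ w sT) xEw sy).
    by have -> : stage_value (K s.+1 ^~ w) (E ^~ w) = Q ^~ w by apply/funext => q; rewrite Qw.
  have lE2 : {ae P, forall w, fun_reccone (E ^~ w) (p w)} by apply: filterS lift => w [].
  have [zs [zsE mzs tzs]] := ext p mp lE2.
  exists (fun r => if r == s then z else zs r); split; first by rewrite eqxx.
    move=> r /andP[sr rT]; case: eqVneq => [->//|rs]; apply: mzs.
    by rewrite rT ltn_neqAle eq_sym rs sr.
  apply: filterS2 lift tzs => w [Kw Ew] [tK tJ]; split; last by rewrite gtn_eqF.
  move=> r /andP[sr rT]; rewrite [r == s]gtn_eqF //.
  have [rs|rs] := eqVneq r.-1 s.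
    have -> : r = s.+1 by rewrite -rs prednK // (leq_ltn_trans _ sr).
    by rewrite zsE.
  apply: tK; rewrite rT andbT ltn_neqAle sr andbT; apply: contraNneq rs => <-.
  by [].
- move=> zs mzs tzs.
  have mzs' : adapted_from s.+1 zs by move=> r /andP[sr rT]; apply: mzs; rewrite ltnW.
  have tzs' : {ae P, forall w, recession_tail s.+1 zs w}.
    apply: filterS tzs => w [tK tJ]; split => // r /andP[sr rT]; apply: tK.
    by rewrite rT andbT ltnW.
  have bE := back zs mzs' tzs'.
  have mz : rv (F s) (zs s) by apply: mzs; rewrite leqnn.
  have Qz : {ae P, forall w, forall x, Q (x + zs s w)%R w <= Q x w}.
    apply: filterS2 (filterI good bE) (filterI tzs QE) => w [[[m1 K1] [m2 E2] _ _] bw] [[tK _] Qw] x.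
    rewrite !Qw; apply: (stage_value_mono K1 E2) bw _.
    by have := tK s.+1; rewrite ltnSn sT; apply.
  have Ez := cond_expectation_le (HG sT') fXC nQ nQ mz cE cE Qz.
  apply: filterS Ez => w H dE; right; split; first exact/epi_nonempty.
  exact/recdir_epi0.
Qed.

(** With an empty domain both cones would be trivial, and [p.1 = 0] would not force [p = 0]; hence
    the hypothesis. *)
Lemma fun_reccone_cylinder (f : X -> \bar R) (p : X * C) : dom f !=set0 ->
  fun_reccone (fun q : X * C => f q.1) p <-> fun_reccone f p.1.
Proof.
move=> [x0 fx0]; split=> [/reccone_recdir/recdir_epi0 H|/reccone_recdir/recdir_epi0 H]; right; split.
- by apply/epi_nonempty; exists x0.
- by apply/recdir_epi0 => x; exact: (H (x, 0%R)).
- by apply/epi_nonempty; exists (x0, 0%R).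
- by apply/recdir_epi0 => x; exact: (H x.1).
Qed.

(** The terminal cost gets a dummy control, so that the equation J_T = J is an infimum over controls
    like the others. *)
Lemma terminal_invariant : stage_invariant T (fun p w => J p.1 w).
Proof.
have [nJ xJ [m im mJ]] := HJ; have sG := proj1 (HG (leqnn T)).
have fXR : findim ((X * R^o)%type : normedModType R) by apply: findim_prod.
have phiE (w : Omega) : closed (epi (fun p : X * C => J p.1 w)).
  apply: (@closed_comp _ _ (fun q : X * C * R^o => (q.1.1, q.2)) _ _ (proj1 nJ w)).
  move=> q _; apply: cvg_pair_nbhs; last exact: cvg_snd.
  by do 2 apply: cvg_pr1.
split.
- apply/normal_integrand_measurable_cmap.
  apply: (@measurable_cmap_map _ _ _ sG _ _ _ setT (fun q : (X * R^o) * C => ((q.1.1, q.2), q.1.2)) _ _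
    (measurable_cmap_prod sG fXR fC nJ (measurable_cmap_cst sG closedT))) => //.
  + exact: findim_prod.
  + move=> q; apply: cvg_pair_nbhs; first apply: cvg_pair_nbhs.
    * by do 2 apply: cvg_pr1.
    * exact: cvg_snd.
    * by apply: cvg_pr2; exact: cvg_fst.
  + move=> w [[x u] r]; split=> [h|[[[x' r'] u'] [[/= h _] _ [<- _ <-]]] //].
    by exists ((x, r : R^o), u).
- by exists m => //; apply: filterS mJ => w H p.
- apply: aeW => w t p q t01 Jp Jq.
  have cJ := proj1 (convex_setP _) (xJ w).
  exact: (cJ t (p.1.1, p.2) (q.1.1, q.2) t01 Jp Jq).
- move=> z mz zJ; exists (fun=> z); split => //.
    by move=> r rT; have -> : r = T by apply/eqP; rewrite eqn_leq andbC.
  apply: filterS2 HJdom zJ => w dJ zw; split.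
    by move=> r /andP[Tr rT]; move: (leq_trans Tr rT); rewrite ltnn.
  exact/(fun_reccone_cylinder _ dJ).
- move=> zs mzs tzs; apply: filterS2 HJdom tzs => w dJ [_ tJ] _.
  exact/(fun_reccone_cylinder _ dJ).
Qed.

End stage.

(** * Optimal processes and solutions of the Bellman equations *)

Section dynamic_programming.
Context {d} {Omega : measurableType d} {R : realType} (P : probability Omega R).
Context (N M T : nat) (F : nat -> set (set Omega)) (HF : filtration T F).
Local Notation X := ('rV[R]_N).
Local Notation C := ('rV[R]_M).
Context (K : nat -> X * C * X -> Omega -> \bar R) (J : X -> Omega -> \bar R).
Hypotheses (HK : forall t, (t <= T)%N -> lb_convex_normal_integrand P (F t) (K t))
  (HJ : lb_convex_normal_integrand P (F T) J)
  (HJdom : {ae P, forall w, dom (J ^~ w) !=set0})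
  (K0 : K 0%N = fun _ _ => 0)
  (Hsym : forall z, adapted_from T F 0 z -> {ae P, forall w, recession_tail T K J 0 z w} ->
  {ae P, forall w, recession_tail T K J 0 (fun r w => - z r w)%R w}).

Let HG t : (t <= T)%N -> Defs.sub_sigma_algebra (F t). Proof. by case: HF => H _; exact: H. Qed.
Let HFF s t : (s <= t <= T)%N -> F s `<=` F t. Proof. by case: HF => _ H; exact: H. Qed.
Let fX : findim (X : normedModType R). Proof. exact: findim_rV. Qed.
Let fC : findim (C : normedModType R). Proof. exact: findim_rV. Qed.
Let fXC : findim ((X * C)%type : normedModType R). Proof. exact: findim_prod. Qed.
Let fXCX : findim ((X * C * X)%type : normedModType R). Proof. exact: findim_prod. Qed.

Definition stage_data (Es Qs : nat -> X * C -> Omega -> \bar R) :=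
  [/\ forall t, (t <= T)%N -> stage_invariant P T F K J t (Es t),
    Es T = (fun p w => J p.1 w) &
    forall t, (t < T)%N -> [/\ lb_convex_normal_integrand P measurable (Qs t),
      {ae P, forall w, forall z, Qs t z w = stage_value (K t.+1 ^~ w) (Es t.+1 ^~ w) z} &
      is_cond_expectation_integrand P (F t) (Qs t) (Es t)]].

(** [phi] is total, with arbitrary values where the induction step does not apply. The recursion
    counts remaining time: [e n] belongs to time [T - n]. *)
Lemma stage_data_exists : exists Es Qs, stage_data Es Qs.
Proof.
have H (sE : nat * (X * C -> Omega -> \bar R)) : exists QE : (X * C -> Omega -> \bar R) * (X * C -> Omega -> \bar R),
    (sE.1 < T)%N -> stage_invariant P T F K J sE.1.+1 sE.2 ->
    [/\ stage_invariant P T F K J sE.1 QE.2, lb_convex_normal_integrand P measurable QE.1,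
      {ae P, forall w, forall z, QE.1 z w = stage_value (K sE.1.+1 ^~ w) (sE.2 ^~ w) z} &
      is_cond_expectation_integrand P (F sE.1) QE.1 QE.2].
  case: sE => s E /=.
  have [[sT iE]|nh] := pselect ((s < T)%N /\ stage_invariant P T F K J s.+1 E).
    by have [Q [E' h]] := stage_step HF HK K0 Hsym sT iE; exists (Q, E').
  by exists (E, E) => sT iE; case: nh.
have [phi phiP] := choice H.
pose e := fix e n := if n is m.+1 then (phi ((T - m.+1)%N, e m)).2 else (fun p w => J p.1 w).
have inv n : (n <= T)%N -> stage_invariant P T F K J (T - n) (e n).
  elim: n => [_|n IH nT]; first by rewrite subn0; exact: (terminal_invariant HF K HJ HJdom).
  have h : (T - n.+1 < T)%N by rewrite ltn_subrL (leq_ltn_trans _ nT).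
  have := phiP ((T - n.+1)%N, e n) h; rewrite /= subnSK // => /(_ (IH (ltnW nT)))[].
  by [].
exists (fun t => e (T - t)%N), (fun t => (phi (t, e (T - t.+1)%N)).1); split.
- by move=> t tT; have h := inv (T - t)%N (leq_subr _ _); rewrite subKn in h.
- by rewrite subnn.
- move=> t tT; have := phiP (t, e (T - t.+1)%N) tT.
  have := inv (T - t.+1)%N (leq_subr _ _); rewrite subKn // => h /(_ h)[_ h1 h2 h3].
  split => //.
  by rewrite -[in e (T - t)%N](subnSK tT) /= subnSK // subKn // ltnW.
Qed.

Section with_data.
Context (Es Qs : nat -> X * C -> Omega -> \bar R) (ES : stage_data Es Qs).

Let inv t : (t <= T)%N -> stage_invariant P T F K J t (Es t). Proof. by have [H _ _] := ES; exact: H. Qed.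
Let ET : Es T = (fun p w => J p.1 w). Proof. by have [_ H _] := ES. Qed.
Let lbQ t : (t < T)%N -> lb_convex_normal_integrand P measurable (Qs t).
Proof. by have [_ _ H] := ES; move=> /H[]. Qed.
Let QE t : (t < T)%N ->
  {ae P, forall w, forall z, Qs t z w = stage_value (K t.+1 ^~ w) (Es t.+1 ^~ w) z}.
Proof. by have [_ _ H] := ES; move=> /H[]. Qed.
Let ceQ t : (t < T)%N -> is_cond_expectation_integrand P (F t) (Qs t) (Es t).
Proof. by have [_ _ H] := ES; move=> /H[]. Qed.

Definition is_stage_optimal (z : nat -> Omega -> X * C) w :=
  forall s, (s < T)%N -> K s.+1 (z s w, (z s.+1 w).1) w + Es s.+1 (z s.+1 w) w <=
    stage_value (K s.+1 ^~ w) (Es s.+1 ^~ w) (z s w).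

(** Each pair is a measurable minimizer given its predecessor. At time 0 the predecessor is a dummy
    zero; since [K 0] vanishes, the choice minimizes [Es 0]. *)
Lemma optimal_process : exists z, [/\ adapted_from T F 0 z,
  {ae P, forall w, is_stage_optimal z w} & {ae P, forall w, forall q, Es 0%N (z 0%N w) w <= Es 0%N q w}].
Proof.
have H (sz : nat * (Omega -> X * C)) : exists p : Omega -> X * C, (sz.1 <= T)%N -> rv (F sz.1) sz.2 ->
   rv (F sz.1) p /\ {ae P, forall w, K sz.1 (sz.2 w, (p w).1) w + Es sz.1 (p w) w <=
     stage_value (K sz.1 ^~ w) (Es sz.1 ^~ w) (sz.2 w)}.
  case: sz => s z /=.
  have [[sT mz]|nh] := pselect ((s <= T)%N /\ rv (F s) z); last first.
    by exists z => sT mz; case: nh.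
  have good := stage_good_ae HF HK K0 Hsym sT (inv sT).
  have [nE _ _ _ _] := inv sT; have [nK xK _] := HK sT.
  have [p mp pP] := measurable_argmin (HG sT) fX fC nK nE mz.
  exists p => _ _; split => //; apply: filterS good => w [[m1 K1] [m2 E2] xE sy].
  have [p0 p0P] := stage_attained fX fC K1 E2 (proj1 nK w) (proj1 nE w)
    (proj1 (convex_setP _) (xK w)) xE sy (z w).
  apply: (le_trans _ p0P); apply: pP.
  - by move=> x; apply: lt_le_trans (K1 x); exact: ltNyr.
  - by move=> x; apply: lt_le_trans (E2 x); exact: ltNyr.
  - exists p0 => q; apply: (le_trans p0P); exact: stage_value_le.
have [phi phiP] := choice H.
pose z := fix z n := if n is m.+1 then phi (m.+1, z m) else phi (0%N, fun=> 0%R).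
have m0 : rv (F 0%N) (fun=> 0%R : X * C) by exact: (rv_cst (proj1 (HG (leq0n T)))).
have mz n : (n <= T)%N -> rv (F n) (z n).
  elim: n => [_|n IH nT]; first by have [] := phiP (0%N, fun=> 0%R) (leq0n T) m0.
  have mzn : rv (F n.+1) (z n).
    by apply: rv_sub (IH (ltnW nT)); apply: HFF; rewrite leqnSn.
  by have [] := phiP (n.+1, z n) nT mzn.
exists z; split.
- by move=> r /andP[_]; exact: mz.
- rewrite /is_stage_optimal; apply: ae_all => s; have [sT|sT] := boolP (s < T)%N; last by apply: aeW.
  have mzn : rv (F s.+1) (z s).
    by apply: rv_sub (mz _ (ltnW sT)); apply: HFF; rewrite leqnSn.
  have [_ /=] := phiP (s.+1, z s) sT mzn.
  by apply: filterS => w.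
- have [_ /=] := phiP (0%N, fun=> 0%R) (leq0n T) m0.
  apply: filterS => w + q; rewrite K0 add0e => /le_trans; apply.
  by apply: le_trans (stage_value_le _ _ _ q) _; rewrite add0e.
Qed.

Let partial_cost (z : nat -> Omega -> X * C) s w : \bar R :=
  \sum_(1 <= t < s.+1) K t (z t.-1 w, (z t w).1) w.

Let mK z s : adapted_from T F 0 z -> (0 < s <= T)%N ->
  measurable_fun setT (fun w => K s (z s.-1 w, (z s w).1) w).
Proof.
move=> mz /andP[s0 sT]; have [nK _ _] := HK sT.
have mzs : rv (F s) (fun w => (z s.-1 w, (z s w).1)).
  apply: (rv_pair (proj1 (HG sT)) fXC fX).
    apply: rv_sub (mz s.-1 _); first by apply: HFF; rewrite leq_pred.
    by rewrite (leq_trans (leq_pred _) sT).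
  by apply: rv_fst; apply: mz; rewrite sT.
exact: (measurable_normal (HG sT) fXCX (normal_ambient (HG sT) nK) mzs).
Qed.

Let lK z s : (0 < s <= T)%N -> integrable_below P (fun w => K s (z s.-1 w, (z s w).1) w).
Proof. by move=> /andP[s0 sT]; have [_ _ lk] := HK sT; exact: integrable_below_normal. Qed.

Let partial_cost_ok z s : adapted_from T F 0 z -> (s <= T)%N ->
  measurable_fun setT (partial_cost z s) /\ integrable_below P (partial_cost z s).
Proof.
move=> mz; elim: s => [_|s IH sT].
  have -> : partial_cost z 0 = cst 0 by apply/funext => w; rewrite /partial_cost big_geq.
  split => //; exists (cst 0%R); last by apply: aeW.
  exact: finite_measure_integrable_cst.
have -> : partial_cost z s.+1 =
    (fun w => partial_cost z s w + K s.+1 (z s w, (z s.+1 w).1) w).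
  by apply/funext => w; rewrite /partial_cost big_nat_recr.
have [m1 l1] := IH (ltnW sT).
split; first by apply: emeasurable_funD => //; exact: (mK (s := s.+1)).
by apply: integrable_belowD => //; exact: (lK z (s := s.+1)).
Qed.

(** Expected cost with everything after time [s] replaced by the conditioned cost-to-go. At [s = T]
    it is the cost of [z]; at [s = 0] it is the integral of [Es 0] at [z 0]. *)
Let value z s := \int[P]_w (partial_cost z s w + Es s (z s w) w).

Let mE z s : adapted_from T F 0 z -> (s <= T)%N ->
  measurable_fun setT (fun w => Es s (z s w) w).
Proof.
move=> mz sT; have [nE _ _ _ _] := inv sT.
exact: (measurable_normal (HG sT) fXC (normal_ambient (HG sT) nE) (mz s sT)).
Qed.

Let lE (z : nat -> Omega -> X * C) s : (s <= T)%N -> integrable_below P (fun w => Es s (z s w) w).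
Proof. by move=> sT; have [_ le _ _ _] := inv sT; exact: integrable_below_normal. Qed.

Let valueE z s : adapted_from T F 0 z -> (s < T)%N ->
  value z s = \int[P]_w (partial_cost z s w + Qs s (z s w) w).
Proof.
move=> mz sT; have sT' := ltnW sT.
have [mp lp] := partial_cost_ok mz sT'.
have [nQ _ lQ] := lbQ sT.
have mzs : rv (F s) (z s) by exact: mz.
have mQ := measurable_normal (HG sT') fXC nQ mzs.
have [_ /(_ _ (proj2 (rv_random_vector (proj1 (HG sT')) _) mzs))[_ I]] := ceQ sT.
rewrite /value !integral_integrable_belowD //; [|exact: integrable_below_normal|exact: mE|exact: lE].
by rewrite I //; exact: (sGT (proj1 (HG sT'))).
Qed.

Let value_nondecreasing z s : adapted_from T F 0 z -> (s < T)%N -> value z s <= value z s.+1.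
Proof.
move=> mz sT; rewrite valueE //; have sT' := ltnW sT.
have [mp lp] := partial_cost_ok mz sT'; have [mp' lp'] := partial_cost_ok mz sT.
have [nQ _ lQ] := lbQ sT.
have mQ := measurable_normal (HG sT') fXC nQ (mz s sT').
apply: integral_ae_le => //.
- exact: emeasurable_funD.
- by apply: emeasurable_funD => //; exact: mE.
apply: filterS (QE sT) => w Qw.
rewrite /partial_cost [in leRHS]big_nat_recr //= -addeA leeD2l // Qw.
exact: stage_value_le.
Qed.

Let value_optimal z s : adapted_from T F 0 z -> {ae P, forall w, is_stage_optimal z w} ->
  (s < T)%N -> value z s.+1 <= value z s.
Proof.
move=> mz oz sT; rewrite [leRHS]valueE //; have sT' := ltnW sT.
have [mp lp] := partial_cost_ok mz sT'; have [mp' lp'] := partial_cost_ok mz sT.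
have [nQ _ lQ] := lbQ sT.
have mQ := measurable_normal (HG sT') fXC nQ (mz s sT').
apply: integral_ae_le => //.
- by apply: emeasurable_funD => //; exact: mE.
- exact: emeasurable_funD.
apply: filterS2 (QE sT) oz => w Qw ow.
rewrite /partial_cost [in leLHS]big_nat_recr //= -addeA leeD2l // Qw.
exact: ow.
Qed.

(** [value] is nondecreasing in time for every adapted process and nonincreasing along a stagewise
    optimal one, so the comparison reduces to time 0, where [z] minimizes [Es 0] pointwise. *)
Lemma optimal_cost : exists2 z, adapted_from T F 0 z & forall z', adapted_from T F 0 z' ->
  \int[P]_w (\sum_(1 <= t < T.+1) K t (z t.-1 w, (z t w).1) w + J (z T w).1 w) <=
  \int[P]_w (\sum_(1 <= t < T.+1) K t (z' t.-1 w, (z' t w).1) w + J (z' T w).1 w).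
Proof.
have [z [mz oz mz0]] := optimal_process; exists z => // z' mz'.
have vT y : value y T =
    \int[P]_w (\sum_(1 <= t < T.+1) K t (y t.-1 w, (y t w).1) w + J (y T w).1 w).
  by rewrite /value ET.
rewrite -!vT.
have up s : (s <= T)%N -> value z s <= value z 0.
  elim: s => [//|s IH sT]; apply: le_trans (IH (ltnW sT)); exact: value_optimal.
have down s : (s <= T)%N -> value z' 0 <= value z' s.
  elim: s => [//|s IH sT]; apply: le_trans (IH (ltnW sT)) _; exact: value_nondecreasing.
apply: le_trans (up T (leqnn T)) _; apply: le_trans (down T (leqnn T)).
have [mp lp] := partial_cost_ok mz (leq0n T); have [mp' lp'] := partial_cost_ok mz' (leq0n T).
apply: integral_ae_le => //.
- by apply: emeasurable_funD => //; exact: mE.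
- by apply: emeasurable_funD => //; exact: mE.
apply: filterS mz0 => w H.
by rewrite /partial_cost !big_geq // !add0e.
Qed.

Lemma bellman_solution_exists : exists Jt Q, bellman_solution P T F K J Jt Q.
Proof.
have H t : exists Jn : X -> Omega -> \bar R, (t <= T)%N ->
    lb_convex_normal_integrand P measurable Jn /\
    {ae P, forall w, forall x, Jn x w = inf_control (Es t ^~ w) x}.
  have [tT|tT] := boolP (t <= T)%N; last by exists J.
  by have [Jn h1 h2] := control_minimum HF HK K0 Hsym tT (inv tT); exists Jn.
have [Jt JtP] := choice H.
have JtE : {ae P, forall w, forall t, (t <= T)%N -> forall x, Jt t x w = inf_control (Es t ^~ w) x}.
  apply: ae_all => t; have [tT|tT] := boolP (t <= T)%N; last by apply: aeW.
  by have [_] := JtP t tT; apply: filterS => w.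
have QtE : {ae P, forall w, forall t, (t < T)%N -> forall z,
    Qs t z w = stage_value (K t.+1 ^~ w) (Es t.+1 ^~ w) z}.
  apply: ae_all => t; have [tT|tT] := boolP (t < T)%N; last by apply: aeW.
  by have := QE tT; apply: filterS => w.
exists Jt, Qs; split.
- by move=> t /JtP[].
- by move=> t /lbQ.
exists Es; first by move=> t /ceQ.
apply: filterS2 JtE QtE => w Jw Qw; split.
  move=> x; rewrite Jw // ET /inf_control.
  (* The terminal control is a dummy; the space of controls is nonempty, so the infimum is over one
     value. *)
  have -> : [set J x w | _ in [set: C]] = [set J x w].
    by rewrite predeqE => y; split => [[v _ <-]//|->]; exists 0%R.
  exact: ereal_inf1.
move=> t tT x u; split; last by rewrite Jw // ltnW.
rewrite Qw // /stage_value; congr ereal_inf; apply: eq_imagel => y _.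
by rewrite Jw.
Qed.

End with_data.

End dynamic_programming.

(** * Uniqueness for the Bellman equations *)

Section uniqueness.
Context {d} {Omega : measurableType d} {R : realType} (P : probability Omega R).
Context (N M T : nat) (F : nat -> set (set Omega)) (HF : filtration T F).
Local Notation X := ('rV[R]_N).
Local Notation C := ('rV[R]_M).
Context (K : nat -> X * C * X -> Omega -> \bar R) (J : X -> Omega -> \bar R).

Lemma bellman_solution_unique Jt Q Jt' Q' :
  bellman_solution P T F K J Jt Q -> bellman_solution P T F K J Jt' Q' ->
  {ae P, forall w,
    (forall t, (t <= T)%N -> forall x, Jt' t x w = Jt t x w) /\
    (forall t, (t < T)%N -> forall z, Q' t z w = Q t z w)}.
Proof.
move=> [lJ lQ [EQ cE eqs]] [lJ' lQ' [EQ' cE' eqs']].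
have fXC : findim (('rV[R]_N * 'rV[R]_M)%type : normedModType R) by exact: (findim_prod (@findim_rV R N) (@findim_rV R M)).
have QofJ t : (t < T)%N -> {ae P, forall w, forall x, Jt' t.+1 x w = Jt t.+1 x w} ->
    {ae P, forall w, forall z, Q' t z w = Q t z w}.
  move=> tT JJ; apply: filterS3 eqs eqs' JJ => w [_ e1] [_ e2] JJ [x u].
  rewrite (proj1 (e1 t tT x u)) (proj1 (e2 t tT x u)).
  by congr ereal_inf; apply: eq_imagel => y _; rewrite JJ.
have JJ n : (n <= T)%N -> {ae P, forall w, forall x, Jt' (T - n)%N x w = Jt (T - n)%N x w}.
  elim: n => [_|n IH nT].
    by apply: filterS2 eqs eqs' => w [e1 _] [e2 _] x; rewrite subn0 e1 e2.
  have tT : (T - n.+1 < T)%N by rewrite ltn_subrL (leq_ltn_trans _ nT).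
  have QQ : {ae P, forall w, forall z, Q' (T - n.+1)%N z w = Q (T - n.+1)%N z w}.
    by apply: QofJ => //; rewrite subnSK //; exact: IH (ltnW nT).
  have HG : Defs.sub_sigma_algebra (F (T - n.+1)%N) by case: HF => H _; apply: H; exact: leq_subr.
  have [nQ _ _] := lQ _ tT; have [nQ' _ _] := lQ' _ tT.
  have EE := cond_expectation_unique HG fXC nQ' nQ (cE' _ tT) (cE _ tT) QQ.
  apply: filterS3 eqs eqs' EE => w [_ e1] [_ e2] EE x.
  (* The two equations share one quantification over controls; the zero control is a placeholder for
     the one that does not mention it. *)
  rewrite (proj2 (e1 _ tT x 0%R)) (proj2 (e2 _ tT x 0%R)).
  by congr ereal_inf; apply: eq_imagel => v _; rewrite EE.
have JA : {ae P, forall w, forall t, (t <= T)%N -> forall x, Jt' t x w = Jt t x w}.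
  apply: ae_all => t; have [tT|tT] := boolP (t <= T)%N; last by apply: aeW.
  by have := JJ (T - t)%N (leq_subr _ _); rewrite subKn //; apply: filterS => w.
have QA : {ae P, forall w, forall t, (t < T)%N -> forall z, Q' t z w = Q t z w}.
  apply: ae_all => t; have [tT|tT] := boolP (t < T)%N; last by apply: aeW.
  have := QofJ t tT; have JJt : {ae P, forall w, forall x, Jt' t.+1 x w = Jt t.+1 x w}.
    by apply: filterS JA => w; apply.
  by move=> /(_ JJt); apply: filterS => w.
by apply: filterS2 JA QA => w.
Qed.

End uniqueness.

(** * From the linearity assumption to the stagewise condition *)

Section recession_directions_of_processes.
Context {d} {Omega : measurableType d} {R : realType} (P : probability Omega R).
Context (N M T : nat) (F : nat -> set (set Omega)) (HF : filtration T F).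
Local Notation X := ('rV[R]_N).
Local Notation C := ('rV[R]_M).
Context (K : nat -> X * C * X -> Omega -> \bar R) (J : X -> Omega -> \bar R).
Hypotheses (HK : forall t, (1 <= t <= T)%N -> lb_convex_normal_integrand P (F t) (K t))
  (HJ : lb_convex_normal_integrand P (F T) J)
  (HKdom : forall t, (1 <= t <= T)%N -> {ae P, forall w, dom (K t ^~ w) !=set0})
  (HJdom : {ae P, forall w, dom (J ^~ w) !=set0}).

Definition process_of (z : nat -> Omega -> X * C) : process Omega R N M :=
  (fun t w => (z t w).1, fun t w => (z t w).2).

Lemma adapted_process_of z : adapted T F (process_of z) <-> adapted_from T F 0 z.
Proof.
have HG t : (t <= T)%N -> Defs.sub_sigma_algebra (F t) by case: HF => H _; exact: H.
have E t : (fun w => ((process_of z).1 t w, (process_of z).2 t w)) = z t.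
  by apply/funext => w; rewrite /= -surjective_pairing.
split=> [H t /andP[_ tT]|H t tT].
  by have := H t tT; rewrite E => /(rv_random_vector (proj1 (HG t tT))).
by rewrite E; apply/(rv_random_vector (proj1 (HG t tT))); exact: H.
Qed.

Let recession_ok {V : normedModType R} (G : set (set Omega)) (h : V -> Omega -> \bar R) :
  lb_convex_normal_integrand P G h -> {ae P, forall w, dom (h ^~ w) !=set0} ->
  {ae P, forall w, forall x, 0 <= recession (h ^~ w) x /\
    (recession (h ^~ w) x <= 0 <-> fun_reccone (h ^~ w) x)}.
Proof.
move=> [nh xh lh] dh; apply: filterS2 (lower_bounded_real lh) dh => w [m hm] dw x.
have xw := proj1 (convex_setP _) (xh w).
split; first exact: (recession_ge0 xw dw hm).
exact: (recession_le0P (proj1 nh w) xw dw hm).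
Qed.

(** All recession functions involved are nonnegative almost surely, so their sum is nonpositive iff
    each of them is. *)
Lemma recession_directionsP z : adapted_from T F 0 z ->
  recession_directions P T F K J (process_of z) <-> {ae P, forall w, recession_tail T K J 0 z w}.
Proof.
move=> mz.
have okK : {ae P, forall w, forall t, (1 <= t <= T)%N -> forall x, 0 <= recession (K t ^~ w) x /\
    (recession (K t ^~ w) x <= 0 <-> fun_reccone (K t ^~ w) x)}.
  apply: ae_all => t; have [tT|tT] := boolP (1 <= t <= T)%N; last by apply: aeW.
  by have := recession_ok (HK tT) (HKdom tT); apply: filterS => w.
have okJ := recession_ok HJ HJdom.
have tripleE t w : ((process_of z).1 t.-1 w, (process_of z).2 t.-1 w, (process_of z).1 t w) =
   (z t.-1 w, (z t w).1) by rewrite /= -surjective_pairing.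
split=> [[_ H]|H].
  apply: filterS3 okK okJ H => w HKw HJw le.
  pose a t := recession (K t ^~ w)
    ((process_of z).1 t.-1 w, (process_of z).2 t.-1 w, (process_of z).1 t w).
  have le0 : \sum_(1 <= t < T.+1) a t + recession (J ^~ w) ((process_of z).1 T w) <= 0 := le.
  have a0 t : (1 <= t < T.+1)%N -> 0 <= a t by move=> tT; have [] := HKw t tT
    ((process_of z).1 t.-1 w, (process_of z).2 t.-1 w, (process_of z).1 t w).
  have s0 : 0 <= \sum_(1 <= t < T.+1) a t by rewrite big_nat; apply: sume_ge0.
  have [j0 jP] := HJw ((process_of z).1 T w).
  split; last by apply: (proj1 jP); apply: le_trans le0; rewrite leeDr.
  move=> t /andP[t0 tT]; have tT' : (1 <= t <= T)%N by rewrite t0.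
  rewrite -tripleE; apply: (proj1 (proj2 (HKw t tT' _))); apply: le_trans le0.
  have h : a t <= \sum_(1 <= t < T.+1) a t.
    rewrite (bigD1_seq t) ?iota_uniq ?mem_index_iota //= leeDl //.
    by rewrite big_seq_cond; apply: sume_ge0 => i /andP[+ _]; rewrite mem_index_iota; exact: a0.
  by apply: (le_trans h); rewrite leeDl.
split; first exact/adapted_process_of.
apply: filterS3 okK okJ H => w HKw HJw [tK tJ].
rewrite -[leRHS]adde0; apply: leeD; last exact: (proj2 (proj2 (HJw _)) tJ).
rewrite big_nat; apply: sume_le0 => t tT.
apply: (proj2 (proj2 (HKw t tT _))).
have := tK t tT; rewrite -tripleE; exact.
Qed.

Lemma recession_tail_opp (Hlin : GRing.submod_closed (mem (recession_directions P T F K J))) z :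
  adapted_from T F 0 z -> {ae P, forall w, recession_tail T K J 0 z w} ->
  {ae P, forall w, recession_tail T K J 0 (fun r w => - z r w)%R w}.
Proof.
move=> mz tz.
have HG t : (t <= T)%N -> Defs.sub_sigma_algebra (F t) by case: HF => H _; exact: H.
have fXC : findim (('rV[R]_N * 'rV[R]_M)%type : normedModType R).
  exact: (findim_prod (@findim_rV R N) (@findim_rV R M)).
have mN : adapted_from T F 0 (fun r w => - z r w)%R.
  by move=> r /andP[_ rT]; apply: (rv_opp (proj1 (HG r rT)) fXC); exact: mz.
apply/(recession_directionsP mN).
have [Z0 ZL] := Hlin.
have Zz : recession_directions P T F K J (process_of z) by apply/(recession_directionsP mz).
have Zn := set_mem (ZL (-1)%R (process_of z) 0%R (mem_set Zz) Z0).
have <- : ((-1)%R *: process_of z + 0)%R = process_of (fun r w => - z r w)%R; last exact: Zn.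
rewrite addr0 scaleN1r /process_of; congr pair; by do 2 apply/funext=> ?.
Qed.

End recession_directions_of_processes.

Lemma lb_convex_normal_integrand0 {d} {Omega : measurableType d} {R : realType}
    (P : probability Omega R) {V : normedModType R} (G : set (set Omega)) :
  sigma_algebra setT G -> lb_convex_normal_integrand P G (fun (_ : V) (_ : Omega) => 0).
Proof.
move=> sG; split.
- apply/normal_integrand_measurable_cmap; apply: (measurable_cmap_cst sG).
  have -> : epi (fun _ : V => 0) = [set p : V * R^o | (0 : R^o) <= p.2]%R.
    by apply/seteqP; split=> p /=; rewrite /epi /= -lee_fin.
  by apply: closed_leset => x; [exact: cst_continuous|exact: cvg_snd].
- move=> w; apply/convex_setP => t x y /andP[t0 t1]; rewrite /epi /= -![_ <= _]lee_fin => x0 y0.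
  by apply: addr_ge0; apply: mulr_ge0; rewrite ?subr_ge0.
- exists (fun=> 0%R); first exact: finite_measure_integrable_cst.
  exact: aeW.
Qed.

(** [HKdom] and [HJdom] express the convention that a recession function is written for a nonempty
    domain only; [Hlin] states linearity inside the module of all processes. *)
Theorem theorem10 (R : realType) (d : measure_display)
  (Omega : measurableType d) (P : probability Omega R)
  (N M T : nat) (F : nat -> set (set Omega))
  (HF : filtration T F)
  (HF0 : forall A, F 0%N A -> P A = 0 \/ P A = 1)
  (K : nat -> 'rV[R]_N * 'rV[R]_M * 'rV[R]_N -> Omega -> \bar R)
  (HK : forall t, (1 <= t <= T)%N -> lb_convex_normal_integrand P (F t) (K t))
  (J : 'rV[R]_N -> Omega -> \bar R)
  (HJ : lb_convex_normal_integrand P (F T) J)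
  (HKdom : forall t, (1 <= t <= T)%N ->
     {ae P, forall w, dom (K t ^~ w) !=set0})
  (HJdom : {ae P, forall w, dom (J ^~ w) !=set0})
  (Hlin : GRing.submod_closed (mem (recession_directions P T F K J))) :
  (exists Z, solution P T F K J Z) /\
  exists Jt Q, bellman_solution P T F K J Jt Q /\
    forall Jt' Q', bellman_solution P T F K J Jt' Q' ->
      {ae P, forall w,
        (forall t, (t <= T)%N -> forall x, Jt' t x w = Jt t x w) /\
        (forall t, (t < T)%N -> forall z, Q' t z w = Q t z w)}.
Proof.
(* [K 0] is arbitrary, whereas the recursion wants the zero cost there; costs from time 1 on are
   unchanged. *)
pose K' t : 'rV[R]_N * 'rV[R]_M * 'rV[R]_N -> Omega -> \bar R :=
  if t is t'.+1 then K t'.+1 else (fun _ _ => 0).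
have K'E t : (0 < t)%N -> K' t = K t by case: t.
have HK' t : (t <= T)%N -> lb_convex_normal_integrand P (F t) (K' t).
  case: t => [t0|t tT]; last exact: HK.
  by apply: lb_convex_normal_integrand0; case: HF => /(_ 0%N t0)[].
have tailE z w : recession_tail T K' J 0 z w <-> recession_tail T K J 0 z w.
  by split=> -[tK tJ]; split=> // r rT; have := tK r rT; rewrite K'E //; case/andP: rT.
have Hsym z : adapted_from T F 0 z -> {ae P, forall w, recession_tail T K' J 0 z w} ->
    {ae P, forall w, recession_tail T K' J 0 (fun r w => - z r w)%R w}.
  move=> mz tz; have tz' : {ae P, forall w, recession_tail T K J 0 z w}.
    by apply: filterS tz => w /tailE.
  by apply: filterS (recession_tail_opp HF HK HJ HKdom HJdom Hlin mz tz') => w /tailE.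
have [Es [Qs ES]] := stage_data_exists HF HK' HJ HJdom erefl Hsym.
split.
  have [z mz zmin] := optimal_cost HF HK' erefl Hsym ES.
  have costE y : \int[P]_w (\sum_(1 <= t < T.+1) K' t (y t.-1 w, (y t w).1) w + J (y T w).1 w) =
      cost P T K J (process_of y).
    apply: eq_integral => w _; congr (_ + _); apply: eq_big_nat => t /andP[t0 _].
    by rewrite K'E //= -surjective_pairing.
  exists (process_of z); split; first exact/adapted_process_of.
  move=> Z aZ; pose z' t w := (Z.1 t w, Z.2 t w).
  have ZE : process_of z' = Z by case: Z {aZ} @z'.
  rewrite -ZE -!costE; apply: zmin.
  by apply/(adapted_process_of HF); rewrite ZE.
have [Jt [Q JQ]] := bellman_solution_exists HF HK' erefl Hsym ES.
exists Jt, Q; split; first exact: JQ.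
move=> Jt' Q' JQ'; exact: (bellman_solution_unique HF JQ JQ').
Qed.
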